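(* Let $X$ be a connected aspherical CW-complex which is locally finite or countable. Then $X$ has the distinguished path property (dpp).
   Context: A CW-complex is locally finite if every point is contained in a finite number of (closed) cells, and countable if it has countably many cells. A space $X$ is aspherical if it is path connected and $\pi_n(X)=0$ for all $n\geq 2$. For a path connected, locally path connected and semilocally simply connected space $X$ (for example a connected CW-complex), an open subset $U\subseteq X$ is nice if it is path connected and the inclusion induces the trivial map $\pi_1(U,x)\to\pi_1(X,x)$ for every $x\in U$; the nice open sets form a basis of the topology. Let $I=[0,1]$ and let $X^I$ be the space of all continuous paths $I\to X$ with the compact-open topology. $\Pi(X)$ is the set of homotopy classes relative to endpoints $[\gamma]$ of paths $\gamma:I\to X$, with the topology having as basis the sets $S(U,V,[\gamma])=\{[\delta_1*\gamma*\delta_2]\}$, where $U,V\subseteq X$ are nice open sets, $\gamma$ is a path with $\gamma(0)\in U$ and $\gamma(1)\in V$, and $\delta_1$ (resp. $\delta_2$) ranges over the paths contained in $U$ ending at $\gamma(0)$ (resp. contained in $V$ starting at $\gamma(1)$); $*$ is concatenation. Let $q:X^I\to\Pi(X)$ be the quotient map $q(\gamma)=[\gamma]$. $X$ has the distinguished path property (dpp) if there is a continuous map $g:\Pi(X)\to X^I$ with $q\circ g=\mathrm{id}$. *)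

(* Defs.v *)
From HB Require Import structures.
From mathcomp Require Import all_boot all_order all_algebra.
From mathcomp Require Import generic_quotient.
From mathcomp Require Import all_classical all_reals all_analysis.
From mathcomp Require Import lra.
Import Order.TTheory GRing.Theory Num.Theory.
Import numFieldNormedType.Exports.

Set Implicit Arguments.
Unset Strict Implicit.
Unset Printing Implicit Defensive.

Local Open Scope classical_set_scope.
Local Open Scope ring_scope.
Local Open Scope quotient_scope.

Section UnitInterval.
Variable R : realType.

Definition unitI : topologicalType := (`[0%R, 1%R]%classic : set R).

Definition ival (t : unitI) : R := set_val t.

Lemma ival_ge0 (t : unitI) : 0 <= ival t.
Proof. by case: t => x /[dup] /set_mem /=; rewrite in_itv /= => /andP[]. Qed.

Lemma ival_le1 (t : unitI) : ival t <= 1.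
Proof. by case: t => x /[dup] /set_mem /=; rewrite in_itv /= => /andP[]. Qed.

Lemma ival_inj : injective ival.
Proof. exact: val_inj. Qed.

Lemma ival_continuous : continuous ival.
Proof. exact: initial_continuous. Qed.

Fact clamp_subproof (x : R) : Num.max 0 (Num.min x 1) \in `[0%R, 1%R]%classic.
Proof.
by rewrite inE /= in_itv /= le_max lexx /= ge_max ler01 ge_min lexx orbT.
Qed.

(* retraction of the line onto the unit interval *)
Definition clamp (x : R) : unitI :=
  exist (fun y : R => y \in `[0%R, 1%R]%classic) _ (clamp_subproof x).

Lemma clampE (x : R) : 0 <= x <= 1 -> ival (clamp x) = x.
Proof.
move=> /andP[x0 x1]; rewrite [LHS](_ : _ = Num.max 0 (Num.min x 1)) //.
by rewrite (min_l x1) (max_r x0).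
Qed.

Lemma clamp_continuous : continuous clamp.
Proof.
apply: continuous_comp_initial => x.
apply: (@continuous_max R R (cst 0) (fun y => Num.min y 1)); first exact: cvg_cst.
by apply: (@continuous_min R R id (cst 1)); [exact: cvg_id|exact: cvg_cst].
Qed.

Lemma rescale_continuous (f : R -> R) :
  continuous f -> continuous (fun t => clamp (f (ival t))).
Proof.
move=> cf t; apply: (@continuous_comp _ _ _ (f \o ival) clamp).
  by apply: continuous_comp; [exact: ival_continuous|exact: cf].
exact: clamp_continuous.
Qed.

Definition I0 : unitI := clamp 0.
Definition I1 : unitI := clamp 1.

Lemma ival0 : ival I0 = 0. Proof. by rewrite clampE // lexx ler01. Qed.
Lemma ival1 : ival I1 = 1. Proof. by rewrite clampE // lexx ler01. Qed.

(* the two halves of the unit interval, rescaled *)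
Definition lhalf (t : unitI) : unitI := clamp (2 * ival t).
Definition rhalf (t : unitI) : unitI := clamp (2 * ival t - 1).

Lemma lhalf_continuous : continuous lhalf.
Proof.
apply: (@rescale_continuous (fun x => 2 * x)) => x.
exact: cvgMl_tmp.
Qed.

Lemma rhalf_continuous : continuous rhalf.
Proof.
apply: (@rescale_continuous (fun x => 2 * x - 1)) => x.
by apply: cvgB; [exact: cvgMl_tmp|exact: cvg_cst].
Qed.

Lemma lhalf0 : lhalf I0 = I0.
Proof. by rewrite /lhalf ival0 mulr0. Qed.

Lemma rhalf1 : rhalf I1 = I1.
Proof. by rewrite /rhalf ival1; congr clamp; lra. Qed.

Lemma lhalf_mid t : ival t = 2^-1 -> lhalf t = I1.
Proof. by move=> tE; rewrite /lhalf tE; congr clamp; lra. Qed.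

Lemma rhalf_mid t : ival t = 2^-1 -> rhalf t = I0.
Proof. by move=> tE; rewrite /rhalf tE; congr clamp; lra. Qed.

Definition irev (t : unitI) : unitI := clamp (1 - ival t).

Lemma irev_continuous : continuous irev.
Proof.
apply: (@rescale_continuous (fun x => 1 - x)) => x.
by apply: cvgB; [exact: cvg_cst|exact: cvg_id].
Qed.

Lemma irev0 : irev I0 = I1.
Proof. by rewrite /irev ival0 subr0. Qed.

Lemma irev1 : irev I1 = I0.
Proof. by rewrite /irev ival1 subrr. Qed.

Lemma paste_continuous (T X : topologicalType) (phi : T -> unitI)
    (a b : T -> X) :
  continuous phi -> continuous a -> continuous b ->
  (forall t, ival (phi t) = 2^-1 -> a t = b t) ->
  continuous (fun t => if ival (phi t) <= 2^-1 then a t else b t).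
Proof.
move=> cphi ca cb ab.
have cv : continuous (ival \o phi).
  by move=> t; apply: continuous_comp; [exact: cphi|exact: ival_continuous].
pose A := (ival \o phi) @^-1` [set x | x <= 2^-1].
pose B := (ival \o phi) @^-1` [set x | 2^-1 <= x].
have clA : closed A by apply: preimage_closed => //; exact: closed_le.
have clB : closed B by apply: preimage_closed => //; exact: closed_ge.
have AB : A `|` B = setT.
  by apply/seteqP; split => // t _; case: (leP (ival (phi t)) 2^-1) => h;
    [left|right => /=; exact: ltW].
apply/continuous_subspace_setT; rewrite -AB.
apply: withinU_continuous => //.
  apply: (@subspace_eq_continuous _ _ _ a); last exact: continuous_subspaceT.
  by move=> t /set_mem tA; rewrite /from_subspace ifT.
apply: (@subspace_eq_continuous _ _ _ b); last exact: continuous_subspaceT.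
move=> t /set_mem tB; rewrite /from_subspace; case: ifPn => // tA.
by rewrite ab //; apply: le_anti; rewrite tA tB.
Qed.

End UnitInterval.

Arguments I0 {R}.
Arguments I1 {R}.

Section Homotopy.
Variables (R : realType) (S X : topologicalType) (A : set S).
Implicit Types f g h : continuousType S X.

Definition homotopic_rel f g := exists H : unitI R * S -> X,
  [/\ continuous H,
      forall s, H (I0, s) = f s,
      forall s, H (I1, s) = g s
    & forall t s, A s -> H (t, s) = f s].

Let rescale_fst_continuous (r : unitI R -> unitI R) :
  continuous r -> continuous (fun ts : unitI R * S => (r ts.1, ts.2)).
Proof.
move=> cr ts; apply: (@cvg_pair _ _ _ (nbhs ts) (nbhs (r ts.1)) (nbhs ts.2)
  _ _ _ (fun ts : unitI R * S => r ts.1) snd).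
  by apply: continuous_comp; [exact: cvg_fst|exact: cr].
exact: cvg_snd.
Qed.

Lemma homotopic_rel_refl f : homotopic_rel f f.
Proof.
exists (fun ts => f ts.2); split => // ts.
by apply: continuous_comp; [exact: cvg_snd|exact: cts_fun].
Qed.

Lemma homotopic_rel_sym f g : homotopic_rel f g -> homotopic_rel g f.
Proof.
move=> [H [cH H0 H1 HA]]; exists (fun ts => H (irev ts.1, ts.2)); split.
- move=> ts; apply: (@continuous_comp _ _ _ (fun ts => (irev ts.1, ts.2)) H).
    exact/rescale_fst_continuous/irev_continuous.
  exact: cH.
- by move=> s; rewrite irev0.
- by move=> s; rewrite irev1.
- by move=> t s As; rewrite HA // -H1 HA.
Qed.

Lemma homotopic_rel_trans f g h :
  homotopic_rel f g -> homotopic_rel g h -> homotopic_rel f h.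
Proof.
move=> [H [cH H0 H1 HA]] [K [cK K0 K1 KA]].
have cr (F : unitI R * S -> X) (r : unitI R -> unitI R) :
    continuous F -> continuous r -> continuous (fun ts => F (r ts.1, ts.2)).
  move=> cF cr ts; apply: (@continuous_comp _ _ _ (fun ts => (r ts.1, ts.2)) F).
    exact: rescale_fst_continuous.
  exact: cF.
exists (fun ts => if ival ts.1 <= 2^-1 then H (lhalf ts.1, ts.2)
                  else K (rhalf ts.1, ts.2)); split.
- apply: (@paste_continuous R _ _ fst).
  + by move=> ts; exact: cvg_fst.
  + exact: (cr _ _ cH (@lhalf_continuous R)).
  + exact: (cr _ _ cK (@rhalf_continuous R)).
  + by move=> ts e; rewrite (lhalf_mid e) (rhalf_mid e) H1 K0.
- by move=> s /=; rewrite ival0 invr_ge0 ler0n lhalf0.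
- move=> s /=; rewrite ival1 ifF ?rhalf1 //.
  by apply/negbTE; rewrite -ltNge invf_lt1 ?ltr1n.
- move=> t s As /=; case: ifP => _; first exact: HA.
  by rewrite KA // -H1 HA.
Qed.

Definition homotopic_relb f g : bool := `[< homotopic_rel f g >].

Lemma homotopic_relb_refl : reflexive homotopic_relb.
Proof. by move=> f; apply/asboolP/homotopic_rel_refl. Qed.

Lemma homotopic_relb_sym : symmetric homotopic_relb.
Proof.
by move=> f g; apply/asboolP/asboolP; exact: homotopic_rel_sym.
Qed.

Lemma homotopic_relb_trans : transitive homotopic_relb.
Proof.
by move=> g f h /asboolP fg /asboolP gh; apply/asboolP/(homotopic_rel_trans fg gh).
Qed.

End Homotopy.

Section Paths.
Variables (R : realType) (X : topologicalType).

(* X^I with the compact-open topology *)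
Definition path_space := continuousType (unitI R) X.

HB.instance Definition _ := Choice.on path_space.
HB.instance Definition _ := Topological.copy path_space
  (@initial_topology path_space {compact-open, unitI R -> X} id).

Definition path_of (f : unitI R -> X) (cf : continuous f) : path_space :=
  mkcts cf.

Definition cst_path (x : X) : path_space := cst x.

Section Concat.
Variables (c d : path_space) (cd : c I1 = d I0).

Definition concat_fun (t : unitI R) : X :=
  if ival t <= 2^-1 then c (lhalf t) else d (rhalf t).

Lemma concat_continuous : continuous concat_fun.
Proof.
apply: (@paste_continuous R _ _ id).
- by move=> t; exact: cvg_id.
- by move=> t; apply: continuous_comp; [exact: lhalf_continuous|exact: cts_fun].
- by move=> t; apply: continuous_comp; [exact: rhalf_continuous|exact: cts_fun].
- by move=> t e; rewrite (lhalf_mid e) (rhalf_mid e).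
Qed.

Definition concat : path_space := path_of concat_continuous.

Lemma concatE (t : unitI R) :
  concat t = if ival t <= 2^-1 then c (lhalf t) else d (rhalf t).
Proof. by []. Qed.

Lemma concat0 : concat I0 = c I0.
Proof. by rewrite concatE ival0 invr_ge0 ler0n lhalf0. Qed.

Lemma concat1 : concat I1 = d I1.
Proof.
rewrite concatE ival1 ifF ?rhalf1 //.
by apply/negbTE; rewrite -ltNge invf_lt1 ?ltr1n.
Qed.

End Concat.

Definition endpoints : set (unitI R) := [set I0; I1].

Canonical path_homotopy_equiv := EquivRel
  (@homotopic_relb R _ X endpoints : rel path_space)
  (@homotopic_relb_refl R _ X endpoints)
  (@homotopic_relb_sym R _ X endpoints)
  (@homotopic_relb_trans R _ X endpoints).

Definition path_classes := {eq_quot path_homotopy_equiv}.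

HB.instance Definition _ := Choice.on path_classes.

Definition path_class (c : path_space) : path_classes := \pi_path_classes c.

Definition path_in (U : set X) (c : path_space) := forall t, U (c t).

Definition path_connected (U : set X) := forall x y, U x -> U y ->
  exists c : path_space, [/\ path_in U c, c I0 = x & c I1 = y].

(* The last clause is the triviality of pi_1(U, x) -> pi_1(X, x) for all x in
   U: a loop in U represents the trivial class in X. *)
Definition nice (U : set X) := [/\ open U, path_connected U &
  forall (x : X) (c : path_space), U x -> path_in U c -> c I0 = x -> c I1 = x ->
    path_class c = path_class (cst_path x)].

Definition basic_open (U V : set X) (c : path_space) : set path_classes :=
  [set p | exists (d1 d2 : path_space) (e1 : d1 I1 = c I0) (e2 : c I1 = d2 I0),
     [/\ path_in U d1, path_in V d2 &
         p = path_class (concat (etrans (concat1 e1) e2))]].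

Definition basic_opens : set (set path_classes) :=
  [set B | exists (U V : set X) (c : path_space),
     [/\ nice U, nice V, U (c I0), V (c I1) & B = basic_open U V c]].

(* When the nice open sets form a basis of the topology of X, basic_opens is a
   basis of a topology, which is then the topology it generates as a subbasis.
   Using a subbasis makes this well defined for every X. *)
HB.instance Definition _ :=
  @isSubBaseTopological.Build path_classes (set path_classes) basic_opens id.

Definition dpp := exists g : path_classes -> path_space,
  continuous g /\ cancel g path_class.

End Paths.

Section HomotopyGroups.
Variables (R : realType) (n : nat).

Definition cube : topologicalType :=
  ([set v : 'rV[R]_n | forall i, 0 <= v 0 i <= 1] : set 'rV[R]_n).

Definition cube_boundary : set cube :=
  [set v | exists i, (set_val v : 'rV[R]_n) 0 i = 0 \/
                     (set_val v : 'rV[R]_n) 0 i = 1].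

Variables (X : topologicalType) (x : X).

Definition spheroid :=
  {f : continuousType cube X | `[< forall v, cube_boundary v -> f v = x >]}.

HB.instance Definition _ := Choice.on spheroid.

Definition spheroid_homotopic : rel spheroid := fun f g =>
  homotopic_relb R cube_boundary (val f) (val g).

Lemma spheroid_homotopic_refl : reflexive spheroid_homotopic.
Proof. by move=> f; exact: homotopic_relb_refl. Qed.

Lemma spheroid_homotopic_sym : symmetric spheroid_homotopic.
Proof. by move=> f g; exact: homotopic_relb_sym. Qed.

Lemma spheroid_homotopic_trans : transitive spheroid_homotopic.
Proof. by move=> f g h; exact: homotopic_relb_trans. Qed.

Canonical spheroid_equiv := EquivRel spheroid_homotopic
  spheroid_homotopic_refl spheroid_homotopic_sym spheroid_homotopic_trans.

(* pi_n(X, x) as a set *)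
Definition homotopy_group := {eq_quot spheroid_equiv}.

Fact cst_spheroid_subproof :
  `[< forall v : cube, cube_boundary v -> cst x v = x >].
Proof. by apply/asboolP. Qed.

Definition cst_spheroid : spheroid := exist
  (fun f : continuousType cube X => `[< forall v, cube_boundary v -> f v = x >])
  (cst x : continuousType cube X) cst_spheroid_subproof.

Definition homotopy_group1 : homotopy_group := \pi_homotopy_group cst_spheroid.

End HomotopyGroups.

Definition aspherical (R : realType) (X : topologicalType) :=
  path_connected R [set: X] /\
  forall n (x : X) (a : homotopy_group R n x), (2 <= n)%N ->
    a = homotopy_group1 R n x.

Section CW.
Variable R : realType.

(* The library norm on row vectors is the sup norm, hence the explicit sums. *)
Definition sqnorm n (v : 'rV[R]_n) : R := \sum_(i < n) v 0 i ^+ 2.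
Definition disk n : set 'rV[R]_n := [set v | sqnorm v <= 1].
Definition open_disk n : set 'rV[R]_n := [set v | sqnorm v < 1].
Definition sphere n : set 'rV[R]_n := [set v | sqnorm v = 1].

Arguments disk : clear implicits.
Arguments open_disk : clear implicits.
Arguments sphere : clear implicits.

(* A CW structure on X, in J.H.C. Whitehead's form. The values of
   [char j] outside the disk are irrelevant. *)
Unset Implicit Arguments.
Record CW_structure (X : topologicalType) := {
  cell : Type;
  dim : cell -> nat;
  char : forall j, 'rV[R]_(dim j) -> X;
  open_cell := fun j => char j @` open_disk (dim j);
  closed_cell := fun j => char j @` disk (dim j);
  CW_hausdorff : hausdorff_space X;
  char_continuous : forall j, {within disk (dim j), continuous (char j)};
  (* char j restricts to a homeomorphism from the open disk to the open cell *)
  char_inj : forall j, set_inj (open_disk (dim j)) (char j);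
  char_open : forall j (O : set 'rV[R]_(dim j)), open O ->
    exists W : set X, open W /\
      char j @` (open_disk (dim j) `&` O) = open_cell j `&` W;
  cells_disjoint : trivIset [set: cell] open_cell;
  cells_cover : \bigcup_j open_cell j = [set: X];
  closure_finite : forall j, exists F : set cell,
    [/\ finite_set F, forall i, F i -> (dim i < dim j)%N
      & char j @` sphere (dim j) `<=` \bigcup_(i in F) open_cell i];
  weak_topology : forall A : set X,
    closed A <-> forall j, closed (A `&` closed_cell j)
}.
Set Implicit Arguments.

Definition locally_finite_CW X (K : CW_structure X) :=
  forall x : X, finite_set [set j : cell X K | closed_cell X K j x].

Definition countable_CW X (K : CW_structure X) := countable [set: cell X K].

End CW.

Arguments cell {R X} c.
Arguments dim {R X c} j : rename.
Arguments char {R X c} j _ : rename.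
Arguments open_cell {R X c} j : rename.
Arguments closed_cell {R X c} j : rename.

(* Main.v *)
(* A continuous section of q over Pi(X) is built cell by cell. The cells of Pi(X)
   are indexed by two cells of X and a homotopy class joining their centres;
   extending a section from the boundary of such a cell of dimension N means
   filling an (N + 1)-ball in X with prescribed boundary, which is possible by
   asphericity if N >= 2 and by the prescribed homotopy class if N = 1.
   The result is continuous along closed cells only, whereas Pi(X) locally carries
   the product topology of X * X. This is repaired with the flow of X that moves
   points radially outwards in their cells: after a fixed time every point has a
   neighbourhood that the flow has carried into finitely many closed cells. So one
   flows both endpoints, applies the cellular section, and flows back.
   The same flow, stopped on entering a small ball of a given cell, deforms an open
   set onto that ball; these sets form a basis of nice open sets. *)

From mathcomp Require Import all_boot all_order all_algebra.
From mathcomp Require Import generic_quotient finmap.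
From mathcomp Require Import all_classical all_reals all_analysis.
From mathcomp Require Import lra ring.
Require Import Defs.
Import Order.TTheory GRing.Theory Num.Theory.
Import numFieldNormedType.Exports.

Set Implicit Arguments.
Unset Strict Implicit.
Unset Printing Implicit Defensive.

Local Open Scope classical_set_scope.
Local Open Scope ring_scope.
Local Open Scope quotient_scope.

(** * Topological preliminaries *)

(** Continuity along closed cells does imply continuity on the set of classes lying over finitely
    many pairs of closed cells; a neighbourhood in [X] may meet infinitely many cells, and that is
    the whole obstacle. The flow removes it only if one fixed time serves all points, which is what
    scaling gives: points close to a given point of an open cell enter that cell after scaling by a
    factor close to 1, however many higher cells they cross. All radii [d] are at most 1, so the
    factor 2, reached at parameter [t = 1], always suffices. Openness of the set of points that
    enter a ball in time is the delicate part: the bare entry factor jumps at the edge of the ball,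
    while the entry factor weighted by 1 plus the distance from the entry point to the centre,
    truncated at [1 + d], is continuous. The flow, this depth function and the section come from one
    recursion: each point lies in exactly one open cell, and boundary points lie in open cells of
    smaller rank. No skeleta are formed. Two norms coexist: [nrm] is Euclidean and cuts out disks,
    the library norm is the sup norm and cuts out cubes. *)

Section Within.
Variables (Y Z : topologicalType).

Lemma within_closedP (A : set Y) (f : Y -> Z) : closed A ->
  {within A, continuous f} <->
  (forall C, closed C -> closed (A `&` f @^-1` C)).
Proof.
move=> clA; rewrite continuous_closedP.
by split=> h C cC; move: (h C cC); rewrite closed_setSI.
Qed.

Lemma within_continuousT (f : Y -> Z) :
  {within setT, continuous f} <-> continuous f.
Proof. by rewrite continuous_subspace_setT. Qed.

Lemma within_eq (A : set Y) (f g : Y -> Z) : (forall y, A y -> f y = g y) ->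
  {within A, continuous f} -> {within A, continuous g}.
Proof. by move=> fg; apply: subspace_eq_continuous => y /set_mem /fg. Qed.

Lemma within_cover (A B : set Y) (f : Y -> Z) : closed A -> closed B ->
  A `|` B = setT -> {within A, continuous f} -> {within B, continuous f} ->
  continuous f.
Proof.
by move=> ? ? AB ? ?; apply/within_continuousT; rewrite -AB; exact: withinU_continuous.
Qed.

Lemma within_comp (W : topologicalType) (A : set Y) (B : set W) (f : Y -> Z)
    (r : W -> Y) : {within B, continuous r} -> (forall w, B w -> A (r w)) ->
  {within A, continuous f} -> {within B, continuous (f \o r)}.
Proof.
move=> /subspace_continuousP cr rA /subspace_continuousP cf.
apply/subspace_continuousP => w Bw S fS.
have := cf _ (rA _ Bw) S fS; rewrite /= /nbhs /= /within /= => AS.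
have := cr _ Bw _ AS; rewrite /= /nbhs /= /within /=.
by apply: filterS => x xS Bx; exact: xS Bx (rA _ Bx).
Qed.

End Within.

Lemma continuous_pair (Y U V : topologicalType) (f : Y -> U) (g : Y -> V) :
  continuous f -> continuous g -> continuous (fun y => (f y, g y)).
Proof. by move=> cf cg y; apply: cvg_pair; [exact: cf|exact: cg]. Qed.

(** A continuous map from a compact set to a Hausdorff space is closed, hence a quotient map onto
    its image. All fillings and one lifting below are built on a convenient compact set and pushed
    down this way; [z0] is the value off the image. *)
Lemma compact_descend (Y Y' Z : topologicalType) (K : set Y) (k : Y -> Y')
    (f : Y -> Z) (z0 : Z) : compact K -> hausdorff_space Y' ->
  continuous k -> {within K, continuous f} ->
  (forall a b, K a -> K b -> k a = k b -> f a = f b) ->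
  exists g : Y' -> Z, (forall a, K a -> g (k a) = f a) /\
    {within k @` K, continuous g}.
Proof.
move=> cK hY ck cf kf.
pose g y := if pselect (exists2 a, K a & k a = y) is left e
  then f (projT1 (cid2 e)) else z0.
have gE a : K a -> g (k a) = f a.
  move=> Ka; rewrite /g; case: pselect => [e|[]]; last by exists a.
  by case: (cid2 e) => b Kb /= kb; exact: kf.
exists g; split=> //; apply/within_closedP.
  apply: compact_closed => //; apply: continuous_compact => //.
  exact: continuous_subspaceT.
move=> C cC; rewrite (_ : _ `&` _ = k @` (K `&` f @^-1` C)).
  apply: compact_closed => //; apply: continuous_compact.
    exact: continuous_subspaceT.
  rewrite -(_ : K `&` ((K `&` f @^-1` C) : set Y) = K `&` f @^-1` C); last first.
    by rewrite setIA setIid.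
  move: cf; rewrite continuous_closedP => /(_ _ cC).
  move=> /closed_subspaceP[V cV VK].
  rewrite setIA setIid (setIC K) -VK setIC.
  exact: compact_closedI.
apply/seteqP; split => [y [[a Ka <-]] /=|_ [a [Ka fa] <-]].
  by rewrite gE // => Ca; exists a.
by split; [exists a|rewrite /= gE].
Qed.

Lemma hausdorff_prod (U V : topologicalType) : hausdorff_space U ->
  hausdorff_space V -> hausdorff_space (U * V)%type.
Proof.
move=> hU hV [p1 p2] [q1 q2] pq; congr (_, _).
  apply: hU => A B pA qB.
  have [] := pq (A `*` setT) (B `*` setT).
  - by exists (A, setT) => //; split => //; exact: filterT.
  - by exists (B, setT) => //; split => //; exact: filterT.
  by move=> [x y] [[/= Ax _] [/= Bx _]]; exists x.
apply: hV => A B pA qB.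
have [] := pq (setT `*` A) (setT `*` B).
- by exists (setT, A) => //; split => //; exact: filterT.
- by exists (setT, B) => //; split => //; exact: filterT.
by move=> [x y] [[/= _ Ay] [/= _ By]]; exists y.
Qed.

Lemma compact_set_type (Y : topologicalType) (A : set Y) : compact A ->
  compact [set: A].
Proof.
move=> cA F PF _.
have FA : (set_val @ F) A.
  by apply: (@filterS _ F _ setT); [move=> y _; exact: set_valP|exact: filterT].
have [y [Ay cly]] := cA (set_val @ F) _ FA.
exists (exist _ y (mem_set Ay)); split => // S B FS [W [[N oN <-] /= Ny] NB].
have [z [[s Ss sz] Nz]] : (set_val @` S) `&` N !=set0.
  apply: cly; last exact: open_nbhs_nbhs.
  by apply: (@filterS _ F _ S _ _ FS) => s Ss; exists s.
by exists s; split => //; apply: NB => /=; rewrite sz.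
Qed.

Section UnitIntervalSpace.
Variable R : realType.
Notation I := (unitI R).

Lemma ivalK (t : I) : clamp (ival t) = t.
Proof. by apply: ival_inj; rewrite clampE // ival_ge0 ival_le1. Qed.

Lemma unitI_compact : compact [set: I].
Proof.
have -> : [set: I] = @clamp R @` `[0, 1].
  apply/seteqP; split => // t _; exists (ival t); last exact: ivalK.
  by rewrite /= in_itv /= ival_ge0 ival_le1.
apply: continuous_compact; last exact: segment_compact.
by apply: continuous_subspaceT; exact: clamp_continuous.
Qed.

Lemma unitI_hausdorff : hausdorff_space I.
Proof.
move=> s t st; apply: ival_inj; apply: (@Rhausdorff R) => A B sA tB.
have [u [uA uB]] := st (@ival R @^-1` A) (@ival R @^-1` B)
  (@ival_continuous R s _ sA) (@ival_continuous R t _ tB).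
by exists (ival u).
Qed.

Lemma unitI_locally_compact : locally_compact [set: I].
Proof.
move=> t _; rewrite withinET; exists [set: I]; first exact: filterT.
by split; [exact: unitI_compact|exact: closedT].
Qed.

Lemma clamp_le0 (x : R) : x <= 0 -> clamp x = I0.
Proof.
move=> x0; apply: ival_inj; rewrite ival0 /ival /=.
rewrite (_ : set_val _ = Num.max 0 (Num.min x 1)) //.
by rewrite min_l ?(le_trans x0) // max_l.
Qed.

Lemma clamp_ge1 (x : R) : 1 <= x -> clamp x = I1.
Proof.
move=> x1; apply: ival_inj; rewrite ival1 /ival /=.
rewrite (_ : set_val _ = Num.max 0 (Num.min x 1)) //.
by rewrite min_r // max_r.
Qed.

Lemma path_space_cvgP (X : topologicalType) (T : Type) (F : set_system T)
    (a : T -> path_space R X) (c : path_space R X) : Filter F ->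
  a @ F --> c <-> forall K O, compact K -> open O ->
    (forall t, K t -> O (c t)) -> \forall y \near F, forall t, K t -> O (a y t).
Proof.
move=> FF; split.
  move=> ac K O cK oO cKO.
  have nc : nbhs c [set d : path_space R X | forall t, K t -> O (d t)].
    apply: open_nbhs_nbhs; split => //.
    exists [set g : {compact-open, I -> X} | g @` K `<=` O].
      exact: compact_open_open.
    apply/seteqP; split => d /= h; first by move=> t Kt; apply: h; exists t.
    by move=> _ [t Kt <-]; exact: h.
  exact: ac _ nc.
move=> h.
pose j : path_space R X -> {compact-open, I -> X} := fun d : path_space R X => d : I -> X.
have jc : (j \o a) @ F --> j c.
  apply/compact_open_cvgP => K O cK oO cKO.
  have cKO' t : K t -> O (c t) by move=> Kt; apply: cKO; exists t.
  by apply: filterS (h K O cK oO cKO') => y hy _ [t Kt <-]; exact: hy.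
move=> S [U [[W oW <-] Wc] WS].
have nW : nbhs (j c) W by exact: (@open_nbhs_nbhs _ (j c)).
have := jc _ nW; rewrite /= !nbhs_simpl; apply: (@filterS _ F) => y Wy.
exact: WS.
Qed.

(** Tube lemma: the compact set of parameters is covered by finitely many boxes around [y]. With the
    converse below, which rests on local compactness of the interval, continuity of a family of
    paths can be checked on [Y * I]. *)
Lemma curry_path_continuous (Y X : topologicalType)
    (a : Y -> path_space R X) :
  continuous (fun yt : Y * I => a yt.1 yt.2) -> continuous a.
Proof.
move=> ca y; apply/path_space_cvgP => K O cK oO aO.
move: cK => /compact_near_coveringP/near_covering_withinP; apply => t Kt.
have := ca (y, t) O; rewrite /= => /(_ (open_nbhs_nbhs (conj oO (aO _ Kt)))).
move=> [[P Q] [/= Py Qt] PQ]; exists (Q, P) => // -[b d] /= [Qb Pd] Kb.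
exact: (PQ (d, b)).
Qed.

Lemma uncurry_path_continuous (Y X : topologicalType)
    (a : Y -> path_space R X) :
  continuous a -> continuous (fun yt : Y * I => a yt.1 yt.2).
Proof.
move=> ca.
have := @continuous_uncurry Y I X (fun y => a y : I -> X) unitI_locally_compact
  unitI_hausdorff.
have -> : uncurry (fun y : Y => a y : I -> X) = (fun yt : Y * I => a yt.1 yt.2).
  by apply/funext => -[].
apply; last by move=> y; exact: cts_fun.
move=> y; apply/compact_open_cvgP => K O cK oO cKO.
have cKO' t : K t -> O (a y t) by move=> Kt; apply: cKO; exists t.
have /path_space_cvgP/(_ K O cK oO cKO') := ca y.
by apply: filterS => z hz _ [t Kt <-]; exact: hz.
Qed.

End UnitIntervalSpace.

Section ContinuousOperations.
Variables (R : realType) (Y : topologicalType) (V : normedModType R).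
Implicit Types (f g : Y -> R) (u v : Y -> V).

Lemma cont_cst (Z : topologicalType) (z : Z) : continuous (fun _ : Y => z).
Proof. by move=> y; exact: cvg_cst. Qed.

Lemma cont_comp (Z W : topologicalType) (f : Y -> Z) (h : Z -> W) :
  continuous f -> continuous h -> continuous (fun y => h (f y)).
Proof.
move=> cf ch y; apply: (@continuous_comp _ _ _ f h); [exact: cf|exact: ch].
Qed.

Lemma cont_addv u v : continuous u -> continuous v ->
  continuous (fun y => u y + v y).
Proof. by move=> cu cv y; apply: cvgD; [exact: cu|exact: cv]. Qed.

Lemma cont_scale f v : continuous f -> continuous v ->
  continuous (fun y => f y *: v y).
Proof. by move=> cf cv y; apply: cvgZ; [exact: cf|exact: cv]. Qed.

Lemma cont_normv v : continuous v -> continuous (fun y => `|v y|).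
Proof. by move=> cv y; apply: cvg_norm; exact: cv. Qed.

Lemma cont_add f g : continuous f -> continuous g ->
  continuous (fun y => f y + g y).
Proof. by move=> cu cv y; apply: cvgD; [exact: cu|exact: cv]. Qed.

Lemma cont_sub f g : continuous f -> continuous g ->
  continuous (fun y => f y - g y).
Proof. by move=> cu cv y; apply: cvgB; [exact: cu|exact: cv]. Qed.

Lemma cont_mul f g : continuous f -> continuous g ->
  continuous (fun y => f y * g y).
Proof. by move=> cu cv y; apply: cvgM; [exact: cu|exact: cv]. Qed.

Lemma cont_inv f : (forall y, f y != 0) -> continuous f ->
  continuous (fun y => (f y)^-1).
Proof. by move=> f0 cf y; apply: cvgV; [exact: f0|exact: cf]. Qed.

Lemma cont_min f g : continuous f -> continuous g ->
  continuous (fun y => Num.min (f y) (g y)).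
Proof. by move=> cf cg y; apply: continuous_min; [exact: cf|exact: cg]. Qed.

Lemma cont_max f g : continuous f -> continuous g ->
  continuous (fun y => Num.max (f y) (g y)).
Proof. by move=> cf cg y; apply: continuous_max; [exact: cf|exact: cg]. Qed.

End ContinuousOperations.

Lemma cont_id (Y : topologicalType) : continuous (fun y : Y => y).
Proof. by move=> y; exact: cvg_id. Qed.

Lemma cont_fst (Y Z : topologicalType) : continuous (fun y : Y * Z => y.1).
Proof. by move=> y; exact: cvg_fst. Qed.

Lemma cont_snd (Y Z : topologicalType) : continuous (fun y : Y * Z => y.2).
Proof. by move=> y; exact: cvg_snd. Qed.

Lemma cont_paste (R : realType) (Y Z : topologicalType) (f : Y -> R) (c : R)
    (a b h : Y -> Z) : continuous f ->
  {within [set y | f y <= c], continuous a} ->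
  {within [set y | c <= f y], continuous b} ->
  (forall y, f y <= c -> h y = a y) -> (forall y, c <= f y -> h y = b y) ->
  continuous h.
Proof.
move=> cf ca cb ha hb.
apply: (@within_cover _ _ [set y | f y <= c] [set y | c <= f y]).
- by apply: (@preimage_closed _ _ f [set x | x <= c]) => //; exact: closed_le.
- by apply: (@preimage_closed _ _ f [set x | c <= x]) => //; exact: closed_ge.
- by apply/seteqP; split => // y _; case: (leP (f y) c) => h';
    [left|right => /=; exact: ltW].
- by apply: within_eq ca => y /ha ->.
- by apply: within_eq cb => y /hb ->.
Qed.

(** * The groupoid of path classes *)

Section PathClasses.
Variables (R : realType).
Notation I := (unitI R).

Lemma path_eqP (X : topologicalType) (c d : path_space R X) :
  path_class c = path_class d <-> homotopic_rel R (@endpoints R) c d.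
Proof.
split => [/eqmodP /asboolP //|h]; by apply/eqmodP/asboolP.
Qed.

Lemma path_eq (X : topologicalType) (c d : path_space R X) :
  (forall t, c t = d t) -> c = d.
Proof. by move=> cd; apply/continuousEP => t; exact: cd. Qed.

Lemma path_ofE (X : topologicalType) (f : I -> X) (cf : continuous f) t :
  path_of cf t = f t.
Proof. by []. Qed.

Section MapPath.
Variables (X Y : topologicalType) (F : X -> Y) (cF : continuous F).

Lemma map_path_continuous (c : path_space R X) : continuous (F \o c).
Proof. by move=> t; apply: continuous_comp; [exact: cts_fun|exact: cF]. Qed.

Definition map_path (c : path_space R X) : path_space R Y :=
  path_of (@map_path_continuous c).

Lemma map_pathE (c : path_space R X) t : map_path c t = F (c t).
Proof. by []. Qed.

Lemma map_path_class (c d : path_space R X) : path_class c = path_class d ->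
  path_class (map_path c) = path_class (map_path d).
Proof.
move=> /path_eqP [H [cH H0 H1 Hr]]; apply/path_eqP; exists (F \o H); split.
- by move=> x; apply: continuous_comp; [exact: cH|exact: cF].
- by move=> s /=; rewrite H0.
- by move=> s /=; rewrite H1.
- by move=> t s As /=; rewrite Hr.
Qed.

End MapPath.

Lemma rev_continuous (X : topologicalType) (c : path_space R X) :
  continuous (fun t => c (irev t)).
Proof.
by move=> t; apply: (@continuous_comp _ _ _ (@irev R) c);
  [exact: irev_continuous|exact: cts_fun].
Qed.

Definition rev_path (X : topologicalType) (c : path_space R X) : path_space R X :=
  path_of (@rev_continuous _ c).

Lemma rev_pathE (X : topologicalType) (c : path_space R X) t :
  rev_path c t = c (irev t).
Proof. by []. Qed.

Lemma rev_path0 (X : topologicalType) (c : path_space R X) : rev_path c I0 = c I1.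
Proof. by rewrite rev_pathE irev0. Qed.

Lemma rev_path1 (X : topologicalType) (c : path_space R X) : rev_path c I1 = c I0.
Proof. by rewrite rev_pathE irev1. Qed.

Lemma convex_paths (V : normedModType R) (a b : path_space R V) :
  a I0 = b I0 -> a I1 = b I1 -> path_class a = path_class b.
Proof.
move=> ab0 ab1; apply/path_eqP.
exists (fun ts : I * I => (1 - ival ts.1) *: a ts.2 + ival ts.1 *: b ts.2); split.
- have c1 : continuous (fun ts : I * I => ival ts.1).
    move=> ts; apply: (@continuous_comp _ _ _ fst (@ival R)); first exact: cvg_fst.
    exact: ival_continuous.
  have c2 (c : path_space R V) : continuous (fun ts : I * I => c ts.2).
    move=> ts; apply: (@continuous_comp _ _ _ snd c); first exact: cvg_snd.
    exact: cts_fun.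
  move=> ts; apply: cvgD; apply: cvgZ; [|exact: c2|exact: c1|exact: c2].
  by apply: cvgB; [exact: cvg_cst|exact: c1].
- by move=> s; rewrite /= ival0 subr0 scale1r scale0r addr0.
- by move=> s; rewrite /= ival1 subrr scale1r scale0r add0r.
- by move=> t s [] -> /=; rewrite -?ab0 -?ab1 -scalerDl subrK scale1r.
Qed.

Section Operations.
Variable X : topologicalType.
Implicit Types (c d : path_space R X) (p q r : path_classes R X).

Definition src p : X := (repr p : path_space R X) I0.
Definition tgt p : X := (repr p : path_space R X) I1.

(* Junk value [c] when the endpoints do not match. *)
Definition pcat c d : path_space R X :=
  if pselect (c I1 = d I0) is left e then concat e else c.
Definition pmul p q : path_classes R X := path_class (pcat (repr p) (repr q)).
Definition pinv p : path_classes R X := path_class (rev_path (repr p)).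
Definition pid x : path_classes R X := path_class (cst_path R x).

Lemma path_classK p : path_class (repr p) = p.
Proof. exact: reprK. Qed.

Lemma path_class_endpoints c d : path_class c = path_class d ->
  c I0 = d I0 /\ c I1 = d I1.
Proof.
move=> /path_eqP [H [_ H0 H1 Hr]]; split.
  by rewrite -H1 Hr //; left.
by rewrite -H1 Hr //; right.
Qed.

Lemma src_class c : src (path_class c) = c I0.
Proof. by case: (path_class_endpoints (path_classK (path_class c))). Qed.

Lemma tgt_class c : tgt (path_class c) = c I1.
Proof. by case: (path_class_endpoints (path_classK (path_class c))). Qed.

Lemma pcatE c d (e : c I1 = d I0) : pcat c d = concat e.
Proof.
by rewrite /pcat; case: pselect => // e'; congr concat; exact: Prop_irrelevance.
Qed.

Lemma pcat0 c d : c I1 = d I0 -> pcat c d I0 = c I0.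
Proof. by move=> e; rewrite pcatE concat0. Qed.

Lemma pcat1 c d : c I1 = d I0 -> pcat c d I1 = d I1.
Proof. by move=> e; rewrite pcatE concat1. Qed.

Lemma concat_l c d (e : c I1 = d I0) (t : I) :
  concat e (clamp (ival t / 2)) = c t.
Proof.
have t0 := ival_ge0 t; have t1 := ival_le1 t.
have h : ival (clamp (ival t / 2)) = ival t / 2 by rewrite clampE //; lra.
rewrite concatE h ifT; last by lra.
by rewrite /lhalf h mulrC divfK ?pnatr_eq0 // ivalK.
Qed.

Lemma concat_r c d (e : c I1 = d I0) (t : I) :
  concat e (clamp ((1 + ival t) / 2)) = d t.
Proof.
have t0 := ival_ge0 t; have t1 := ival_le1 t.
have h : ival (clamp ((1 + ival t) / 2)) = (1 + ival t) / 2 by rewrite clampE //; lra.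
rewrite concatE h; case: ifPn => h2.
  have t00 : ival t = 0 by lra.
  have -> : d t = d I0 by congr (d _); apply: ival_inj; rewrite ival0.
  by rewrite -e lhalf_mid // h t00 addr0 mul1r.
by rewrite /rhalf h mulrC divfK ?pnatr_eq0 // [1 + _]addrC addrK ivalK.
Qed.

Lemma concat_class c c' d d' (e : c I1 = d I0) (e' : c' I1 = d' I0) :
  path_class c = path_class c' -> path_class d = path_class d' ->
  path_class (concat e) = path_class (concat e').
Proof.
move=> /path_eqP [H [cH H0 H1 Hr]] /path_eqP [K [cK K0 K1 Kr]].
apply/path_eqP.
exists (fun ts => if ival ts.2 <= 2^-1 then H (ts.1, lhalf ts.2)
                  else K (ts.1, rhalf ts.2)).
have cr (F : I * I -> X) (r : I -> I) :
    continuous F -> continuous r -> continuous (fun ts => F (ts.1, r ts.2)).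
  move=> cF cr ts; apply: (@continuous_comp _ _ _ (fun ts => (ts.1, r ts.2)) F);
    last exact: cF.
  move: ts; apply: continuous_pair; first by move=> ?; exact: cvg_fst.
  by move=> ts; apply: continuous_comp; [exact: cvg_snd|exact: cr].
split.
- apply: (@paste_continuous R _ _ snd).
  + by move=> ts; exact: cvg_snd.
  + exact: (cr _ _ cH (@lhalf_continuous R)).
  + exact: (cr _ _ cK (@rhalf_continuous R)).
  + move=> ts h; rewrite (lhalf_mid h) (rhalf_mid h).
    rewrite Hr; last by right.
    by rewrite Kr; last by left.
- by move=> s /=; rewrite concatE H0 K0.
- by move=> s /=; rewrite concatE H1 K1.
- move=> t s [] -> /=.
    by rewrite ival0 invr_ge0 ler0n lhalf0 concat0 Hr; last by left.
  rewrite ival1 ifF; last by apply/negbTE; rewrite -ltNge invf_lt1 ?ltr1n.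
  by rewrite rhalf1 concat1 Kr; last by right.
Qed.

Lemma pmul_class c d (e : c I1 = d I0) :
  pmul (path_class c) (path_class d) = path_class (concat e).
Proof.
have e' : (repr (path_class c) : path_space R X) I1 =
    (repr (path_class d) : path_space R X) I0.
  by have := src_class d; have := tgt_class c; rewrite /tgt /src => -> ->.
by rewrite /pmul (pcatE e'); apply: concat_class; exact: path_classK.
Qed.

Lemma pmul_pcat c d : c I1 = d I0 ->
  pmul (path_class c) (path_class d) = path_class (pcat c d).
Proof. by move=> e; rewrite (pmul_class e) (pcatE e). Qed.

Lemma pinv_class c : pinv (path_class c) = path_class (rev_path c).
Proof.
have /path_eqP [H [cH H0 H1 Hr]] := path_classK (path_class c).
apply/path_eqP; exists (fun ts => H (ts.1, irev ts.2)); split.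
- move=> ts; apply: (@continuous_comp _ _ _ (fun ts => (ts.1, irev ts.2)) H);
    last exact: cH.
  move: ts; apply: continuous_pair; first by move=> ?; exact: cvg_fst.
  by move=> ts; apply: continuous_comp; [exact: cvg_snd|exact: irev_continuous].
- by move=> s /=; rewrite H0.
- by move=> s /=; rewrite H1.
- move=> t s sA; rewrite rev_pathE; apply: Hr.
  by case: sA => -> /=; rewrite ?irev0 ?irev1; [right|left].
Qed.

End Operations.

Lemma map_concat (X Y : topologicalType) (F : X -> Y) (cF : continuous F)
    (c d : path_space R X) (e : c I1 = d I0)
    (e' : map_path cF c I1 = map_path cF d I0) :
  map_path cF (concat e) = concat e'.
Proof. apply: path_eq => t; rewrite map_pathE !concatE; by case: ifP. Qed.

Lemma map_rev (X Y : topologicalType) (F : X -> Y) (cF : continuous F)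
    (c : path_space R X) : map_path cF (rev_path c) = rev_path (map_path cF c).
Proof. exact: path_eq. Qed.

Section Segments.
Variables (V : normedModType R).

Lemma segment_continuous (v w : V) :
  continuous (fun t : I => (1 - ival t) *: v + ival t *: w).
Proof.
apply: cont_addv; apply: cont_scale; try exact: cont_cst.
- by apply: cont_sub; [exact: cont_cst|exact: ival_continuous].
- exact: ival_continuous.
Qed.

Definition segment v w : path_space R V := path_of (@segment_continuous v w).

Lemma segmentE v w t : segment v w t = (1 - ival t) *: v + ival t *: w.
Proof. by []. Qed.

Lemma segment0 v w : segment v w I0 = v.
Proof. by rewrite segmentE ival0 subr0 scale1r scale0r addr0. Qed.

Lemma segment1 v w : segment v w I1 = w.
Proof. by rewrite segmentE ival1 subrr scale1r scale0r add0r. Qed.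

Variables (X : topologicalType) (F : V -> X) (cF : continuous F).

(** In a normed space two paths with the same ends are homotopic, so this class depends only on [v]
    and [w]. The identities [segM], [segV] and [seg_id] therefore replace explicit reparametrisation
    homotopies throughout. *)
Definition seg v w : path_classes R X := path_class (map_path cF (segment v w)).

Lemma src_seg v w : src (seg v w) = F v.
Proof. by rewrite src_class map_pathE segment0. Qed.

Lemma tgt_seg v w : tgt (seg v w) = F w.
Proof. by rewrite tgt_class map_pathE segment1. Qed.

Lemma map_seg (c : path_space R V) :
  path_class (map_path cF c) = seg (c I0) (c I1).
Proof.
by apply: map_path_class; apply: convex_paths; rewrite ?segment0 ?segment1.
Qed.

Lemma seg_path (c : path_space R X) (b : path_space R V) :
  (forall t, c t = F (b t)) -> path_class c = seg (b I0) (b I1).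
Proof. by move=> cb; rewrite -map_seg; congr path_class; apply: path_eq. Qed.

Lemma segM u v w : pmul (seg u v) (seg v w) = seg u w.
Proof.
have e : segment u v I1 = segment v w I0 by rewrite segment0 segment1.
have e' : map_path cF (segment u v) I1 = map_path cF (segment v w) I0.
  by rewrite !map_pathE e.
rewrite (pmul_class e') -(map_concat e e') map_seg concat0 concat1.
by rewrite segment0 segment1.
Qed.

Lemma segV u v : pinv (seg u v) = seg v u.
Proof.
by rewrite pinv_class -map_rev map_seg !rev_pathE irev0 irev1 segment0 segment1.
Qed.

Lemma seg_id u : seg u u = pid (F u).
Proof.
congr path_class; apply: path_eq => t.
by rewrite map_pathE segmentE -scalerDl subrK scale1r.
Qed.

End Segments.

Section Laws.
Variable X : topologicalType.
Implicit Types (c d : path_space R X) (p q r : path_classes R X).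

Lemma extend_continuous c : continuous (fun x : R^o => c (clamp x)).
Proof.
by move=> x; apply: continuous_comp; [exact: clamp_continuous|exact: cts_fun].
Qed.

(** Every path is the image of a straight segment under its own constant extension to the line. The
    groupoid laws thereby reduce to identities between segments of the line. *)
Lemma class_seg c : path_class c = seg (@extend_continuous c) 0 1.
Proof.
congr path_class; apply: path_eq => t; rewrite map_pathE segmentE.
by rewrite scaler0 add0r [_ *: _]mulr1 ivalK.
Qed.

Lemma src_mul p q : tgt p = src q -> src (pmul p q) = src p.
Proof. by move=> e; rewrite /pmul src_class pcat0. Qed.

Lemma tgt_mul p q : tgt p = src q -> tgt (pmul p q) = tgt q.
Proof. by move=> e; rewrite /pmul tgt_class pcat1. Qed.

Lemma src_inv p : src (pinv p) = tgt p.
Proof. by rewrite src_class rev_pathE irev0. Qed.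

Lemma tgt_inv p : tgt (pinv p) = src p.
Proof. by rewrite tgt_class rev_pathE irev1. Qed.

Lemma pmul1p p : pmul (pid (src p)) p = p.
Proof.
by rewrite -{2 3}(path_classK p) class_seg -{2}(segM _ (0 : R^o) 0 1) seg_id.
Qed.

Lemma pmulp1 p : pmul p (pid (tgt p)) = p.
Proof.
by rewrite -{1 3}(path_classK p) class_seg -{2}(segM _ (0 : R^o) 1 1) seg_id.
Qed.

Lemma pmulpV p : pmul p (pinv p) = pid (src p).
Proof.
by rewrite -{1 2}(path_classK p) class_seg segV segM seg_id.
Qed.

Lemma pmulVp p : pmul (pinv p) p = pid (tgt p).
Proof.
by rewrite -{1 2}(path_classK p) class_seg segV segM seg_id.
Qed.

Lemma pmulA p q r : tgt p = src q -> tgt q = src r ->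
  pmul p (pmul q r) = pmul (pmul p q) r.
Proof.
rewrite -(path_classK p) -(path_classK q) -(path_classK r).
move: (repr p : path_space R X) (repr q : path_space R X) (repr r : path_space R X) => a b c.
rewrite !tgt_class !src_class => ab bc.
have ab_c : a I1 = concat bc I0 by rewrite concat0.
rewrite (pmul_class bc) (pmul_class ab_c) class_seg.
set F := @extend_continuous _.
have ci := @ival_continuous R; have c1 := @cont_cst I R^o (1 : R^o).
have ca : continuous (fun t : I => (ival t / 2) : R^o).
  by apply: cont_mul => //; exact: cont_cst.
have cb : continuous (fun t : I => ((1 + ival t / 2) / 2) : R^o).
  by apply: cont_mul; [apply: cont_add|exact: cont_cst].
have cc : continuous (fun t : I => ((1 + (1 + ival t) / 2) / 2) : R^o).
  apply: cont_mul; last exact: cont_cst.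
  by apply: cont_add => //; apply: cont_mul; [apply: cont_add|exact: cont_cst].
(* Inside the path [a * (b * c)] the three factors occupy [[0, 1/2]], [[1/2, 3/4]] and [[3/4, 1]];
   [ca], [cb], [cc] parametrise these intervals, so both bracketings equal the segment from 0 to
   1. *)
have hb (t : I) : ival (clamp (ival t / 2)) = ival t / 2.
  by rewrite clampE // ?divr_ge0 ?ival_ge0 ?ler0n //=; have := ival_le1 t; lra.
have hc (t : I) : ival (clamp ((1 + ival t) / 2)) = (1 + ival t) / 2.
  by rewrite clampE //; have := ival_le1 t; have := ival_ge0 t; lra.
rewrite (@seg_path _ _ _ F a (path_of ca)); last first.
  by move=> t; exact/esym/(concat_l ab_c t).
rewrite (@seg_path _ _ _ F b (path_of cb)); last first.
  by move=> t; rewrite -(concat_l bc t) -(concat_r ab_c) hb.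
rewrite (@seg_path _ _ _ F c (path_of cc)); last first.
  by move=> t; rewrite -(concat_r bc t) -(concat_r ab_c) hc.
rewrite !path_ofE !ival0 !ival1 mul0r !addr0 !mul1r !segM; congr seg.
by rewrite mulfV // (_ : 1 + 1 = 2) // divff ?pnatr_eq0.
Qed.

Lemma pmulKV p q : tgt p = src q -> pmul (pinv p) (pmul p q) = q.
Proof. by move=> e; rewrite pmulA ?tgt_inv // pmulVp e pmul1p. Qed.

Lemma pmulVK p q : src p = src q -> pmul p (pmul (pinv p) q) = q.
Proof. by move=> e; rewrite pmulA ?tgt_inv ?src_inv // pmulpV e pmul1p. Qed.

Lemma pmulK p q : tgt p = src q -> pmul (pmul p q) (pinv q) = p.
Proof. by move=> e; rewrite -pmulA ?src_inv // pmulpV -e pmulp1. Qed.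

Lemma pmulKr p q : tgt p = tgt q -> pmul (pmul p (pinv q)) q = p.
Proof. by move=> e; rewrite -pmulA ?src_inv ?tgt_inv // pmulVp -e pmulp1. Qed.

End Laws.

(** Both sides are the image of the diagonal. This is how a homotopy with moving ends enters the
    groupoid: it becomes a commuting square. *)
Lemma square_class (X : topologicalType) (F : R^o * R^o -> X) (cF : continuous F) :
  pmul (seg cF (0, 0) (0, 1)) (seg cF (0, 1) (1, 1)) =
  pmul (seg cF (0, 0) (1, 0)) (seg cF (1, 0) (1, 1)).
Proof. by rewrite !segM. Qed.

End PathClasses.

(** * Recursion over cells *)

Lemma existT_inj (J : Type) (D : J -> Type) j (a b : D j) :
  existT D j a = existT D j b -> a = b.
Proof.
move=> ab; pose P (u : {j & D j}) := forall e : projT1 u = j,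
  eq_rect (projT1 u) D (projT2 u) j e = a.
have Pa : P (existT D j a) by move=> /= e; rewrite (Prop_irrelevance e erefl).
by move: Pa; rewrite ab => /(_ erefl).
Qed.

Section CellRecursion.
Variables (T Z J : Type) (D : J -> Type) (rk : J -> nat).
Variables (Phi : forall j, D j -> T) (int bd : forall j, D j -> Prop).
Variable (E : forall j, (D j -> Z) -> D j -> Z).
Hypothesis cover : forall t, exists j (v : D j), int v /\ Phi v = t.
Hypothesis uniq : forall j (v : D j) i (w : D i), int v -> int w ->
  Phi v = Phi w -> existT D j v = existT D i w.
Hypothesis lower : forall j (v : D j), bd v ->
  exists i (w : D i), [/\ (rk i < rk j)%N, int w & Phi v = Phi w].
Hypothesis E_ext : forall j (f g : D j -> Z),
  (forall v, bd v -> f v = g v) -> E f = E g.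

(** [E] computes the values on a cell from those on its boundary, and the boundary is covered by
    interiors of cells of smaller rank. Iterating the resulting operator from a constant function
    therefore stabilises at each point. *)
Lemma cell_rec (z0 : Z) : exists F : T -> Z, forall j (v : D j), int v ->
  F (Phi v) = E (fun w => F (Phi w)) v.
Proof.
have L t : {u : {j & D j} | int (projT2 u) /\ Phi (projT2 u) = t}.
  by have /cid [j /cid [v ?]] := cover t; exists (existT D j v).
pose loc t := projT1 (L t).
have locP t : int (projT2 (loc t)) /\ Phi (projT2 (loc t)) = t := projT2 (L t).
have locE j (v : D j) : int v -> loc (Phi v) = existT D j v.
  move=> iv; have [il lE] := locP (Phi v); have := uniq il iv lE.
  by case: (loc (Phi v)).
pose S (F : T -> Z) t := E (fun w : D (projT1 (loc t)) => F (Phi w)) (projT2 (loc t)).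
pose A := fix A n := if n is m.+1 then S (A m) else fun=> z0.
pose h t := rk (projT1 (loc t)).
(* At a point in a cell of rank [h t] the iteration is final from stage [h t + 1] on, which is why
   that stage defines the function. *)
have stable n m t : (h t < n)%N -> (h t < m)%N -> A n t = A m t.
  elim: n m t => [//|n IH] [//|m] t hn hm; rewrite -[LHS]/(S (A n) t) -[RHS]/(S (A m) t).
  rewrite /S (E_ext (g := fun w => A m (Phi w))) // => v /lower [i [w [iw intw ->]]].
  have hE : h (Phi w) = rk i by rewrite /h locE.
  by apply: (IH m (Phi w)); rewrite hE; [move: hn|move: hm];
    rewrite ltnS; apply: leq_trans.
exists (fun t => A (h t).+1 t) => j v iv.
rewrite -[LHS]/(S (A (h (Phi v))) (Phi v)) /S /h locE //=.
rewrite (E_ext (g := fun w => A (h (Phi w)).+1 (Phi w))) // => w bw.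
have [i [u [iu intu ->]]] := lower bw.
by apply: (stable _ _ (Phi u)); rewrite /h !locE.
Qed.

End CellRecursion.

(** The preimage of a closed set is a finite union of preimages of compact, hence closed, images.
    This glues data known on the lower cells into continuity on the boundary of a cell. *)
Lemma finite_cover_within (J : Type) (F : set J) (D : J -> topologicalType)
    (T Y Z : topologicalType) (K : forall i, set (D i)) (k : forall i, D i -> T)
    (f : T -> Z) (a : Y -> T) (A : set Y) :
  finite_set F -> hausdorff_space T -> (forall i, F i -> compact (K i)) ->
  (forall i, F i -> continuous (k i)) -> (forall i, F i -> continuous (f \o k i)) ->
  continuous a -> closed A ->
  (forall y, A y -> exists2 i, F i & (k i @` K i) (a y)) ->
  {within A, continuous (f \o a)}.
Proof.
move=> finF hT cK ck cf ca clA AF; apply/within_closedP => // C clC.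
rewrite (_ : _ `&` _ = A `&` \bigcup_(i in F) a @^-1` (k i @` (K i `&` (f \o k i) @^-1` C))).
  apply: closedI => //; apply: (@closed_bigcup _ {classic J}) => // i Fi.
  have /continuous_closedP := ca; apply; apply: compact_closed => //.
  apply: continuous_compact; first by apply: continuous_subspaceT; exact: (ck _ Fi).
  apply: compact_closedI; first exact: (cK _ Fi).
  by have /continuous_closedP := cf _ Fi; apply.
apply/seteqP; split => y [Ay].
  move=> Cy; split => //; have [i Fi [v Kv va]] := AF _ Ay.
  by exists i => //; exists v => //; split => //=; rewrite va.
by move=> [i Fi [v [Kv Cv] va]]; split => //=; rewrite -va.
Qed.

(** * Disks and characteristic maps *)

Section EuclideanNorm.
Variables (R : realType).

Lemma cont_mx (Y : topologicalType) m n (f : Y -> 'M[R]_(m, n)) :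
  (forall i j, continuous (fun y => f y i j)) -> continuous f.
Proof.
move=> cf y A [P nP PA].
apply: (@filterS _ _ _ [set z | forall i j, P i j (f z i j)]).
  by move=> z h; exact: PA.
apply: filter_forall => i; apply: filter_forall => j.
exact: (cf i j y _ (nP i j)).
Qed.

Lemma cont_sum (Y : topologicalType) (T : Type) (r : seq T) (f : T -> Y -> R) :
  (forall i, continuous (f i)) -> continuous (fun y => \sum_(i <- r) f i y).
Proof.
move=> cf; elim: r => [|i r IH].
  by under eq_fun do rewrite big_nil; exact: cont_cst.
by under eq_fun do rewrite big_cons; apply: cont_add.
Qed.

Variable n : nat.
Implicit Types (v w : 'rV[R]_n) (a : R).

Definition nrm v : R := Num.sqrt (sqnorm v).

Lemma sqnorm_ge0 v : 0 <= sqnorm v.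
Proof. by apply: sumr_ge0 => i _; rewrite sqr_ge0. Qed.

Lemma nrm_ge0 v : 0 <= nrm v. Proof. exact: sqrtr_ge0. Qed.

Lemma sqr_nrm v : nrm v ^+ 2 = sqnorm v.
Proof. by rewrite sqr_sqrtr // sqnorm_ge0. Qed.

Lemma nrmZ a v : nrm (a *: v) = `|a| * nrm v.
Proof.
rewrite /nrm; have -> : sqnorm (a *: v) = a ^+ 2 * sqnorm v.
  by rewrite /sqnorm big_distrr; apply: eq_bigr => i _; rewrite mxE exprMn.
by rewrite sqrtrM ?sqr_ge0 // sqrtr_sqr.
Qed.

Lemma nrm_pZ a v : 0 <= a -> nrm (a *: v) = a * nrm v.
Proof. by move=> a0; rewrite nrmZ ger0_norm. Qed.

Lemma nrm0 : nrm 0 = 0.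
Proof. by rewrite -(scale0r 0) nrmZ normr0 mul0r. Qed.

Lemma coord_le_nrm v i : `|v 0 i| <= nrm v.
Proof.
rewrite -(ler_pXn2r (n := 2)) ?nnegrE ?nrm_ge0 // sqr_nrm real_normK ?num_real //.
by rewrite /sqnorm (bigD1 i) //= lerDl; apply: sumr_ge0 => j _; rewrite sqr_ge0.
Qed.

Lemma nrm_eq0 v : nrm v = 0 -> v = 0.
Proof.
move=> v0; apply/rowP => i; rewrite mxE; apply/eqP; rewrite -normr_le0 -v0.
exact: coord_le_nrm.
Qed.

Lemma norm_le_nrm v : `|v| <= nrm v.
Proof.
have -> : `|v| = mx_norm v by [].
rewrite mx_normrE; apply/bigmax_leP; split; first exact: nrm_ge0.
by move=> [i j] _ /=; rewrite ord1 coord_le_nrm.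
Qed.

Lemma nrm_continuous : continuous nrm.
Proof.
move=> v; apply: (@continuous_comp _ _ _ (@sqnorm R n) Num.sqrt); last exact: sqrt_continuous.
apply: cont_sum => i.
under eq_fun do rewrite expr2.
by apply: cont_mul; exact: coord_continuous.
Qed.

Lemma diskE v : disk v <-> nrm v <= 1.
Proof. by rewrite -(expr_le1 (n := 2)) ?nrm_ge0 // sqr_nrm. Qed.

Lemma open_diskE v : open_disk v <-> nrm v < 1.
Proof. by rewrite -(expr_lt1 (n := 2)) ?nrm_ge0 // sqr_nrm. Qed.

Lemma sphereE v : sphere v <-> nrm v = 1.
Proof.
split => [h|h]; first by rewrite /nrm h sqrtr1.
by rewrite /sphere /= -sqr_nrm h expr1n.
Qed.

Definition ball_le (r : R) : set 'rV[R]_n := [set v | nrm v <= r].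

Lemma ball_le_compact r : compact (ball_le r).
Proof.
apply: bounded_closed_compact.
  exists r; split; first exact: num_real.
  by move=> s rs v /= vr; apply: (le_trans (norm_le_nrm v)); exact: le_trans (ltW rs).
have /continuous_closedP/(_ _ (@closed_le _ r)) := nrm_continuous; exact.
Qed.

Definition ret v : 'rV[R]_n := (Num.max 1 (nrm v))^-1 *: v.

Lemma ret_continuous : continuous ret.
Proof.
apply: cont_scale; last exact: cont_id.
apply: cont_inv; last by apply: cont_max; [exact: cont_cst|exact: nrm_continuous].
by move=> v; rewrite gt_eqF // lt_max ltr01.
Qed.

Lemma ret_id v : nrm v <= 1 -> ret v = v.
Proof. by move=> v1; rewrite /ret max_l // invr1 scale1r. Qed.

Lemma ret_out v : 1 <= nrm v -> ret v = (nrm v)^-1 *: v.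
Proof. by move=> v1; rewrite /ret max_r. Qed.

Lemma nrm_ret v : nrm (ret v) = Num.min 1 (nrm v).
Proof.
case: (leP (nrm v) 1) => h; first by rewrite ret_id // min_r.
rewrite ret_out ?ltW // nrm_pZ ?invr_ge0 ?nrm_ge0 //.
by rewrite mulVf // gt_eqF // (lt_trans ltr01).
Qed.

Lemma nrm_ret_le1 v : nrm (ret v) <= 1.
Proof. by rewrite nrm_ret ge_min lexx. Qed.

End EuclideanNorm.

Section CWBasics.

Variables (R : realType) (X : topologicalType) (K : CW_structure R X).
Notation I := (unitI R).
Notation J := (cell K).
Implicit Types (i j : J).

(** Composing with the radial retraction makes the characteristic map continuous on the whole vector
    space, so subspace topologies are mostly avoided. The price is that boundary points are those
    with [1 <= nrm v], not only the unit sphere. *)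
Definition Phi j (v : 'rV[R]_(dim j)) : X := char j (ret v).

Lemma PhiE j (v : 'rV[R]_(dim j)) : nrm v <= 1 -> Phi v = char j v.
Proof. by move=> v1; rewrite /Phi ret_id. Qed.

Lemma Phi_ret j (v : 'rV[R]_(dim j)) : Phi (ret v) = Phi v.
Proof. by rewrite /Phi (ret_id (nrm_ret_le1 v)). Qed.

Lemma Phi_continuous j : continuous (@Phi j).
Proof.
apply/within_continuousT.
apply: (within_comp (A := disk (n := dim j))) (@char_continuous _ _ K j) => //.
  by apply/within_continuousT; exact: ret_continuous.
by move=> v _; apply/diskE; exact: nrm_ret_le1.
Qed.

Lemma closed_cellE j : closed_cell j = @Phi j @` ball_le 1.
Proof.
apply/seteqP; split => _ [v hv <-]; exists v.
- exact/diskE.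
- by rewrite PhiE //; exact/diskE.
- exact/diskE.
- by rewrite -PhiE.
Qed.

Lemma Phi_closed_cell j (v : 'rV[R]_(dim j)) : closed_cell j (Phi v).
Proof. by rewrite closed_cellE -Phi_ret; exists (ret v) => //; exact: nrm_ret_le1. Qed.

Lemma Phi_cover x : exists j (v : 'rV[R]_(dim j)), nrm v < 1 /\ Phi v = x.
Proof.
have : [set: X] x by [].
rewrite -(@cells_cover _ _ K) => -[j _ [v /open_diskE v1 vx]]; exists j, v; split => //.
by rewrite PhiE // ltW.
Qed.

Lemma Phi_uniq j (v : 'rV[R]_(dim j)) i (w : 'rV[R]_(dim i)) :
  nrm v < 1 -> nrm w < 1 -> Phi v = Phi w ->
  existT (fun j => 'rV[R]_(dim j)) j v = existT _ i w.
Proof.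
move=> v1 w1; rewrite !PhiE ?ltW // => vw.
have ji : j = i.
  apply: (@cells_disjoint _ _ K j i) => //; exists (char j v); split.
    by exists v => //; exact/open_diskE.
  by rewrite vw; exists w => //; exact/open_diskE.
case: i / ji w w1 vw => w w1 vw; congr existT.
by apply: (@char_inj _ _ K j) => //; rewrite inE; exact/open_diskE.
Qed.

Lemma Phi_inj j (v w : 'rV[R]_(dim j)) :
  nrm v < 1 -> nrm w < 1 -> Phi v = Phi w -> v = w.
Proof. by move=> v1 w1 vw; exact: existT_inj (Phi_uniq v1 w1 vw). Qed.

Lemma Phi_boundary j : exists F : set J, [/\ finite_set F,
  forall i, F i -> (dim i < dim j)%N &
  forall v : 'rV[R]_(dim j), 1 <= nrm v ->
    exists i (w : 'rV[R]_(dim i)), [/\ F i, nrm w < 1 & Phi v = Phi w]].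
Proof.
have [F [finF Fd FS]] := @closure_finite _ _ K j; exists F; split => // v v1.
have [i Fi [w /open_diskE w1 wv]] : (\bigcup_(i in F) open_cell i) (Phi v).
  by apply: FS; exists (ret v) => //; apply/sphereE; rewrite nrm_ret min_l.
by exists i, w; split => //; rewrite -wv PhiE // ltW.
Qed.

Lemma CW_continuous (Z : topologicalType) (f : X -> Z) :
  (forall j, continuous (f \o @Phi j)) -> continuous f.
Proof.
move=> cf; apply/continuous_closedP => C cC; apply/(@weak_topology _ _ K) => j.
rewrite (_ : _ `&` _ = @Phi j @` (ball_le 1 `&` (f \o @Phi j) @^-1` C)).
  apply: compact_closed; first exact: CW_hausdorff K.
  apply: continuous_compact; first by apply: continuous_subspaceT; exact: Phi_continuous.
  apply: compact_closedI; first exact: ball_le_compact.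
  by have /continuous_closedP := cf j; apply.
rewrite closed_cellE; apply/seteqP; split => x.
  by move=> [Cx [v v1 vx]]; exists v => //; split => //=; rewrite vx.
by move=> [v [v1 Cv] <-]; split => //; exists v.
Qed.

(** The weak topology tests maps out of [X], not out of [X * I]. Currying turns [f] into a map from
    [X] to a path space, to which the test applies. *)
Lemma CW_continuous2 (Z : topologicalType) (f : X -> I -> Z) :
  (forall j, continuous (fun vt : 'rV[R]_(dim j) * I => f (Phi vt.1) vt.2)) ->
  continuous (fun xt : X * I => f xt.1 xt.2).
Proof.
move=> cf.
have cfx x : continuous (f x).
  have [j [v [_ <-]]] := Phi_cover x.
  apply: (cont_comp (h := fun vt : 'rV[R]_(dim j) * I => f (Phi vt.1) vt.2)
    (continuous_pair (@cont_cst _ _ v) (@cont_id _))); exact: cf.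
apply: (@uncurry_path_continuous R X Z (fun x => path_of (@cfx x))).
by apply: CW_continuous => j; apply: curry_path_continuous; exact: cf.
Qed.

Lemma CW_rec (Z : Type) (E : forall j, ('rV[R]_(dim j) -> Z) -> 'rV[R]_(dim j) -> Z)
    (z0 : Z) :
  (forall j (f g : 'rV[R]_(dim j) -> Z),
    (forall v, 1 <= nrm v -> f v = g v) -> E j f = E j g) ->
  exists F : X -> Z, forall j (v : 'rV[R]_(dim j)), nrm v < 1 ->
    F (Phi v) = E j (fun w => F (Phi w)) v.
Proof.
move=> Eext.
apply: (@cell_rec X Z J (fun j => 'rV[R]_(dim j)) (fun j => dim j) Phi
  (fun j v => nrm v < 1) (fun j v => 1 <= nrm v) E) => //.
- exact: Phi_cover.
- exact: Phi_uniq.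
- move=> j v v1; have [F [_ Fd /(_ v v1) [i [w [Fi w1 vw]]]]] := Phi_boundary j.
  by exists i, w; split => //; exact: Fd.
Qed.

Lemma dim_ind (P : J -> Prop) :
  (forall j, (forall i, (dim i < dim j)%N -> P i) -> P j) -> forall j, P j.
Proof.
move=> IH j; have [n jn] := ubnP (dim j); elim: n => // n IHn in j jn *.
by apply: IH => i ij; apply: IHn; rewrite ltnS in jn; exact: leq_trans ij jn.
Qed.

End CWBasics.

(** * The radial flow *)

Section Flow.
Variables (R : realType) (X : topologicalType) (K : CW_structure R X).
Notation I := (unitI R).
Notation J := (cell K).
Implicit Types (i j : J) (t : I).

Definition normalize n (v : 'rV[R]_n) := (nrm v)^-1 *: v.

Lemma nrm_normalize n (v : 'rV[R]_n) : 0 < nrm v -> nrm (normalize v) = 1.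
Proof.
by move=> v0; rewrite nrm_pZ ?invr_ge0 ?nrm_ge0 // mulVf // gt_eqF.
Qed.

Lemma normalizeZ n (v : 'rV[R]_n) l : 0 < l -> normalize (l *: v) = normalize v.
Proof.
move=> l0; rewrite /normalize nrm_pZ ?(ltW l0) // scalerA invfM mulrAC mulVf ?mul1r //.
by rewrite gt_eqF.
Qed.

Lemma Phi_normalize j a (v : 'rV[R]_(dim j)) : 1 <= a * nrm v -> 0 <= a ->
  Phi (a *: v) = Phi (normalize v).
Proof.
move=> h a0; have v0 : 0 < nrm v.
  by rewrite lt_neqAle nrm_ge0 andbT eq_sym; apply: contraTneq h => ->; rewrite mulr0 ler10.
have a1 : 0 < a.
  by rewrite lt_neqAle a0 andbT eq_sym; apply: contraTneq h => ->; rewrite mul0r ler10.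
rewrite -Phi_ret ret_out ?nrm_pZ // scalerA invfM mulrAC mulVf ?mul1r //.
by rewrite gt_eqF.
Qed.

(* Each cell flows radially outwards with unit logarithmic speed; a point that
   reaches the boundary of its cell keeps flowing in a lower-dimensional one.
   The flow time at parameter [t] is [ln (1 + t)]. *)
Definition is_flow (H : X -> I -> X) := forall j (v : 'rV[R]_(dim j)) t,
  nrm v <= 1 ->
  ((1 + ival t) * nrm v <= 1 -> H (Phi v) t = Phi ((1 + ival t) *: v)) /\
  (1 <= (1 + ival t) * nrm v ->
   H (Phi v) t = H (Phi (normalize v)) (clamp ((1 + ival t) * nrm v - 1))).

(** A point at radius [nrm v] leaves its cell after the factor [1 / nrm v]; the factor left over is
    [(1 + t) * nrm v], that is parameter [(1 + t) * nrm v - 1], and the boundary value of the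
    recursion is read off there. *)
Lemma flow_exists (x0 : X) : exists H, is_flow H.
Proof.
pose E j (f : 'rV[R]_(dim j) -> I -> X) v t :=
  if (1 + ival t) * nrm v <= 1 then Phi ((1 + ival t) *: v)
  else f (normalize v) (clamp ((1 + ival t) * nrm v - 1)).
have pos j (v : 'rV[R]_(dim j)) t : 1 < (1 + ival t) * nrm v -> 0 < nrm v.
  move=> h; rewrite lt_neqAle nrm_ge0 andbT eq_sym.
  by apply: contraTneq h => ->; rewrite mulr0 ltr10.
have Eext j (f g : 'rV[R]_(dim j) -> I -> X) :
    (forall v, 1 <= nrm v -> f v = g v) -> E j f = E j g.
  move=> fg; apply/funext => v; apply/funext => t; rewrite /E.
  by case: leP => // /pos v0; rewrite fg // nrm_normalize.
have [H HE] := CW_rec (fun=> x0) Eext; exists H.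
have H0 x : H x I0 = x.
  have [j [v [v1 <-]]] := Phi_cover K x.
  by rewrite HE // /E ival0 addr0 mul1r ltW // scale1r.
have H1 j (v : 'rV[R]_(dim j)) : nrm v = 1 -> normalize v = v.
  by move=> v1; rewrite /normalize v1 invr1 scale1r.
(* The recursion equation speaks of open cells only. On the unit sphere [normalize v = v] and no
   factor is lost, so the formula for the cell [j] is a tautology there. *)
have key j (v : 'rV[R]_(dim j)) t : nrm v <= 1 -> H (Phi v) t = E j (fun w => H (Phi w)) v t.
  rewrite le_eqVlt => /orP [/eqP v1|/HE -> //].
  rewrite /E v1 mulr1; case: leP => h.
    have t0 : t = I0 by apply: ival_inj; rewrite ival0; have := ival_ge0 t; lra.
    by rewrite t0 H0 ival0 addr0 scale1r.
  by rewrite H1 // [1 + _]addrC addrK ivalK.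
move=> j v t v1; rewrite key // /E; split; first by move=> ->.
rewrite le_eqVlt => /orP [/eqP e|]; last by case: leP.
rewrite -e lexx subrr (clamp_le0 (lexx 0)) H0 /normalize; congr (Phi (_ *: _)).
have v0 : nrm v != 0 by apply/eqP => v0; move: e; rewrite v0 mulr0 => /eqP; rewrite oner_eq0.
by apply: (mulIf v0); rewrite -e mulVf.
Qed.

Variable (H : X -> I -> X).
Hypothesis HF : is_flow H.

Lemma flow0 x : H x I0 = x.
Proof.
have [j [v [v1 <-]]] := Phi_cover K x.
have [-> //] := HF I0 (ltW v1).
  by rewrite ival0 addr0 scale1r.
by rewrite ival0 addr0 mul1r ltW.
Qed.

Lemma flow_continuous : continuous (fun xt : X * I => H xt.1 xt.2).
Proof.
apply: (CW_continuous2 (K := K)); apply: (@dim_ind _ _ K) => j IH.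
pose f (vt : 'rV[R]_(dim j) * I) := (1 + ival vt.2) * nrm (ret vt.1).
have ct : continuous (fun vt : 'rV[R]_(dim j) * I => 1 + ival vt.2).
  apply: cont_add; first exact: cont_cst.
  by apply: cont_comp; [exact: cont_snd|exact: ival_continuous].
have cr : continuous (fun vt : 'rV[R]_(dim j) * I => ret vt.1).
  by apply: cont_comp; [exact: cont_fst|exact: ret_continuous].
have cf : continuous f.
  by apply: cont_mul => //; apply: cont_comp; [exact: cr|exact: nrm_continuous].
pose a (vt : 'rV[R]_(dim j) * I) := Phi ((1 + ival vt.2) *: ret vt.1).
(* [normalize] is singular at 0. Where [1 <= f] the radius is at least 1/2 because [1 + t <= 2], so
   [2 *: v] is outside the open disk and has the same image under [Phi] as [normalize v]. *)
pose b (vt : 'rV[R]_(dim j) * I) := (Phi (2 *: vt.1), clamp (f vt - 1)).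
apply: (@cont_paste R _ _ f 1 a (fun vt => H (b vt).1 (b vt).2)) => //.
- apply: continuous_subspaceT; apply: cont_comp; last exact: Phi_continuous.
  exact: cont_scale.
- have [F [finF Fd FS]] := Phi_boundary j.
  apply: (@finite_cover_within J F (fun i => ('rV[R]_(dim i) * I)%type) (X * I)%type
    _ _ (fun i => ball_le 1 `*` setT) (fun i wt => (Phi wt.1, wt.2))
    (fun xt => H xt.1 xt.2) b) => //.
  + by apply: hausdorff_prod; [exact: CW_hausdorff K|exact: unitI_hausdorff].
  + by move=> i _; apply: compact_setX; [exact: ball_le_compact|exact: unitI_compact].
  + move=> i _; apply: continuous_pair; last exact: cont_snd.
    by apply: cont_comp; [exact: cont_fst|exact: Phi_continuous].
  + by move=> i /Fd; exact: IH.
  + apply: continuous_pair.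
      apply: cont_comp; last exact: Phi_continuous.
      by apply: cont_scale; [exact: cont_cst|exact: cont_fst].
    by apply: cont_comp; [apply: cont_sub => //; exact: cont_cst|exact: clamp_continuous].
  + by have /continuous_closedP/(_ _ (@closed_ge _ 1)) := cf.
  + move=> [v t] /= h; have [|i [w [Fi w1 vw]]] := FS (2 *: v).
      rewrite nrm_pZ //; apply: (le_trans h); rewrite /f /= nrm_ret.
      apply: ler_pM; rewrite ?le_min ?ler01 ?nrm_ge0 ?addr_ge0 ?ival_ge0 //.
        by have := ival_le1 t; lra.
      by rewrite ge_min lexx orbT.
    exists i => //; exists (w, clamp (f (v, t) - 1)); first by split => //; exact: ltW.
    by rewrite /b /= vw.
- move=> [v t] h /=; rewrite -Phi_ret.
  by have [-> //] := HF t (nrm_ret_le1 v).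
- move=> [v t] h /=; rewrite -Phi_ret.
  have [_ -> //] := HF t (nrm_ret_le1 v); congr (H _ _).
  have h2 : 1 <= 2 * nrm (ret v).
    apply: (le_trans h); rewrite /f /=; apply: ler_wpM2r; first exact: nrm_ge0.
    by have := ival_le1 t; lra.
  rewrite -(Phi_normalize h2) // -Phi_ret; case: (leP (nrm v) 1) => v1.
    by rewrite (ret_id v1) Phi_ret.
  rewrite Phi_ret Phi_normalize // Phi_normalize ?(ltW) //.
    congr Phi; rewrite /normalize nrm_ret min_l ?ltW // invr1 scale1r.
    by rewrite ret_out // ltW.
  by lra.
Qed.

End Flow.

(** * Nice neighbourhoods in a CW complex *)

Section Depth.
Variables (R : realType) (X : topologicalType) (K : CW_structure R X).
Notation I := (unitI R).
Notation J := (cell K).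
Implicit Types (i j : J) (t : I).
Variables (H : X -> I -> X) (HF : is_flow K H).
Variables (j0 : J) (v0 : 'rV[R]_(dim j0)) (d rho : R).
Hypotheses (d0 : 0 < d) (d1 : d <= 1) (rho1 : rho < 1).
Hypothesis v0d : forall w a, `|w - v0| <= d -> 1 <= a -> a <= 1 + d ->
  nrm (a *: w) <= rho.

(* [T y] is the factor by which [y] has to flow to enter the ball of radius [d]
   around [v0] in the cell [j0], increased by the distance to [v0] of the entry
   point, and truncated at [1 + d]. *)
Definition is_depth (T : X -> R) := forall j (v : 'rV[R]_(dim j)), nrm v <= 1 ->
  (forall e : j0 = j, T (Phi v) =
    1 + Num.min d `|v - eq_rect j0 (fun j => 'rV[R]_(dim j)) v0 j e|) /\
  (j0 <> j -> T (Phi v) =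
    if nrm v == 0 then 1 + d else Num.min (1 + d) (T (Phi (normalize v)) / nrm v)).

Lemma depth_exists : exists T, is_depth T /\ forall x, 1 <= T x <= 1 + d.
Proof.
pose E j (f : 'rV[R]_(dim j) -> R) v :=
  if pselect (j0 = j) is left e
  then 1 + Num.min d `|v - eq_rect j0 (fun j => 'rV[R]_(dim j)) v0 j e|
  else if nrm v == 0 then 1 + d else Num.min (1 + d) (f (normalize v) / nrm v).
have pos n (v : 'rV[R]_n) : nrm v != 0 -> 0 < nrm v.
  by move=> v0'; rewrite lt_neqAle nrm_ge0 andbT eq_sym.
have Eext j (f g : 'rV[R]_(dim j) -> R) :
    (forall v, 1 <= nrm v -> f v = g v) -> E j f = E j g.
  move=> fg; apply/funext => v; rewrite /E; case: pselect => // _.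
  by case: eqP => // /eqP/pos v1; rewrite fg // nrm_normalize.
have [T TE] := CW_rec 1 Eext; exists T.
have bounds j : forall v : 'rV[R]_(dim j), nrm v < 1 -> 1 <= T (Phi v) <= 1 + d.
  elim/(@dim_ind _ _ K): j => j IH v v1; rewrite TE // /E.
  case: pselect => [e|_].
    rewrite lerDl le_min (ltW d0) normr_ge0 /= lerD2l ge_min lexx //.
  case: eqP => [_|/eqP/pos vp]; first by rewrite lexx lerDl ltW.
  rewrite ge_min lexx le_min lerDl (ltW d0) andbT /=.
  have [F [_ Fd /(_ (normalize v))]] := Phi_boundary j.
  rewrite nrm_normalize // => /(_ (lexx _)) [i [w [Fi w1 ->]]].
  have /andP[h _] := IH _ (Fd _ Fi) w w1.
  by rewrite ler_pdivlMr // mul1r (le_trans (ltW v1)).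
have bnd x : 1 <= T x <= 1 + d.
  by have [j [v [v1 <-]]] := Phi_cover K x; exact: bounds.
split=> //.
(* The flow leaves a cell only into cells of smaller dimension, so from these cells it never reaches
   [j0] and the truncation value is attained. *)
have low j : (dim j <= dim j0)%N -> j0 <> j -> forall v : 'rV[R]_(dim j), nrm v < 1 ->
    T (Phi v) = 1 + d.
  elim/(@dim_ind _ _ K): j => j IH jj0 j0j v v1; rewrite TE // /E.
  case: pselect => // _; case: eqP => // /eqP/pos vp.
  have [F [_ Fd /(_ (normalize v))]] := Phi_boundary j.
  rewrite nrm_normalize // => /(_ (lexx _)) [i [w [Fi w1 ->]]].
  rewrite IH ?Fd //; last 2 first.
  - by apply: leq_trans jj0; rewrite ltnW // Fd.
  - by move=> ij; have := Fd _ Fi; rewrite -ij ltnNge jj0.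
  rewrite min_l // ler_pdivlMr // ler_piMr ?(ltW v1) //.
  by rewrite addr_ge0 // ltW.
move=> j v; rewrite le_eqVlt => /orP [/eqP v1|v1]; last first.
  rewrite TE // /E; split; first by move=> e; case: pselect => // e'; rewrite (Prop_irrelevance e e').
  by case: pselect.
split=> [e|_]; last first.
  rewrite v1 oner_eq0 divr1 /normalize v1 invr1 scale1r min_r //.
  by case/andP: (bnd (Phi v)).
(* A boundary point of [j0] itself lies in lower cells, where [T] is [1 + d]. The formula for [j0]
   agrees: a point of norm 1 is at distance at least [d] from [v0], since nearer points have norm at
   most [rho < 1]. *)
case: j / e v v1 => v v1 /=.
have [F [_ Fd /(_ v)]] := Phi_boundary j0.
rewrite v1 => /(_ (lexx _)) [i [w [Fi w1 ->]]].
rewrite low //; last 2 first.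
- by rewrite ltnW // Fd.
- by move=> ij; have := Fd _ Fi; rewrite -ij ltnn.
rewrite min_l // leNgt; apply/negP => h.
have := v0d (ltW h) (lexx 1); rewrite scale1r v1 lerDl (ltW d0) => /(_ isT).
by rewrite leNgt rho1.
Qed.

Variable (T : X -> R) (TD : is_depth T) (Tb : forall x, 1 <= T x <= 1 + d).

Lemma depth_base (v : 'rV[R]_(dim j0)) : nrm v <= 1 ->
  T (Phi v) = 1 + Num.min d `|v - v0|.
Proof. by move=> /TD [/(_ erefl)]. Qed.

Lemma depth_continuous : continuous T.
Proof.
apply: (CW_continuous (K := K)); apply: (@dim_ind _ _ K) => j IH.
have [e|ne] := pselect (j0 = j).
  case: j / e IH => _.
  have -> : T \o @Phi _ _ K j0 = fun v => 1 + Num.min d `|ret v - v0|.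
    by apply/funext => v /=; rewrite -Phi_ret depth_base // nrm_ret_le1.
  apply: cont_add; first exact: cont_cst.
  apply: cont_min; first exact: cont_cst.
  apply: cont_normv; apply: cont_addv; last exact: cont_cst.
  exact: ret_continuous.
have cr : continuous (fun v : 'rV[R]_(dim j) => nrm (ret v)).
  by apply: cont_comp; [exact: ret_continuous|exact: nrm_continuous].
(* Below radius 1/2 the quotient is at least [2 >= 1 + d], as [1 <= T] and [d <= 1], so [T] is
   constant there. Above it, [2 *: v] stands for [normalize v] and the maximum keeps the divisor off
   0. *)
pose b (v : 'rV[R]_(dim j)) := Num.min (1 + d) (T (Phi (2 *: v)) / Num.max (nrm (ret v)) 2^-1).
have half : 0 < 2^-1 :> R by rewrite invr_gt0 ltr0n.
apply: (@cont_paste R _ _ _ 2^-1 (fun=> 1 + d) b _ cr).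
- by apply: continuous_subspaceT; exact: cont_cst.
- set A := [set y | _].
  apply: (@cont_comp (subspace A) _ _ (fun v => T (Phi (2 *: v)) / Num.max (nrm (ret v)) 2^-1)
      (fun x => Num.min (1 + d) x)); last first.
    by apply: cont_min; [exact: cont_cst|exact: cont_id].
  apply: (@cont_mul R (subspace A)).
    have [F [finF Fd FS]] := Phi_boundary j.
    suff h : {within A, continuous (T \o (fun v : 'rV[R]_(dim j) => Phi (2 *: v)))} by exact: h.
    apply: (@finite_cover_within J F (fun i => 'rV[R]_(dim i)) X 'rV[R]_(dim j) _
      (fun i => ball_le 1) (fun i => @Phi _ _ K i) T (fun v => Phi (2 *: v))) => //.
    + exact: CW_hausdorff K.
    + by move=> i _; exact: ball_le_compact.
    + by move=> i _; exact: Phi_continuous.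
    + by move=> i /Fd; exact: IH.
    + apply: cont_comp; last exact: Phi_continuous.
      by apply: cont_scale; [exact: cont_cst|exact: cont_id].
    + by have /continuous_closedP/(_ _ (@closed_ge _ 2^-1)) := cr.
    + move=> v; rewrite /A /= nrm_ret le_min => /andP[_ h].
      have [|i [w [Fi w1 vw]]] := FS (2 *: v); first by rewrite nrm_pZ //; lra.
      by exists i => //; exists w => //; exact: ltW.
  apply: continuous_subspaceT; apply: cont_inv.
    by move=> v; rewrite gt_eqF // lt_max half orbT.
  by apply: cont_max => //; exact: cont_cst.
- move=> v /= h; rewrite -Phi_ret.
  have [_ ->] := TD (nrm_ret_le1 v); last by [].
  case: eqP => // /eqP r0; rewrite min_l //.
  have rp : 0 < nrm (ret v) by rewrite lt_neqAle nrm_ge0 andbT eq_sym.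
  rewrite ler_pdivlMr //; have /andP[+ _] := Tb (Phi (normalize (ret v))).
  apply: le_trans; have : 0 <= (1 - d) * nrm (ret v).
    by apply: mulr_ge0; [rewrite subr_ge0|exact: ltW].
  by move: h; set r := nrm _ => h; rewrite mulrBl mulrDl mul1r => h1; lra.
- move=> v /= h; rewrite -Phi_ret.
  have [_ ->] := TD (nrm_ret_le1 v); last by [].
  have rp : 0 < nrm (ret v) by apply: lt_le_trans h.
  rewrite gt_eqF // /b (max_l h); congr (Num.min _ (T _ / _)).
  have h2 : 1 <= 2 * nrm (ret v) by lra.
  rewrite -(Phi_normalize h2) // -Phi_ret; case: (leP (nrm v) 1) => v1.
    by rewrite (ret_id v1) Phi_ret.
  rewrite Phi_ret Phi_normalize // Phi_normalize ?(ltW) //.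
    congr Phi; rewrite /normalize nrm_ret min_l ?ltW // invr1 scale1r.
    by rewrite ret_out // ltW.
  by lra.
Qed.

End Depth.

Section NiceNeighbourhood.
Variables (R : realType) (X : topologicalType) (K : CW_structure R X).
Notation I := (unitI R).
Notation J := (cell K).
Implicit Types (i j : J) (t : I).
Variables (H : X -> I -> X) (HF : is_flow K H).
Variables (j0 : J) (v0 : 'rV[R]_(dim j0)) (d rho : R).
Hypotheses (d0 : 0 < d) (d1 : d <= 1) (rho1 : rho < 1).
Hypothesis v0d : forall w a, `|w - v0| <= d -> 1 <= a -> a <= 1 + d ->
  nrm (a *: w) <= rho.
Variable O : set X.
Hypothesis oO : open O.
Hypothesis v0O : forall w a, `|w - v0| <= d -> 1 <= a -> a <= 1 + d ->
  O (Phi (a *: w)).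
Variables (T : X -> R) (TD : is_depth v0 d T) (Tb : forall x, 1 <= T x <= 1 + d).

(** The first condition says that the flow line enters the ball around [v0]. The line is then
    followed beyond its entry point [w], for the further factor [1 + |w - v0|], because [T] is
    continuous and the entry time need not be; [v0O] keeps this extra stretch in [O]. *)
Let U := [set y | T y < 1 + d /\ forall t, 1 + ival t <= T y -> O (H y t)].

Let cH := flow_continuous HF.
Let cT := depth_continuous d1 TD Tb.
Let T1 x : 1 <= T x. Proof. by case/andP: (Tb x). Qed.
Let Td x : T x <= 1 + d. Proof. by case/andP: (Tb x). Qed.

Let stop (y : X) (t : I) : I := clamp (Num.min (ival t) (T y - 1)).

Let stopE y t : ival (stop y t) = Num.min (ival t) (T y - 1).
Proof.
rewrite clampE // le_min ival_ge0 subr_ge0 T1 /= ge_min.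
by have := ival_le1 t; lra.
Qed.

Let stop_continuous : continuous (fun yt : X * I => stop yt.1 yt.2).
Proof.
apply: cont_comp; last exact: clamp_continuous.
apply: cont_min; first by apply: cont_comp; [exact: cont_snd|exact: ival_continuous].
by apply: cont_sub; [apply: cont_comp; [exact: cont_fst|exact: cT]|exact: cont_cst].
Qed.

Let flow_stop_continuous : continuous (fun yt : X * I => H yt.1 (stop yt.1 yt.2)).
Proof.
apply: (cont_comp (f := fun yt : X * I => (yt.1, stop yt.1 yt.2)) _ cH).
by apply: continuous_pair; [exact: cont_fst|exact: stop_continuous].
Qed.

Lemma base_nrm w : `|w - v0| <= d -> nrm w < 1.
Proof.
by move=> /v0d/(_ (lexx 1)); rewrite scale1r lerDl => /(_ (ltW d0)) h; exact: le_lt_trans rho1.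
Qed.

(** Freezing the flow at time [T y] turns the second condition into one on all parameters of a
    compact interval: the stopped path lies in [O]. That is open in the compact-open topology, and
    the stopped path depends continuously on [y]. *)
Lemma depth_open : open U.
Proof.
have cpath y : continuous (fun t => H y (stop y t)).
  apply: (cont_comp (f := fun t => (y, t)) _ flow_stop_continuous).
  by apply: continuous_pair; [exact: cont_cst|exact: cont_id].
pose a y : path_space R X := path_of (@cpath y).
have ca : continuous a by apply: curry_path_continuous; exact: flow_stop_continuous.
rewrite openE => y [Ty yO]; rewrite /interior.
have h1 : \forall z \near y, T z < 1 + d.
  have : nbhs (T y) [set x | x < 1 + d] by apply: open_nbhs_nbhs; split; [exact: open_lt|].
  exact: cT.
have h2 : \forall z \near y, forall t, setT t -> O (a z t).
  have /path_space_cvgP := ca y; apply => //; first exact: unitI_compact.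
  move=> t _; rewrite path_ofE; apply: yO; rewrite stopE.
  by rewrite -lerBrDl ge_min lexx orbT.
near=> z; split; first by near: z.
move=> t tT; have az : forall t, setT t -> O (a z t) by near: z.
have := az t Logic.I; rewrite path_ofE (_ : stop z t = t) //; apply: ival_inj; rewrite stopE min_l //.
by rewrite lerBrDl.
Unshelve. all: by end_near. Qed.

Lemma depth_sub : U `<=` O.
Proof. by move=> y [_ /(_ I0)]; rewrite (flow0 HF) ival0 addr0; apply. Qed.

Lemma depth_baseU w : `|w - v0| < d -> U (Phi w).
Proof.
move=> wd; have w1 := base_nrm (ltW wd).
have TE : T (Phi w) = 1 + `|w - v0|.
  by rewrite (depth_base TD) ?(ltW w1) // min_r // ltW.
split; first by rewrite TE ltrD2l.
move=> t; rewrite TE lerD2l => tw.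
have td : 1 + ival t <= 1 + d by rewrite lerD2l (le_trans tw) // ltW.
have t1 : 1 <= 1 + ival t by rewrite lerDl ival_ge0.
have [HE _] := HF t (ltW w1); rewrite HE; first exact: v0O (ltW wd) _ _.
by rewrite -nrm_pZ ?(le_trans ler01) // (le_trans (v0d (ltW wd) _ _)) // ltW.
Qed.

Lemma depth_base_lt (w : 'rV[R]_(dim j0)) : nrm w < 1 -> T (Phi w) < 1 + d ->
  `|w - v0| < d.
Proof.
by move=> w1; rewrite (depth_base TD) ?(ltW w1) // ltrD2l gt_min ltxx.
Qed.

Lemma depth_step j (v : 'rV[R]_(dim j)) : j0 <> j -> nrm v <= 1 -> T (Phi v) < 1 + d ->
  0 < nrm v /\ T (Phi v) * nrm v = T (Phi (normalize v)).
Proof.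
move=> ne v1; have [_ ->] := TD v1; last by [].
case: eqP => [|/eqP vn]; first by rewrite ltxx.
have vp : 0 < nrm v by rewrite lt_neqAle nrm_ge0 andbT eq_sym.
rewrite gt_min ltxx /= => h; split => //.
by rewrite min_r ?(ltW h) // divfK // gt_eqF.
Qed.

(** Moving outwards by [l] divides [T] by [l], and the flow line of [l *: v] is the part of that of
    [v] after the factor [l]. So the conditions at [v] imply those at [l *: v]. *)
Lemma depth_ray j (v : 'rV[R]_(dim j)) l : j0 <> j -> nrm v < 1 -> U (Phi v) ->
  1 <= l -> l * nrm v <= 1 -> U (Phi (l *: v)).
Proof.
move=> ne v1 [Tv vO] l1 lv.
have [vp TvE] := depth_step ne (ltW v1) Tv.
have l0 : 0 < l by apply: lt_le_trans l1.
have lv1 : nrm (l *: v) <= 1 by rewrite nrm_pZ // ltW.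
have TlE : T (Phi (l *: v)) = T (Phi v) / l.
  have [_ ->] := TD lv1; last by [].
  rewrite nrm_pZ ?(ltW l0) // gt_eqF ?mulr_gt0 // normalizeZ // -TvE.
  rewrite invfM mulrACA divff ?gt_eqF // mulr1 min_r //.
  by rewrite ler_pdivrMr // (le_trans (ltW Tv)) // ler_peMr // addr_ge0 // ltW.
have Tll : T (Phi v) / l <= T (Phi v).
  by rewrite ler_pdivrMr // ler_peMr // (le_trans ler01).
split; first by rewrite TlE (le_lt_trans Tll).
move=> t; rewrite TlE ler_pdivlMr // => tT.
have t0 := ival_ge0 t.
have lt1 : 1 <= (1 + ival t) * l by nra.
have t2E : ival (clamp ((1 + ival t) * l - 1)) = (1 + ival t) * l - 1.
  by rewrite clampE // subr_ge0 lt1 /= lerBlDr (le_trans tT) // (le_trans (ltW Tv)) // lerD2l.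
have := vO (clamp ((1 + ival t) * l - 1)); rewrite t2E [1 + _]addrC subrK => /(_ tT).
congr O.
have [A B] := HF (clamp ((1 + ival t) * l - 1)) (ltW v1).
have [C D] := HF t lv1; move: A B C D; rewrite t2E [1 + (_ - _)]addrC subrK.
rewrite nrm_pZ ?(ltW l0) // normalizeZ // scalerA mulrA.
by case: (leP ((1 + ival t) * l * nrm v) 1) => h A B C D;
  [rewrite A ?C|rewrite B ?D // ltW].
Qed.

(** Run radially to the boundary of the cell, staying in [U] by [depth_ray], and continue by
    induction on dimension in the lower cell; the last piece is a straight segment in the sup ball
    around [v0]. *)
Lemma depth_path_to_base y : U y ->
  exists c : path_space R X, [/\ path_in U c, c I0 = y & c I1 = Phi v0].
Proof.
have [j [v [+ <-]]] := Phi_cover K y.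
elim/(@dim_ind _ _ K): j v => j IH v v1 Uv.
have [e|ne] := pselect (j0 = j).
  case: j / e IH v v1 Uv => _ v v1 Uv.
  have vd := depth_base_lt v1 Uv.1.
  exists (map_path (@Phi_continuous _ _ K j0) (segment v v0)); split.
  - move=> t; rewrite map_pathE segmentE; apply: depth_baseU.
    have -> : (1 - ival t) *: v + ival t *: v0 - v0 = (1 - ival t) *: (v - v0).
      by apply/rowP => k; rewrite !mxE; ring.
    rewrite normrZ; apply: le_lt_trans vd; rewrite ler_piMl //.
    by rewrite ger0_norm; have := ival_ge0 t; have := ival_le1 t; lra.
  - by rewrite map_pathE segment0.
  - by rewrite map_pathE segment1.
have [vp _] := depth_step ne (ltW v1) Uv.1.
have seg_scale (t : I) : exists l, [/\ 1 <= l, l * nrm v <= 1 &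
    segment v (normalize v) t = l *: v].
  exists (1 - ival t + ival t / nrm v); split.
  - have : 1 <= (nrm v)^-1 by rewrite invf_ge1 // ltW.
    by move: (nrm v)^-1 => r; have := ival_ge0 t; nra.
  - rewrite mulrDl divfK ?gt_eqF //.
    by have := ival_ge0 t; have := ival_le1 t; move: (nrm v) v1 => r; nra.
  - by rewrite segmentE /normalize scalerA -scalerDl.
have Un : U (Phi (normalize v)).
  apply: depth_ray => //; first by rewrite invf_ge1 // ltW.
  by rewrite mulVf // gt_eqF.
have [F [_ Fd /(_ (normalize v))]] := Phi_boundary j.
rewrite nrm_normalize // => /(_ (lexx _)) [i [w [Fi w1 vw]]].
have [|c [cU c0 c1]] := IH i (Fd _ Fi) w w1; first by rewrite -vw.
pose b := map_path (@Phi_continuous _ _ K j) (segment v (normalize v)).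
have bc : b I1 = c I0 by rewrite map_pathE segment1 c0.
exists (concat bc); split; last 2 first.
- by rewrite concat0 map_pathE segment0.
- by rewrite concat1.
move=> t; rewrite concatE; case: ifP => // _.
have [l [l1 lv lE]] := seg_scale (lhalf t).
by rewrite map_pathE lE; exact: depth_ray.
Qed.

(** The relation [T (Phi v) * nrm v = T (Phi (normalize v)) >= 1] shows that a factor of at least
    [T] leaves every intermediate cell and is still at least [T] in the next one. The last clause
    records that flowing for exactly [T] leaves exactly [T] at the entry point. *)
Lemma depth_flow j (v : 'rV[R]_(dim j)) t : nrm v < 1 -> T (Phi v) < 1 + d ->
  T (Phi v) <= 1 + ival t -> exists (w : 'rV[R]_(dim j0)) t',
    [/\ `|w - v0| < d, H (Phi v) t = H (Phi w) t' &
        1 + ival t = T (Phi v) -> 1 + ival t' = T (Phi w)].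
Proof.
elim/(@dim_ind _ _ K): j v t => j IH v t v1 Tv tT.
have [e|ne] := pselect (j0 = j).
  case: j / e IH v v1 Tv tT => _ v v1 Tv tT.
  by exists v, t; split => //; exact: depth_base_lt.
have [vp TvE] := depth_step ne (ltW v1) Tv.
have h : 1 <= (1 + ival t) * nrm v.
  by rewrite (le_trans (T1 (Phi (normalize v)))) // -TvE ler_pM2r.
have [_ /(_ h) HE] := HF t (ltW v1).
set t1 := clamp _ in HE.
have t1E : ival t1 = (1 + ival t) * nrm v - 1.
  rewrite clampE // subr_ge0 h /= lerBlDr.
  by have := ival_ge0 t; have := ival_le1 t; move: (nrm v) vp v1 => r; nra.
have [F [_ Fd /(_ (normalize v))]] := Phi_boundary j.
rewrite nrm_normalize // => /(_ (lexx _)) [i [w [Fi w1 vw]]].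
have [||w' [t' [w'd E1 E2]]] := IH i (Fd _ Fi) w t1 w1.
- rewrite -vw -TvE; apply: le_lt_trans Tv; rewrite ler_piMr ?(ltW v1) //.
  exact: le_trans ler01 (T1 _).
- by rewrite -vw -TvE t1E [1 + (_ - _)]addrC subrK ler_pM2r.
exists w', t'; split => //; first by rewrite HE vw.
by move=> e; apply: E2; rewrite t1E [1 + (_ - _)]addrC subrK -vw -TvE e.
Qed.

(* Flowing every point [c s] of a loop in [U] for the time [T (c s)] is a free
   homotopy to a loop in a closed ball of the cell [j0]. *)
Lemma depth_loop (c : path_space R X) y : path_in U c -> c I0 = y -> c I1 = y ->
  path_class c = pid R y.
Proof.
move=> cU c0 c1.
pose G (st : R^o * R^o) := H (c (clamp st.1)) (clamp (ival (clamp st.2) * (T (c (clamp st.1)) - 1))).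
have cc : continuous (fun st : R^o * R^o => c (clamp st.1)).
  apply: cont_comp; last exact: cts_fun.
  by apply: cont_comp; [exact: cont_fst|exact: clamp_continuous].
have cG : continuous G.
  apply: (cont_comp (f := fun st : R^o * R^o => (c (clamp st.1),
    clamp (ival (clamp st.2) * (T (c (clamp st.1)) - 1)))) _ cH).
  apply: continuous_pair => //; apply: cont_comp; last exact: clamp_continuous.
  apply: cont_mul.
    apply: cont_comp; last exact: ival_continuous.
    by apply: cont_comp; [exact: cont_snd|exact: clamp_continuous].
  by apply: cont_sub; [apply: cont_comp => //; exact: cT|exact: cont_cst].
have := square_class cG.
have clampI0 : clamp 0 = I0 :> I by [].
have clampI1 : clamp 1 = I1 :> I by [].
have GE0 s : G (s, 0) = c (clamp s).
  by rewrite /G /= clampI0 ival0 mul0r clampI0 (flow0 HF).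
(* Since [c] is a loop, both vertical sides of the square are the track of its base point. *)
have -> : seg cG (1, 0) (1, 1) = seg cG (0, 0) (0, 1).
  congr path_class; apply: path_eq => t; rewrite !map_pathE !segmentE /G /=.
  rewrite !scaler0 !addr0 [_ *: 1]mulr1 [ival t *: 1]mulr1 subrK clampI1 clampI0 c0 c1.
  by rewrite add0r.
have -> : seg cG (0, 0) (1, 0) = path_class c.
  congr path_class; apply: path_eq => t; rewrite map_pathE segmentE.
  have -> : (1 - ival t) *: ((0, 0) : R^o * R^o) + ival t *: ((1, 0) : R^o * R^o) =
      (ival t, 0).
    by congr (_, _); rewrite /= ?scaler0 ?add0r ?addr0 // [LHS]mulr1.
  by rewrite GE0 ivalK.
(* [Phi] embeds the compact ball of radius [rho < 1], being injective on the open disk. The end of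
   the homotopy lies in its image, so it lifts to a loop in a vector space, which is trivial. *)
have [w wP] : exists w : path_space R 'rV[R]_(dim j0), forall t, nrm (w t) <= rho /\
    Phi (w t) = G (ival t, 1).
  have inj (a b : 'rV[R]_(dim j0)) : ball_le rho a -> ball_le rho b ->
      Phi a = Phi b -> a = b.
    move=> ar br ab.
    exact: Phi_inj (le_lt_trans ar rho1) (le_lt_trans br rho1) ab.
  have cid : {within ball_le rho, continuous (fun v : 'rV[R]_(dim j0) => v)}.
    by apply: continuous_subspaceT; exact: cont_id.
  have [g [gE cg]] := @compact_descend _ _ _ _ _ _ (0 : 'rV[R]_(dim j0))
    (@ball_le_compact R (dim j0) rho) (@CW_hausdorff R X K) (@Phi_continuous _ _ K j0) cid inj.
  have Gim t : exists2 v : 'rV[R]_(dim j0), nrm v <= rho & Phi v = G (ival t, 1).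
    rewrite /G /= ivalK clampI1 ival1 mul1r.
    have [j [v [v1 vE]]] := Phi_cover K (c t).
    have tE : 1 + ival (clamp (T (c t) - 1)) = T (c t).
      by rewrite clampE ?[1 + _]addrC ?subrK // subr_ge0 T1 lerBlDr (le_trans (Td _)) // lerD2l.
    have Tv : T (Phi v) < 1 + d by rewrite vE; have [] := cU t.
    have Tt : T (Phi v) <= 1 + ival (clamp (T (c t) - 1)) by rewrite tE vE.
    have [w [t' [wd HE TE]]] := depth_flow v1 Tv Tt; rewrite vE in HE TE; rewrite HE.
    have w1 := base_nrm (ltW wd).
    have t'E := TE tE.
    have TwE : 1 + ival t' <= 1 + d by rewrite t'E.
    exists ((1 + ival t') *: w).
      by apply: v0d => //; [exact: ltW|rewrite lerDl ival_ge0].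
    have [-> //] := HF t' (ltW w1).
    by rewrite -nrm_pZ ?(le_trans ler01) ?lerDl ?ival_ge0 // ltW // (le_lt_trans _ rho1) //;
      apply: v0d => //; [exact: ltW|rewrite lerDl ival_ge0].
  have cg' : continuous (fun t : I => g (G (ival t, 1))).
    apply/within_continuousT.
    apply: (within_comp (r := fun t : I => G (ival t, 1))) cg; last first.
      by move=> t _; have [v ? <-] := Gim t; exists v.
    apply/within_continuousT; apply: (@cont_comp I _ X (fun t : I => ((ival t, 1) : R^o * R^o)) G) => //.
    by apply: continuous_pair; [exact: ival_continuous|exact: cont_cst].
  exists (path_of cg') => t; rewrite path_ofE.
  by have [v vr vE] := Gim t; rewrite -vE gE.
have GE1 : G (0, 1) = G (1, 1) by rewrite /G /= clampI0 clampI1 c0 c1.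
have w01 : w I0 = w I1.
  have [w0r w0E] := wP I0; have [w1r w1E] := wP I1.
  have w01 : Phi (w I0) = Phi (w I1) by rewrite w0E w1E ival0 ival1.
  exact: Phi_inj (le_lt_trans w0r rho1) (le_lt_trans w1r rho1) w01.
have -> : seg cG (0, 1) (1, 1) = pid R (G (0, 1)).
  have -> : seg cG (0, 1) (1, 1) = path_class (map_path (@Phi_continuous _ _ K j0) w).
    congr path_class; apply: path_eq => t; rewrite !map_pathE (wP t).2 segmentE.
    congr G; congr (_, _); rewrite /=.
      by rewrite scaler0 add0r [LHS]mulr1.
    by rewrite -scalerDl subrK scale1r.
  by rewrite map_seg w01 seg_id (wP I1).2 ival1 GE1.
(* The square has become [k = pmul (path_class c) k]; cancelling the track [k] makes [c] trivial. *)
set k := seg cG (0, 0) (0, 1) => e.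
have k1 : tgt k = G (0, 1) by rewrite tgt_seg.
have k0 : src k = y by rewrite src_seg GE0 clampI0 c0.
rewrite -k1 pmulp1 in e.
rewrite -(@pmulK _ _ (path_class c) k) ?tgt_class ?k0 ?c1 // -e pmulpV k0 //.
Qed.

End NiceNeighbourhood.

(** * Local structure of a CW complex: nice basis and finiteness after flowing *)

Section CWLocal.
Variables (R : realType) (X : topologicalType) (K : CW_structure R X).
Notation I := (unitI R).
Notation J := (cell K).
Implicit Types (i j : J) (t : I).

(** Continuity of scaling at [(1, v0)]. The bound [rho] is the midpoint of [nrm v0] and 1; [d] is
    half the smaller of the two radii obtained, so that closed balls fit into open ones, and is
    capped at 1. *)
Lemma base_radius j (v0 : 'rV[R]_(dim j)) (O : set X) : nrm v0 < 1 -> open O ->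
  O (Phi v0) -> exists d rho : R, [/\ 0 < d, d <= 1, rho < 1 &
    forall w a, `|w - v0| <= d -> 1 <= a -> a <= 1 + d ->
      nrm (a *: w) <= rho /\ O (Phi (a *: w))].
Proof.
move=> v01 oO Ov0; pose rho : R := (1 + nrm v0) / 2.
have rhov : nrm v0 < rho by rewrite /rho; lra.
pose m (aw : R^o * 'rV[R]_(dim j)) := aw.1 *: aw.2.
have cm : continuous m by apply: cont_scale; [exact: cont_fst|exact: cont_snd].
have n1 : \forall aw \near ((1, v0) : R^o * 'rV[R]_(dim j)), nrm (m aw) < rho.
  have cnm := cont_comp cm (@nrm_continuous R (dim j)).
  apply: (cnm (1, v0) [set x | x < rho]); apply: open_nbhs_nbhs; split.
    exact: open_lt.
  by rewrite /m /= scale1r.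
have n2 : \forall aw \near ((1, v0) : R^o * 'rV[R]_(dim j)), O (Phi (m aw)).
  have cnm := cont_comp cm (@Phi_continuous _ _ K j).
  by apply: (cnm (1, v0) O); apply: open_nbhs_nbhs; split => //; rewrite /m /= scale1r.
have [[P Q] [/= /nbhs_ballP [e1 /= e10 e1P] /nbhs_ballP [e2 /= e20 e2Q]] PQ] := filterI n1 n2.
exists (Num.min 1 (Num.min e1 e2 / 2)), rho; split.
- by rewrite lt_min ltr01 divr_gt0 // lt_min e10.
- by rewrite ge_min lexx.
- by rewrite /rho; lra.
move=> w a; rewrite le_min => /andP[_ wv] a1.
have m1 : Num.min e1 e2 <= e1 by rewrite ge_min lexx.
have m2 : Num.min e1 e2 <= e2 by rewrite ge_min lexx orbT.
have ad' : Num.min 1 (Num.min e1 e2 / 2) <= Num.min e1 e2 / 2 by rewrite ge_min lexx orbT.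
move=> ad.
have [] : (fun aw => nrm (m aw) < rho) (a, w) /\ O (Phi (m (a, w))).
  apply: (PQ (a, w)); split => /=.
    apply: e1P; rewrite -ball_normE /ball_ /= distrC ger0_norm; last by rewrite subr_ge0.
    by move: ad ad' m1 e10; lra.
  apply: e2Q; rewrite -ball_normE /ball_ /= distrC; apply: (le_lt_trans wv).
  by move: m2 e20; lra.
by move=> h1 h2; split => //; exact: ltW.
Qed.

Lemma CW_nice x (O : set X) : open O -> O x ->
  exists U, [/\ nice R U, U x & U `<=` O].
Proof.
move=> oO Ox; have [H HF] := flow_exists K x.
have [j [v [v1 vx]]] := Phi_cover K x; rewrite -vx in Ox.
have [d [rho [d0 d1 rho1 h]]] := base_radius v1 oO Ox.
have h1 w a : `|w - v| <= d -> 1 <= a -> a <= 1 + d -> nrm (a *: w) <= rho.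
  by move=> wd a1 ad; have [] := h w a wd a1 ad.
have h2 w a : `|w - v| <= d -> 1 <= a -> a <= 1 + d -> O (Phi (a *: w)).
  by move=> wd a1 ad; have [] := h w a wd a1 ad.
have [T [TD Tb]] := depth_exists d0 rho1 h1.
set U := [set y | T y < 1 + d /\ forall t, 1 + ival t <= T y -> O (H y t)].
exists U; split.
- split.
  + exact: (depth_open HF d1 oO TD Tb).
  + move=> y z Uy Uz.
    have [a [aU a0 a1]] := depth_path_to_base HF d0 d1 rho1 h1 h2 TD Tb Uy.
    have [b [bU b0 b1]] := depth_path_to_base HF d0 d1 rho1 h1 h2 TD Tb Uz.
    have e : a I1 = rev_path b I0 by rewrite rev_path0 a1 b1.
    exists (concat e); split; [|by rewrite concat0|by rewrite concat1 rev_path1].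
    by move=> t; rewrite concatE; case: ifP => // _; [exact: (aU (lhalf t))|exact: (bU (irev (rhalf t)))].
  + move=> y c _ cU c0 c1.
    exact: (depth_loop HF d0 d1 rho1 h1 TD Tb cU).
- by rewrite -vx; apply: (depth_baseU HF d0 rho1 h1 h2 TD); rewrite subrr normr0.
- exact: (depth_sub HF Tb).
Qed.

Variables (H : X -> I -> X) (HF : is_flow K H).

(** Induction on dimension through closure finiteness: a flow line starting in [j] stays in its
    closed cell or continues from one of finitely many lower cells. *)
Lemma flow_closure_finite j : exists F : set J, finite_set F /\
  forall (v : 'rV[R]_(dim j)) t, exists2 i, F i & closed_cell i (H (Phi v) t).
Proof.
elim/(@dim_ind _ _ K): j => j IH.
have [F [finF Fd FS]] := Phi_boundary j.
have {}IH i : exists G : set J, finite_set G /\ (F i ->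
  forall (v : 'rV[R]_(dim i)) t, exists2 k, G k & closed_cell k (H (Phi v) t)).
  have [Fi|nFi] := pselect (F i); last by exists set0; split.
  by have [G [finG GP]] := IH i (Fd _ Fi); exists G.
have [G GP] := choice IH.
exists (j |` \bigcup_(i in F) G i); split.
  rewrite finite_setU; split; first exact: finite_set1.
  by apply: bigcup_finite => // i Fi; have [] := GP i.
move=> v t; rewrite -Phi_ret.
have [A B] := HF t (nrm_ret_le1 v).
case: (leP ((1 + ival t) * nrm (ret v)) 1) => h.
  by exists j; [left|rewrite A //; exact: Phi_closed_cell].
have rp : 0 < nrm (ret v).
  by rewrite lt_neqAle nrm_ge0 andbT eq_sym; apply: contraTneq h => ->; rewrite mulr0 ltr10.
have [|i [w [Fi w1 vw]]] := FS (normalize (ret v)); first by rewrite nrm_normalize.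
rewrite B ?ltW // vw.
have [k Gk kP] := (GP i).2 Fi w (clamp ((1 + ival t) * nrm (ret v) - 1)).
by exists k => //; right; exists i.
Qed.

(** Near [x] the depth relative to its own cell [j] is below [1 + d <= 2], so at parameter 1 the
    flow has already entered [j]. From there only the finitely many cells of [flow_closure_finite]
    are visited. *)
Lemma flow_locally_finite (x : X) : exists F : set J, finite_set F /\
  (\forall y \near x, exists2 i, F i & closed_cell i (H y I1)).
Proof.
have [j [v [v1 vx]]] := Phi_cover K x.
have [d [rho [d0 d1 rho1 h]]] := base_radius v1 (@openT X) Logic.I.
have h1 w a : `|w - v| <= d -> 1 <= a -> a <= 1 + d -> nrm (a *: w) <= rho.
  by move=> wd a1 ad; have [] := h w a wd a1 ad.
have [T [TD Tb]] := depth_exists d0 rho1 h1.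
have [F [finF FP]] := flow_closure_finite j.
exists F; split => //.
have cT := depth_continuous d1 TD Tb.
have nT : nbhs (T x) [set r | r < 1 + d].
  apply: open_nbhs_nbhs; split; first exact: open_lt.
  by rewrite /= -vx (depth_base TD) ?(ltW v1) // subrr normr0 min_r ?ltW // addr0 ltrDl.
near=> y; have Ty : T y < 1 + d by near: y; exact: cT x _ nT.
have [i [w [w1 wy]]] := Phi_cover K y; rewrite /= -wy in Ty *.
have [|w' [t' [_ -> _]]] := depth_flow HF TD Tb w1 Ty (t := I1).
  by rewrite ival1 (le_trans (ltW Ty)) // lerD2l.
exact: FP.
Unshelve. all: by end_near. Qed.

End CWLocal.

(** * The topology of Pi(X) *)

Section PathClassTopology.
Variables (R : realType) (X : topologicalType).
Notation I := (unitI R).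
Implicit Types (p q : path_classes R X) (U V : set X).

(** The basic open sets written with the groupoid product and centred at a class instead of a path,
    which makes inclusions and uniqueness a matter of algebra. *)
Definition nbd U V p : set (path_classes R X) :=
  [set q | exists d1 d2 : path_space R X, [/\ path_in U d1, path_in V d2,
    d1 I1 = src p, d2 I0 = tgt p &
    q = pmul (pmul (path_class d1) p) (path_class d2)]].

Lemma basic_openE U V (c : path_space R X) :
  basic_open U V c = nbd U V (path_class c).
Proof.
apply/seteqP; split => q.
  move=> [d1 [d2 [e1 [e2 [d1U d2V ->]]]]]; exists d1, d2.
  rewrite src_class tgt_class; split => //.
  by rewrite (pmul_class e1) (pmul_class (etrans (concat1 e1) e2)).
move=> [d1 [d2 [d1U d2V]]]; rewrite src_class tgt_class => e1 /esym e2 ->.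
exists d1, d2, e1, e2; split => //.
by rewrite (pmul_class e1) (pmul_class (etrans (concat1 e1) e2)).
Qed.

Lemma nbd_open U V p : nice R U -> nice R V -> U (src p) -> V (tgt p) ->
  open (nbd U V p).
Proof.
move=> nU nV Up Vp.
have bo : basic_opens (nbd U V p).
  by exists U, V, (repr p); rewrite basic_openE path_classK.
exists [set nbd U V p]; last by rewrite bigcup_set1.
move=> _ ->; exists (fset1 (nbd U V p)) => //; last by rewrite set_fset1 bigcap_set1.
by move=> _ /[!inE] ->.
Qed.

Lemma nbd_refl U V p : U (src p) -> V (tgt p) -> nbd U V p p.
Proof.
move=> Up Vp; exists (cst_path R (src p)), (cst_path R (tgt p)); split => //.
by rewrite -/(pid R (src p)) -/(pid R (tgt p)) pmul1p pmulp1.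
Qed.

Lemma nbd_src U V p q : nbd U V p q -> U (src q).
Proof.
move=> [d1 [d2 [d1U d2V e1 e2 ->]]].
rewrite src_mul ?tgt_mul ?src_mul ?src_class ?tgt_class //; exact: d1U.
Qed.

Lemma nbd_tgt U V p q : nbd U V p q -> V (tgt q).
Proof.
move=> [d1 [d2 [d1U d2V e1 e2 ->]]].
rewrite tgt_mul ?tgt_mul ?src_class ?tgt_class //; exact: d2V.
Qed.

Lemma path_in_pcat U (c d : path_space R X) : path_in U c -> path_in U d ->
  path_in U (pcat c d).
Proof.
move=> cU dU t; rewrite /pcat; case: pselect => // e; rewrite concatE.
by case: ifP.
Qed.

Lemma nbd_sub U V U' V' p q : nbd U V p q -> U' `<=` U -> V' `<=` V ->
  nbd U' V' q `<=` nbd U V p.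
Proof.
move=> [d1 [d2 [d1U d2V e1 e2 qE]]] UU VV r [c1 [c2 [c1U c2V f1 f2 ->]]].
have sq : src q = d1 I0.
  by rewrite qE src_mul ?tgt_mul ?src_mul ?src_class ?tgt_class.
have tq : tgt q = d2 I1.
  by rewrite qE tgt_mul ?tgt_mul ?src_class ?tgt_class.
rewrite sq in f1; rewrite tq in f2.
exists (pcat c1 d1), (pcat d2 c2); split.
- by apply: path_in_pcat => // t; exact: UU.
- by apply: path_in_pcat => // t; exact: VV.
- by rewrite pcat1.
- by rewrite pcat0.
rewrite -!pmul_pcat // qE.
have a1 : tgt (path_class c1) = src (path_class d1) by rewrite src_class tgt_class.
have a2 : tgt (path_class d1) = src p by rewrite tgt_class.
have a3 : tgt p = src (path_class d2) by rewrite src_class.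
have a4 : tgt (path_class d2) = src (path_class c2) by rewrite src_class tgt_class.
by rewrite !pmulA ?src_mul ?tgt_mul ?src_mul.
Qed.

Lemma nice_path_class U (c d : path_space R X) : nice R U -> path_in U c ->
  path_in U d -> c I0 = d I0 -> c I1 = d I1 -> path_class c = path_class d.
Proof.
move=> [_ _ nU] cU dU cd0 cd1.
have e : c I1 = rev_path d I0 by rewrite rev_path0.
have revU : path_in U (rev_path d) by move=> t; rewrite rev_pathE; exact: dU.
have := nU (c I0) (pcat c (rev_path d)) (cU _) (path_in_pcat cU revU).
rewrite pcat0 // pcat1 // rev_path1 cd0 => /(_ erefl erefl).
rewrite -(pmul_pcat e) -pinv_class => h.
have := @pmulKr R X (path_class c) (path_class d).
rewrite !tgt_class => /(_ cd1); rewrite h => <-.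
by rewrite -[cst_path R _ in LHS]/(cst_path R _) -/(pid R _) -{1}(src_class d) pmul1p.
Qed.

(** Paths in a nice set are determined up to homotopy by their ends, so near [p] a class is
    determined by its endpoints: locally the space of classes looks like a subset of [X * X]. *)
Lemma nbd_inj U V p q q' : nice R U -> nice R V -> nbd U V p q -> nbd U V p q' ->
  src q = src q' -> tgt q = tgt q' -> q = q'.
Proof.
move=> nU nV [d1 [d2 [d1U d2V e1 e2 ->]]] [d1' [d2' [d1U' d2V' e1' e2' ->]]].
have sE (c1 c2 : path_space R X) : c1 I1 = src p -> c2 I0 = tgt p ->
    src (pmul (pmul (path_class c1) p) (path_class c2)) = c1 I0.
  by move=> h1 h2; rewrite !src_mul ?tgt_mul ?src_mul ?src_class ?tgt_class.
have tE (c1 c2 : path_space R X) : c1 I1 = src p -> c2 I0 = tgt p ->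
    tgt (pmul (pmul (path_class c1) p) (path_class c2)) = c2 I1.
  by move=> h1 h2; rewrite !tgt_mul ?tgt_mul ?src_class ?tgt_class.
rewrite !sE // !tE // => f1 f2.
rewrite (nice_path_class nU d1U d1U') ?e1 //.
by rewrite (nice_path_class nV d2V d2V') ?e2.
Qed.

Hypothesis nice_basis : forall x (O : set X), open O -> O x ->
  exists U, [/\ nice R U, U x & U `<=` O].

Lemma nbd_basis p (W : set (path_classes R X)) : nbhs p W ->
  exists U V, [/\ nice R U, nice R V, U (src p), V (tgt p) & nbd U V p `<=` W].
Proof.
rewrite nbhsE => -[B [[D DF <-] [A DA Ap]] BW].
have [F Fb AE] := DF _ DA.
suff [U [V [nU nV Up Vp UVA]]] : exists U V, [/\ nice R U, nice R V, U (src p),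
    V (tgt p) & nbd U V p `<=` A].
  by exists U, V; split => // q /UVA Aq; apply: BW; exists A.
rewrite -AE in Ap *.
have {}Fb (b : set (path_classes R X)) : b \in (F : seq _) -> basic_opens b.
  by move=> bF; have := Fb b bF; rewrite inE.
have : forall b : set (path_classes R X), b \in (F : seq _) -> b p by move=> b bF; exact: Ap.
(* The topology is generated by a subbasis, so finite intersections have to be handled: each member
   of the list shrinks the current pair of nice sets, using [nice_basis] inside the intersection. *)
suff : forall s : seq (set (path_classes R X)), (forall b, b \in s -> basic_opens b) ->
    (forall b, b \in s -> b p) -> exists U V, [/\ nice R U, nice R V, U (src p),
    V (tgt p) & forall q, nbd U V p q -> forall b, b \in s -> b q].
  move=> /(_ _ Fb) h /h [U [V [nU nV Up Vp UVs]]].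
  by exists U, V; split => // q /UVs qs b; exact: qs.
elim=> [|b s IH] sb sp.
  have [U [nU Up _]] := nice_basis (@openT X) (Logic.I : setT (src p)).
  have [V [nV Vp _]] := nice_basis (@openT X) (Logic.I : setT (tgt p)).
  by exists U, V.
have [| |U [V [nU nV Up Vp UVs]]] := IH.
- by move=> b' b's; apply: sb; rewrite inE b's orbT.
- by move=> b' b's; apply: sp; rewrite inE b's orbT.
have [U1 [V1 [c [nU1 nV1 Uc Vc bE]]]] := sb b (mem_head _ _).
have bp := sp b (mem_head _ _).
rewrite bE basic_openE in bp.
have [oU _ _] := nU; have [oU1 _ _] := nU1.
have [oV _ _] := nV; have [oV1 _ _] := nV1.
have [U2 [nU2 U2p U2s]] := nice_basis (openI oU oU1)
  (conj Up (nbd_src bp)).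
have [V2 [nV2 V2p V2s]] := nice_basis (openI oV oV1)
  (conj Vp (nbd_tgt bp)).
exists U2, V2; split => // q qb b'; rewrite inE => /orP [/eqP ->|b's].
  rewrite bE basic_openE; apply: nbd_sub bp _ _ _ qb.
    by move=> x /U2s [].
  by move=> x /V2s [].
apply: (UVs q) => //; apply: (nbd_sub (nbd_refl Up Vp)) qb.
  by move=> x /U2s [].
by move=> x /V2s [].
Qed.

Lemma src_continuous : continuous (@src R X).
Proof.
move=> p W; rewrite nbhsE => -[N [oO Op] OW].
have [U [nU Up UO]] := nice_basis oO Op.
have [V [nV Vp _]] := nice_basis (@openT X) (Logic.I : setT (tgt p)).
apply: (@filterS _ _ _ (nbd U V p)); first by move=> q /nbd_src /UO /OW.
by apply: open_nbhs_nbhs; split; [exact: nbd_open|exact: nbd_refl].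
Qed.

Lemma tgt_continuous : continuous (@tgt R X).
Proof.
move=> p W; rewrite nbhsE => -[N [oO Op] OW].
have [U [nU Up UO]] := nice_basis oO Op.
have [V [nV Vp _]] := nice_basis (@openT X) (Logic.I : setT (src p)).
apply: (@filterS _ _ _ (nbd V U p)); first by move=> q /nbd_tgt /UO /OW.
by apply: open_nbhs_nbhs; split; [exact: nbd_open|exact: nbd_refl].
Qed.

Lemma cvg_path_classes (T : Type) (F : set_system T) (f : T -> path_classes R X) p :
  Filter F -> (forall U V, nice R U -> nice R V -> U (src p) -> V (tgt p) ->
    \forall y \near F, nbd U V p (f y)) -> f @ F --> p.
Proof.
move=> FF h W /nbd_basis [U [V [nU nV Up Vp UVW]]].
by apply: filterS (h U V nU nV Up Vp) => y /UVW.
Qed.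

End PathClassTopology.

(** * Filling spheres *)

Section FillSquare.
Variables (R : realType) (X : topologicalType).
Notation I := (unitI R).

(* The two boundary paths of the unit square from (0,0) to (1,1), joined by
   straight lines, sweep out the square; a homotopy relative to the endpoints
   descends along this sweep. *)
Lemma fill_square (a b c d : path_space R X) :
  a I0 = c I0 -> a I1 = b I0 -> c I1 = d I0 -> b I1 = d I1 ->
  pmul (path_class a) (path_class b) = pmul (path_class c) (path_class d) ->
  exists F : R^o * R^o -> X,
    {within [set z | (0 <= z.1 <= 1) && (0 <= z.2 <= 1)], continuous F} /\
    forall t : I, [/\ F (0, ival t) = a t, F (ival t, 1) = b t,
                      F (ival t, 0) = c t & F (1, ival t) = d t].
Proof.
move=> ac ab cd bd; rewrite (pmul_class ab) (pmul_class cd).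
move=> /path_eqP [W [cW W0 W1 Wr]].
pose m1 (t : I) : R := Num.min (2 * ival t) 1.
pose m2 (t : I) : R := Num.max (2 * ival t - 1) 0.
pose k (rt : I * I) : R^o * R^o :=
  ((1 - ival rt.1) * m2 rt.2 + ival rt.1 * m1 rt.2,
   (1 - ival rt.1) * m1 rt.2 + ival rt.1 * m2 rt.2).
have mD t : m1 t + m2 t = 2 * ival t.
  by rewrite /m1 /m2; case: leP => ?; case: leP => ?; lra.
have cm1 : continuous m1.
  apply: cont_min; last exact: cont_cst.
  by apply: cont_mul; [exact: cont_cst|exact: ival_continuous].
have cm2 : continuous m2.
  apply: cont_max; last exact: cont_cst.
  apply: cont_sub; last exact: cont_cst.
  by apply: cont_mul; [exact: cont_cst|exact: ival_continuous].
have ck : continuous k.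
  have c1 : continuous (fun rt : I * I => ival rt.1).
    by apply: cont_comp; [exact: cont_fst|exact: ival_continuous].
  have c1' : continuous (fun rt : I * I => 1 - ival rt.1) by apply: cont_sub => //; exact: cont_cst.
  have c2 : continuous (fun rt : I * I => m1 rt.2) by apply: cont_comp; [exact: cont_snd|].
  have c3 : continuous (fun rt : I * I => m2 rt.2) by apply: cont_comp; [exact: cont_snd|].
  by apply: continuous_pair; apply: cont_add; apply: cont_mul.
(* The coordinate sum recovers the path parameter, and the difference computed next recovers the
   sweep parameter unless [m1 = m2]. That happens only at the two corners, where the homotopy is
   constant, so it descends. *)
have ksum rt : (k rt).1 + (k rt).2 = 2 * ival rt.2 by rewrite -mD /=; ring.
have kdiff rt : (k rt).1 - (k rt).2 = (2 * ival rt.1 - 1) * (m1 rt.2 - m2 rt.2).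
  by rewrite /=; ring.
have mpos t : t <> I0 -> t <> I1 -> 0 < m1 t - m2 t.
  move=> t0 t1; have := ival_ge0 t; have := ival_le1 t.
  rewrite le_eqVlt => /orP [/eqP e|lt1]; first by case: t1; apply: ival_inj; rewrite ival1.
  rewrite le_eqVlt => /orP [/eqP e|lt0]; first by case: t0; apply: ival_inj; rewrite ival0.
  by rewrite /m1 /m2; case: (leP (2 * ival t) 1) => ?;
    case: (leP (2 * ival t - 1) 0) => ?; lra.
have [F [FE cF]] : exists g : R^o * R^o -> X, (forall rt, setT rt -> g (k rt) = W rt) /\
    {within k @` setT, continuous g}.
  apply: (@compact_descend _ _ _ setT k W (W (I0, I0))) => //.
  - by rewrite -setXTT; apply: compact_setX; exact: unitI_compact.
  - exact: continuous_subspaceT.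
  move=> [r t] [r' t'] _ _ krt.
  have tt : t = t'.
    have := ksum (r, t); rewrite krt ksum /= => h; apply: ival_inj.
    by apply: (mulfI (_ : 2 != 0 :> R)); rewrite ?pnatr_eq0.
  rewrite -tt in krt *.
  have [->|t0] := pselect (t = I0); first by rewrite !Wr //; left.
  have [->|t1] := pselect (t = I1); first by rewrite !Wr //; right.
  have := kdiff (r, t); rewrite krt kdiff /= => h.
  have h2 : 2 * ival r' - 1 = 2 * ival r - 1.
    by apply: (mulIf (_ : m1 t - m2 t != 0)) => //; rewrite gt_eqF // mpos.
  by have -> : r = r' by apply: ival_inj; lra.
have hl (t : I) : ival (clamp (ival t / 2)) = ival t / 2.
  by rewrite clampE //; have := ival_le1 t; have := ival_ge0 t; lra.
have hr (t : I) : ival (clamp ((1 + ival t) / 2)) = (1 + ival t) / 2.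
  by rewrite clampE //; have := ival_le1 t; have := ival_ge0 t; lra.
have ml (t : I) : m1 (clamp (ival t / 2)) = ival t /\ m2 (clamp (ival t / 2)) = 0.
  rewrite /m1 /m2 hl; have := ival_le1 t; have := ival_ge0 t.
  by split; [rewrite min_l|rewrite max_r]; lra.
have mr (t : I) : m1 (clamp ((1 + ival t) / 2)) = 1 /\ m2 (clamp ((1 + ival t) / 2)) = ival t.
  rewrite /m1 /m2 hr; have := ival_le1 t; have := ival_ge0 t.
  by split; [rewrite min_r|rewrite max_l]; lra.
exists F; split.
  apply: continuous_subspaceW cF => -[x y] /= /andP[/andP[x0 x1] /andP[y0 y1]].
  pose t : I := clamp ((x + y) / 2).
  have tE : ival t = (x + y) / 2 by rewrite clampE //; lra.
  have [D0|D0] := eqVneq (m1 t - m2 t) 0.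
    exists (I0, t) => //; move: D0; rewrite /k /= ival0 subr0 !mul1r !mul0r !addr0.
    rewrite /m1 /m2 tE => D0; move: D0.
    by case: leP => h1; case: leP => h2 D0; congr (_, _); lra.
  have Dp : 0 < m1 t - m2 t.
    by apply: mpos => e; case/eqP: D0; rewrite /m1 /m2 e ?ival0 ?ival1;
      case: leP => ?; case: leP => ?; lra.
  have xy1 : x - y <= m1 t - m2 t by rewrite /m1 /m2 tE; case: (leP (2 * _) 1) => ?; case: (leP _ 0) => ?; lra.
  have xy2 : y - x <= m1 t - m2 t by rewrite /m1 /m2 tE; case: (leP (2 * _) 1) => ?; case: (leP _ 0) => ?; lra.
  pose q := (x - y) / (m1 t - m2 t).
  have qE : q * (m1 t - m2 t) = x - y by rewrite divfK.
  have q1 : q <= 1 by rewrite ler_pdivrMr // mul1r.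
  have q2 : -1 <= q by rewrite ler_pdivlMr // mulN1r; lra.
  exists (clamp ((q + 1) / 2), t) => //.
  have rE : ival (clamp ((q + 1) / 2)) = (q + 1) / 2 by rewrite clampE //; lra.
  have := ksum (clamp ((q + 1) / 2), t); have := kdiff (clamp ((q + 1) / 2), t).
  case: (k _) => k1 k2 /=; rewrite rE tE => h1 h2.
  have h3 : k1 - k2 = x - y by rewrite h1 -qE; congr (_ * _); lra.
  by congr (_, _); lra.
move=> t; have [l1 l2] := ml t; have [r1 r2] := mr t; split.
- have := FE (I0, clamp (ival t / 2)) Logic.I.
  by rewrite /k /= l1 l2 ival0 subr0 !mul1r !mul0r !addr0 => ->; rewrite W0 concat_l.
- have := FE (I0, clamp ((1 + ival t) / 2)) Logic.I.
  by rewrite /k /= r1 r2 ival0 subr0 !mul1r !mul0r !addr0 => ->; rewrite W0 concat_r.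
- have := FE (I1, clamp (ival t / 2)) Logic.I.
  by rewrite /k /= l1 l2 ival1 subrr !mul1r !mul0r !add0r => ->; rewrite W1 concat_l.
- have := FE (I1, clamp ((1 + ival t) / 2)) Logic.I.
  by rewrite /k /= r1 r2 ival1 subrr !mul1r !mul0r !add0r => ->; rewrite W1 concat_r.
Qed.

End FillSquare.

Section Gauge.
Variables (R : realType) (m n : nat).
Notation V := ('rV[R]_m * 'rV[R]_n)%type.
Implicit Types (z : V).

(** The norm whose unit ball is the product of two Euclidean disks, i.e. the model of a product
    cell. *)
Definition gauge z : R := Num.max (nrm z.1) (nrm z.2).

Lemma gauge_ge0 z : 0 <= gauge z.
Proof. by rewrite le_max nrm_ge0. Qed.

Lemma gaugeZ l z : 0 <= l -> gauge (l *: z) = l * gauge z.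
Proof. by move=> l0; rewrite /gauge /= !nrm_pZ // maxr_pMr. Qed.

Lemma gauge_eq0 z : gauge z = 0 -> z = 0.
Proof.
move=> z0; have h : Num.max (nrm z.1) (nrm z.2) <= 0 by rewrite -/(gauge z) z0.
move: h; rewrite ge_max => /andP[h1 h2].
have e1 : nrm z.1 = 0 by apply: le_anti; rewrite h1 nrm_ge0.
have e2 : nrm z.2 = 0 by apply: le_anti; rewrite h2 nrm_ge0.
by rewrite [z]surjective_pairing (nrm_eq0 e1) (nrm_eq0 e2).
Qed.

Lemma gauge_continuous : continuous gauge.
Proof.
by apply: cont_max; (apply: cont_comp; last exact: nrm_continuous);
  [exact: cont_fst|exact: cont_snd].
Qed.

Lemma gauge_box z : (gauge z <= 1) = (nrm z.1 <= 1) && (nrm z.2 <= 1).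
Proof. by rewrite ge_max. Qed.

Lemma gauge_ray z : (0 < m + n)%N -> gauge z <= 1 ->
  exists l (z1 : V), [/\ 0 <= l, l <= 1, gauge z1 = 1 & z = l *: z1].
Proof.
move=> mn z1; have [/gauge_eq0 ->|g0] := eqVneq (gauge z) 0; last first.
  have gp : 0 < gauge z by rewrite lt_neqAle gauge_ge0 andbT eq_sym.
  exists (gauge z), ((gauge z)^-1 *: z); split => //; first exact: ltW.
    by rewrite gaugeZ ?invr_ge0 ?gauge_ge0 // mulVf.
  by rewrite scalerA divff // scale1r.
(* The origin lies on every ray, so any nonzero direction will do; this one is nonzero because
   [0 < m + n]. *)
pose w : V := (const_mx 1, const_mx 1).
have [/gauge_eq0 w0|g0] := eqVneq (gauge w) 0.
  have e1 : w.1 = 0 by rewrite w0.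
  have e2 : w.2 = 0 by rewrite w0.
  have [m0|mp] := posnP m.
    have np : (0 < n)%N by rewrite m0 in mn.
    move/rowP: e2 => /(_ (Ordinal np)); rewrite !mxE => /eqP.
    by rewrite oner_eq0.
  by move/rowP: e1 => /(_ (Ordinal mp)); rewrite !mxE => /eqP; rewrite oner_eq0.
exists 0, ((gauge w)^-1 *: w); split => //; last by rewrite scale0r.
by rewrite gaugeZ ?invr_ge0 ?gauge_ge0 // mulVf.
Qed.

End Gauge.

Section Transport.
Variables (R : realType) (X : topologicalType) (m n : nat).
Notation I := (unitI R).
Notation V := ('rV[R]_m * 'rV[R]_n)%type.
Variables (a : 'rV[R]_m -> X) (b : 'rV[R]_n -> X).
Hypotheses (ca : continuous a) (cb : continuous b).
Variable (alpha : path_classes R X).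
Hypotheses (alpha0 : src alpha = a 0) (alpha1 : tgt alpha = b 0).

Definition transport (z : V) : path_classes R X :=
  pmul (pmul (seg ca z.1 0) alpha) (seg cb 0 z.2).

Lemma src_transport z : src (transport z) = a z.1.
Proof.
by rewrite src_mul ?tgt_mul ?src_mul ?src_seg ?tgt_seg ?alpha0 ?alpha1.
Qed.

Lemma tgt_transport z : tgt (transport z) = b z.2.
Proof. by rewrite tgt_mul ?tgt_mul ?src_seg ?tgt_seg ?alpha0 ?alpha1. Qed.

Lemma transport0 : transport 0 = alpha.
Proof. by rewrite /transport /= !seg_id -alpha0 -alpha1 pmul1p pmulp1. Qed.

Lemma transportM z z' : transport z' =
  pmul (pmul (seg ca z'.1 z.1) (transport z)) (seg cb z.2 z'.2).
Proof.
rewrite /transport -(segM ca z'.1 z.1 0) -(segM cb 0 z.2 z'.2).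
by rewrite !pmulA ?src_mul ?tgt_mul ?src_mul ?src_seg ?tgt_seg ?alpha0 ?alpha1.
Qed.

(** Along a ray the class of [f] changes by the two segments traced by its ends ([square_class]),
    and [transport] changes by the same segments ([transportM]). Agreement on the boundary therefore
    propagates inwards. *)
Lemma transport_extend (f : V -> path_space R X) : (0 < m + n)%N ->
  {within [set z | gauge z <= 1], continuous f} ->
  (forall z, gauge z <= 1 -> f z I0 = a z.1 /\ f z I1 = b z.2) ->
  (forall z, gauge z = 1 -> path_class (f z) = transport z) ->
  forall z, gauge z <= 1 -> path_class (f z) = transport z.
Proof.
move=> mn cf fe fS z /(gauge_ray mn) [l [z1 [l0 l1 g1 ->]]].
(* The scaling factor runs from 1 on the boundary to [l]; clamping extends it to the whole line, as
   [square_class] requires a map on the plane. *)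
pose s' (x : R) : R := 1 - ival (clamp x) * (1 - l).
have s'0 x : 0 <= s' x.
  by rewrite /s'; have := ival_ge0 (clamp x); have := ival_le1 (clamp x); nra.
have s'1 x : s' x <= 1.
  by rewrite /s'; have := ival_ge0 (clamp x); have := ival_le1 (clamp x); nra.
pose y (x : R^o) : V := s' x *: z1.
have yle x : gauge (y x) <= 1 by rewrite gaugeZ // g1 mulr1.
have cy : continuous y.
  apply: cont_scale; last exact: cont_cst.
  apply: cont_sub; first exact: cont_cst.
  apply: cont_mul; last exact: cont_cst.
  by apply: cont_comp; [exact: clamp_continuous|exact: ival_continuous].
have cfy : continuous (fun x => f (y x)).
  apply/within_continuousT.
  apply: (within_comp (r := y) _ _ cf); first exact/within_continuousT.
  by move=> x _; exact: yle.
pose k (st : R^o * R^o) := f (y st.1) (clamp st.2).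
have ck : continuous k.
  apply: (@cont_comp _ _ _ (fun st : R^o * R^o => (st.1, clamp st.2))
    (fun xt => f (y xt.1) xt.2)); last exact: (@uncurry_path_continuous R R^o X (fun x => f (y x)) cfy).
  apply: continuous_pair; first exact: cont_fst.
  by apply: cont_comp; [exact: cont_snd|exact: clamp_continuous].
have y0 : y 0 = z1 by rewrite /y /s' (clamp_le0 (lexx 0)) ival0 mul0r subr0 scale1r.
have y1 : y 1 = l *: z1 by rewrite /y /s' (clamp_ge1 (lexx 1)) ival1 mul1r opprB addrC subrK.
have k1 x : seg ck (x, 0) (x, 1) = path_class (f (y x)).
  congr path_class; apply: path_eq => t; rewrite map_pathE segmentE /k /=.
  by rewrite -scalerDl subrK scale1r scaler0 add0r [_ *: _]mulr1 ivalK.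
have := square_class ck; rewrite !k1 y0 y1 fS //.
have cly (x0 : R) : continuous (fun t : I => y (ival t)).
  by apply: cont_comp; [exact: ival_continuous|exact: cy].
have -> : seg ck (0, 0) (1, 0) = seg ca z1.1 (l *: z1).1.
  rewrite -[in RHS]y1 -[in X in _ = seg _ X _]y0.
  have c1 : continuous (fun t : I => (y (ival t)).1).
    by apply: cont_comp; [exact: (cly 0)|exact: cont_fst].
  have := @seg_path R _ X a ca (map_path ck (segment ((0, 0) : R^o * R^o) (1, 0))) (path_of c1).
  rewrite !path_ofE ival0 ival1; apply=> t.
  rewrite map_pathE segmentE /k path_ofE /= !scaler0 add0r [ival t *: 1]mulr1 addr0.
  by rewrite (clamp_le0 (lexx 0)); case: (fe _ (yle (ival t))).
have -> : seg ck (0, 1) (1, 1) = seg cb z1.2 (l *: z1).2.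
  rewrite -[in RHS]y1 -[in X in _ = seg _ X _]y0.
  have c1 : continuous (fun t : I => (y (ival t)).2).
    by apply: cont_comp; [exact: (cly 0)|exact: cont_snd].
  have := @seg_path R _ X b cb (map_path ck (segment ((0, 1) : R^o * R^o) (1, 1))) (path_of c1).
  rewrite !path_ofE ival0 ival1; apply=> t.
  rewrite map_pathE segmentE /k path_ofE /= !scaler0 add0r [ival t *: 1]mulr1.
  rewrite [(1 - ival t) *: 1]mulr1 subrK.
  by rewrite (clamp_ge1 (lexx 1)); case: (fe _ (yle (ival t))).
move=> e.
have lz : gauge (l *: z1) <= 1 by rewrite gaugeZ // g1 mulr1.
have [f0 f1] := fe _ lz.
rewrite (transportM z1) -(segV ca z1.1) -pmulA; last 2 first.
- by rewrite tgt_inv src_seg src_transport.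
- by rewrite tgt_transport src_seg.
by rewrite e pmulKV // tgt_seg src_class f0.
Qed.

End Transport.

(** * The boundary of a cylinder as a quotient of a cube *)

Section FillBall.
Variables (R : realType) (X : topologicalType) (m n : nat).
Notation I := (unitI R).
Notation V := ('rV[R]_m * 'rV[R]_n)%type.
Notation Q := (V * R^o)%type.
Hypothesis mn0 : (0 < m + n)%N.

Definition cyl_gauge (q : Q) : R := Num.max (gauge q.1) `|q.2|.

Lemma cyl_gaugeZ l q : 0 <= l -> cyl_gauge (l *: q) = l * cyl_gauge q.
Proof.
move=> l0; have e : `|l *: q.2| = l * `|q.2| by rewrite normrZ ger0_norm.
by rewrite /cyl_gauge /= gaugeZ // e [in RHS]maxr_pMr.
Qed.

Lemma cyl_gauge_eq0 q : cyl_gauge q = 0 -> q = 0.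
Proof.
move=> q0; have h : Num.max (gauge q.1) `|q.2| <= 0 by rewrite -/(cyl_gauge q) q0.
move: h; rewrite ge_max => /andP[h1]; rewrite normr_le0 => /eqP h2.
have e1 : gauge q.1 = 0 by apply: le_anti; rewrite h1 gauge_ge0.
by rewrite [q]surjective_pairing (gauge_eq0 e1) h2.
Qed.

Definition split_row (w : 'rV[R]_(m + n)) : V := (lsubmx w, rsubmx w).

Lemma split_row_continuous : continuous split_row.
Proof.
apply: continuous_pair; apply: cont_mx => i j;
  by under eq_fun do rewrite mxE; exact: coord_continuous.
Qed.

Lemma split_rowZ l w : split_row (l *: w) = l *: split_row w.
Proof. by congr (_, _); apply/rowP => i; rewrite !mxE. Qed.

Lemma split_row_inj : injective split_row.
Proof. by move=> v w [e1 e2]; rewrite -[v]hsubmxK -[w]hsubmxK e1 e2. Qed.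

Lemma split_rowK z : split_row (row_mx z.1 z.2) = z.
Proof. by rewrite /split_row row_mxKl row_mxKr -surjective_pairing. Qed.

Lemma norm_le_gauge w : `|w| <= gauge (split_row w).
Proof.
have -> : `|w| = mx_norm w by [].
rewrite mx_normrE; apply/bigmax_leP; split; first exact: gauge_ge0.
move=> [i j] _ /=; rewrite ord1 le_max; case: (splitP j) => k jk; apply/orP.
  left; apply: le_trans (coord_le_nrm _ k); rewrite mxE.
  by rewrite (_ : j = lshift n k) //; exact: val_inj.
right; apply: le_trans (coord_le_nrm _ k); rewrite mxE.
by rewrite (_ : j = rshift m k) //; exact: val_inj.
Qed.

(* Radial homeomorphism from the unit ball of the sup norm, i.e. the cube
   [-1, 1]^(m + n), onto a product of two Euclidean disks. *)
Definition radial w : V := (`|w| / gauge (split_row w)) *: split_row w.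

Lemma gauge_split_gt0 w : w != 0 -> 0 < gauge (split_row w).
Proof. by move=> w0; apply: lt_le_trans (norm_le_gauge w); rewrite normr_gt0. Qed.

Lemma gauge_radial w : gauge (radial w) = `|w|.
Proof.
have [->|w0] := eqVneq w 0.
  rewrite /radial normr0 mul0r scale0r /gauge /= !nrm0; exact: maxxx.
rewrite gaugeZ; last by rewrite divr_ge0 // gauge_ge0.
by rewrite divfK // gt_eqF // gauge_split_gt0.
Qed.

Lemma radial_continuous : continuous radial.
Proof.
move=> w; have [->|w0] := eqVneq w 0; last first.
  apply: (@cvgZ R V _ (nbhs w) _ (fun w => `|w| / gauge (split_row w)) split_row); last first.
    exact: split_row_continuous.
  apply: (@cvgM R _ (nbhs w) _ (fun w => `|w|) (fun w => (gauge (split_row w))^-1)).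
    by apply: cvg_norm; exact: cvg_id.
  apply: (@cvgV R _ (nbhs w) _ (fun w => gauge (split_row w))); first by rewrite gt_eqF // gauge_split_gt0.
  by apply: (@continuous_comp _ _ _ split_row (@gauge R m n));
    [exact: split_row_continuous|exact: gauge_continuous].
have norm_gauge (z : V) : `|z| <= gauge z.
  rewrite prod_normE ge_max !le_max; apply/andP; split; apply/orP.
    by left; exact: norm_le_nrm.
  by right; exact: norm_le_nrm.
have r0 : radial 0 = 0 by rewrite /radial normr0 mul0r scale0r.
rewrite /continuous_at r0 => S /nbhs_ballP [e e0 eS].
suff : \forall v \near (0 : 'rV[R]_(m + n)), S (radial v) by [].
near=> v; have : ball (0 : 'rV[R]_(m + n)) e v by near: v; exact: nbhsx_ballx.
rewrite -ball_normE /ball_ /= sub0r normrN => ve.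
apply: eS; rewrite -ball_normE /ball_ /= sub0r normrN.
by apply: (le_lt_trans (norm_gauge _)); rewrite gauge_radial.
Unshelve. all: by end_near. Qed.

(** Chosen so that [width r * r] is [3 r], then 1, then [3 - 3 r] on the three thirds of [[0, 1]],
    while [height] is -1, climbs, and is 1. The maximum in the divisor only removes the singularity
    at 0. *)
Definition width (r : R) : R := Num.min 1 (3 - 3 * r) / Num.max r 3^-1.
Definition height (r : R) : R := Num.max (-1) (Num.min 1 (6 * r - 3)).

(* Collapses the boundary of the cube to the top centre (0, 1) and is otherwise a
   bijection onto the boundary of the cylinder: the distance to the centre of the
   cube runs along the bottom, the side and the top of the cylinder. *)
Definition collapse w : Q := (width `|w| *: radial w, height `|w|).

Lemma width_continuous (Y : topologicalType) (r : Y -> R) : continuous r ->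
  continuous (fun y => width (r y)).
Proof.
move=> cr; apply: cont_mul.
  apply: cont_min; first exact: cont_cst.
  apply: cont_sub; first exact: cont_cst.
  by apply: cont_mul => //; exact: cont_cst.
apply: cont_inv; first by move=> y; rewrite gt_eqF // lt_max invr_gt0 ltr0n orbT.
by apply: cont_max => //; exact: cont_cst.
Qed.

Lemma height_continuous (Y : topologicalType) (r : Y -> R) : continuous r ->
  continuous (fun y => height (r y) : R^o).
Proof.
move=> cr; apply: cont_max; first exact: cont_cst.
apply: cont_min; first exact: cont_cst.
apply: cont_sub; last exact: cont_cst.
by apply: cont_mul => //; exact: cont_cst.
Qed.

Lemma collapse_continuous : continuous collapse.
Proof.
have cn : continuous (fun w : 'rV[R]_(m + n) => `|w|) by apply: cont_normv; exact: cont_id.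
apply: continuous_pair; last exact: height_continuous.
by apply: cont_scale; [exact: width_continuous|exact: radial_continuous].
Qed.

Lemma width_ge0 r : r <= 1 -> 0 <= width r.
Proof.
move=> r1; apply: divr_ge0; last by rewrite le_max invr_ge0 ler0n orbT.
by rewrite le_min ler01 /=; lra.
Qed.

Lemma widthM r : 0 <= r -> width r * r = Num.min 1 (3 - 3 * r) * Num.min 1 (3 * r).
Proof.
move=> r0; rewrite /width -mulrA; congr (_ * _).
have [h|h] := leP r 3^-1.
  by rewrite invrK min_r //; lra.
by rewrite mulVf ?gt_eqF ?(lt_trans _ h) ?invr_gt0 ?ltr0n // min_l //; lra.
Qed.

Lemma cyl_gauge_collapse w : `|w| <= 1 -> cyl_gauge (collapse w) = 1.
Proof.
move=> w1; rewrite /cyl_gauge /= gaugeZ ?width_ge0 // gauge_radial widthM //.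
have := normr_ge0 w; move: `|w| w1 => r r1 r0; rewrite /height.
have [h1|h1] := leP r 3^-1.
  rewrite [Num.min 1 (6 * r - 3)]min_r; last by lra.
  rewrite [Num.max (-1) _]max_l; last by lra.
  rewrite [Num.min 1 (3 - 3 * r)]min_l; last by lra.
  rewrite [Num.min 1 (3 * r)]min_r; last by lra.
  by rewrite normrN1 mul1r max_r //; lra.
have [h2|h2] := leP r (2 / 3).
  rewrite [Num.min 1 (6 * r - 3)]min_r; last by lra.
  rewrite [Num.max (-1) _]max_r; last by lra.
  rewrite [Num.min 1 (3 - 3 * r)]min_l; last by lra.
  rewrite [Num.min 1 (3 * r)]min_l; last by lra.
  by rewrite mul1r max_l // ler_norml; apply/andP; split; lra.
rewrite [Num.min 1 (6 * r - 3)]min_l; last by lra.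
rewrite [Num.max (-1) _]max_r; last by lra.
rewrite [Num.min 1 (3 - 3 * r)]min_r; last by lra.
rewrite [Num.min 1 (3 * r)]min_l; last by lra.
by rewrite normr1 mulr1 max_r //; lra.
Qed.

Lemma profile_inj (r s : R) : 0 <= r -> r <= 1 -> 0 <= s -> s <= 1 ->
  height r = height s -> width r * r = width s * s -> r = s.
Proof.
move=> r0 r1 s0 s1; rewrite !widthM // /height.
have reg (x : R) : 0 <= x -> x <= 1 ->
   [\/ [/\ x <= 3^-1, Num.max (-1) (Num.min 1 (6 * x - 3)) = -1 &
            Num.min 1 (3 - 3 * x) * Num.min 1 (3 * x) = 3 * x],
       [/\ 3^-1 < x < 2 / 3, Num.max (-1) (Num.min 1 (6 * x - 3)) = 6 * x - 3 &
            Num.min 1 (3 - 3 * x) * Num.min 1 (3 * x) = 1] |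
       [/\ 2 / 3 <= x, Num.max (-1) (Num.min 1 (6 * x - 3)) = 1 &
            Num.min 1 (3 - 3 * x) * Num.min 1 (3 * x) = 3 - 3 * x]].
  move=> x0 x1; have [h1|h1] := leP x 3^-1.
    apply: Or31; split => //; first by rewrite max_l // ge_min; apply/orP; right; lra.
    by rewrite min_l ?min_r ?mul1r //; lra.
  have [h2|h2] := ltP x (2 / 3).
    apply: Or32; split => //; first by rewrite min_r ?max_r //; lra.
    by rewrite !min_l ?mul1r //; lra.
  apply: Or33; split => //; first by rewrite min_l ?max_r //; lra.
  by rewrite min_r ?min_l ?mulr1 //; lra.
by case: (reg r r0 r1) => -[a1 -> ->]; case: (reg s s0 s1) => -[b1 -> ->];
  move: a1 b1; lra.
Qed.

(** [profile_inj] recovers the norm from height and gauge. If it is below 1, the width cancels, and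
    [radial] then leaves two vectors of equal norm on the same ray. *)
Lemma collapse_inj v w : `|v| <= 1 -> `|w| <= 1 -> collapse v = collapse w ->
  v = w \/ (`|v| = 1 /\ `|w| = 1).
Proof.
move=> v1 w1 e.
have e1 : width `|v| *: radial v = width `|w| *: radial w by exact: (congr1 fst e).
have e2 : height `|v| = height `|w| by exact: (congr1 snd e).
have vw : `|v| = `|w|.
  apply: profile_inj => //; have := congr1 (@gauge R m n) e1.
  rewrite (gaugeZ (radial v)) ?width_ge0 // (gaugeZ (radial w)) ?width_ge0 //.
  by rewrite !gauge_radial.
rewrite -vw in e1 *; have [|v1'] := eqVneq `|v| 1; first by right.
have [v0|v0] := eqVneq v 0.
  by left; rewrite v0; apply/esym/eqP; rewrite -normr_eq0 -vw v0 normr0.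
have w0 : w != 0 by rewrite -normr_eq0 -vw normr_eq0.
left; have vlt : `|v| < 1 by rewrite lt_neqAle v1'.
have wp : width `|v| != 0.
  rewrite gt_eqF // divr_gt0 // ?lt_min ?lt_max ?ltr01 ?invr_gt0 ?ltr0n ?orbT //=.
  by rewrite subr_gt0; lra.
move/(scalerI wp): e1; rewrite /radial -!split_rowZ => /split_row_inj e1.
have gv := gauge_split_gt0 v0; have gw := gauge_split_gt0 w0.
have nv : 0 < `|v| by rewrite normr_gt0.
have := congr1 (fun u : 'rV[R]_(m + n) => `|u|) e1; rewrite !normrZ -vw => e3.
have e4 : `|v| / gauge (split_row v) = `|v| / gauge (split_row w).
  have hn u : `|(gauge (split_row u))^-1| = (gauge (split_row u))^-1.
    by rewrite ger0_norm // invr_ge0 gauge_ge0.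
  by move: (mulIf (lt0r_neq0 nv) e3); rewrite !hn normr_id.
move: e1; rewrite -vw -e4; apply: scalerI.
by rewrite mulf_neq0 ?invr_eq0 ?gt_eqF.
Qed.

Lemma collapse_surj q : cyl_gauge q = 1 -> exists2 w, `|w| <= 1 & collapse w = q.
Proof.
case: q => z s q1.
have zle : gauge z <= 1 by rewrite -q1 /cyl_gauge le_max lexx.
have sle : `|s| <= 1 by rewrite -q1 /cyl_gauge le_max lexx orbT.
have [s0 s1] : -1 <= s /\ s <= 1 by move: sle; rewrite ler_norml => /andP.
have zs : gauge z = 1 \/ s = -1 \/ s = 1.
  have [h|h] := leP (gauge z) `|s|; last by left; move: q1; rewrite /cyl_gauge max_l // ltW.
  right; move: q1; rewrite /cyl_gauge max_r //=.
  by have [s'|s'] := leP 0 s; [rewrite ger0_norm // => ->; right|rewrite ltr0_norm // => e; left; rewrite -e opprK].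
have g0 := gauge_ge0 z.
(* The witnesses invert the profile on the side, the bottom and the top of the cylinder. *)
have [r [r0 r1 hr wr]] : exists r, [/\ 0 <= r, r <= 1, height r = s &
    width r * r = gauge z].
  have [e|[e|e]] := zs.
  - exists ((s + 3) / 6); split; try lra.
      by rewrite /height (_ : 6 * _ - 3 = s); [rewrite min_r // max_r|lra].
    by rewrite widthM; [rewrite !min_l ?mul1r //; lra|lra].
  - exists (gauge z / 3); split; try lra.
      by rewrite /height min_r; [rewrite max_l|]; lra.
    by rewrite widthM; [rewrite min_l ?min_r ?mul1r; lra|lra].
  - exists (1 - gauge z / 3); split; try lra.
      by rewrite /height min_l; [rewrite max_r|]; lra.
    by rewrite widthM; [rewrite min_r ?min_l ?mulr1; lra|lra].
(* Over the axis of the cylinder the direction is arbitrary, and a vector of norm [r] exists because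
   [0 < m + n]. *)
have [z0|z0] := eqVneq (gauge z) 0.
  have zE := gauge_eq0 z0.
  have [w wE] : exists w : 'rV[R]_(m + n), `|w| = r.
    exists (const_mx r).
    have -> : `|const_mx r : 'rV[R]_(m + n)| = mx_norm (const_mx r : 'rV[R]_(m + n)) by [].
    rewrite mx_normrE; apply: le_anti; apply/andP; split.
      by apply/bigmax_leP; split => // i _; rewrite mxE ger0_norm.
    apply: (@bigmax_sup _ _ _ _ (ord0, Ordinal mn0)) => //.
    by rewrite mxE ger0_norm.
  exists w; rewrite ?wE // /collapse wE hr; congr (_, _).
  rewrite zE; apply: gauge_eq0; rewrite gaugeZ ?width_ge0 // gauge_radial wE wr z0 //.
have zp : 0 < gauge z by rewrite lt_neqAle g0 andbT eq_sym.
pose w0 : 'rV[R]_(m + n) := row_mx z.1 z.2.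
have sw0 : split_row w0 = z by exact: split_rowK.
have w0p : 0 < `|w0|.
  rewrite normr_gt0; apply: contraTneq zp => w00.
  rewrite -sw0 w00 (_ : split_row 0 = 0); last by congr (_, _); apply/rowP => i; rewrite !mxE.
  by rewrite /gauge /= !nrm0 maxxx ltxx.
pose w := (r / `|w0|) *: w0.
have wE : `|w| = r by rewrite normrZ ger0_norm ?divfK ?gt_eqF // divr_ge0.
exists w; rewrite ?wE // /collapse wE hr; congr (_, _).
have rp : r != 0 by apply: contra_neq z0 => r00; rewrite -wr r00 mulr0.
have c0 : r / `|w0| != 0 by rewrite mulf_neq0 // invr_eq0 gt_eqF.
rewrite /radial wE split_rowZ sw0 gaugeZ; last by rewrite divr_ge0.
rewrite !scalerA -[RHS]scale1r; congr (_ *: _).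
have wp : width r != 0 by apply: contra_neq z0 => w00; rewrite -wr w00 mul0r.
by rewrite -wr; field; rewrite rp wp gt_eqF.
Qed.

End FillBall.

(** * Filling balls by the vanishing of a homotopy group *)

Section FillBallAspherical.
Variables (R : realType) (X : topologicalType) (m n : nat).
Notation I := (unitI R).
Notation V := ('rV[R]_m * 'rV[R]_n)%type.
Notation Q := (V * R^o)%type.
Notation C := (cube R (m + n)).
Hypothesis mn0 : (0 < m + n)%N.

Definition cube_center (v : C) : 'rV[R]_(m + n) := 2 *: (set_val v : 'rV[R]_(m + n)) - const_mx 1.

Lemma coord_le_norm k (w : 'rV[R]_k) i : `|w 0 i| <= `|w|.
Proof.
have -> : `|w| = mx_norm w by [].
by rewrite mx_normrE; apply: (@bigmax_sup _ _ _ _ (ord0, i)).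
Qed.

Lemma norm_le_coord k (w : 'rV[R]_k) r : 0 <= r -> (forall i, `|w 0 i| <= r) -> `|w| <= r.
Proof.
move=> r0 wr; have -> : `|w| = mx_norm w by [].
by rewrite mx_normrE; apply/bigmax_leP; split => // -[i j] _ /=; rewrite ord1.
Qed.

Lemma cube_coord (v : C) i : 0 <= (set_val v : 'rV[R]_(m + n)) 0 i <= 1.
Proof. exact: (set_valP v). Qed.

Lemma cube_center_coord (v : C) i :
  cube_center v 0 i = 2 * (set_val v : 'rV[R]_(m + n)) 0 i - 1.
Proof. by rewrite !mxE. Qed.

Lemma cube_center_le1 (v : C) : `|cube_center v| <= 1.
Proof.
apply: norm_le_coord => // i; rewrite cube_center_coord ler_norml.
by have /andP[h1 h2] := cube_coord v i; apply/andP; split; lra.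
Qed.

Lemma cube_center_boundary (v : C) : cube_boundary v <-> `|cube_center v| = 1.
Proof.
split => [[i vi]|h].
  apply: le_anti; rewrite cube_center_le1 /=; apply: le_trans (coord_le_norm _ i).
  rewrite cube_center_coord; case: vi => ->; first by rewrite mulr0 sub0r normrN1.
  by rewrite ler_normr; apply/orP; left; lra.
have [|[i j] /=] := @mx_norm_neq0 _ _ _ (cube_center v).
  by rewrite -[mx_norm _]/`|cube_center v| h oner_neq0.
rewrite ord1 -[mx_norm _]/`|cube_center v| h cube_center_coord => hj.
exists j; move: hj; have /andP[h1 h2] := cube_coord v j.
move: (set_val v 0 j) h1 h2 => x h1 h2.
by have [x0|x0] := leP 0 (2 * x - 1); [rewrite ger0_norm // => e; right; lra
  |rewrite ltr0_norm // => e; left; lra].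
Qed.

Lemma cube_center_surj (w : 'rV[R]_(m + n)) : `|w| <= 1 -> exists v : C, cube_center v = w.
Proof.
move=> w1; pose v : 'rV[R]_(m + n) := 2^-1 *: (w + const_mx 1).
have vC : v \in [set v : 'rV[R]_(m + n) | forall i, 0 <= v 0 i <= 1].
  rewrite inE => i; rewrite !mxE.
  have := le_trans (coord_le_norm w i) w1; rewrite ler_norml => /andP[h1 h2].
  by apply/andP; split; lra.
exists (exist _ v vC); apply/rowP => i; rewrite cube_center_coord /= !mxE.
by rewrite mulrA divff ?pnatr_eq0 // mul1r addrK.
Qed.

Lemma cube_center_continuous : continuous cube_center.
Proof.
apply: cont_addv; last exact: cont_cst.
apply: cont_scale; first exact: cont_cst.
exact: initial_continuous.
Qed.

Lemma cube_compact : compact [set: C].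
Proof.
apply: compact_set_type.
have := @rV_compact R (m + n) (fun=> `[0, 1]%classic) (fun _ => @segment_compact R 0 1).
congr (compact _); apply/seteqP; split => v /= h i; have := h i; by rewrite in_itv.
Qed.

Hypothesis asph : forall (x : X) (s : homotopy_group R (m + n) x),
  s = homotopy_group1 R (m + n) x.

(** Pulled back along [collapse], [f] is a spheroid based at the image of the top centre. A null
    homotopy of it descends to the cone over the boundary of the cylinder, which is the cylinder. *)
Lemma fill_ball (f : Q -> X) : {within [set q | cyl_gauge q = 1], continuous f} ->
  exists F : Q -> X, {within [set q | cyl_gauge q <= 1], continuous F} /\
    forall q, cyl_gauge q = 1 -> F q = f q.
Proof.
move=> cf; pose p (v : C) := collapse (cube_center v).
have p1 v : cyl_gauge (p v) = 1 by apply: cyl_gauge_collapse; exact: cube_center_le1.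
have cp : continuous p.
  by apply: cont_comp; [exact: cube_center_continuous|exact: collapse_continuous].
have cfp : continuous (fun v : C => f (p v)).
  apply/within_continuousT; apply: (within_comp (r := p) _ _ cf).
    exact/within_continuousT.
  by move=> v _ /=; exact: p1.
pose x := f (0, 1).
have pb v : cube_boundary v -> p v = (0, 1).
  move=> /cube_center_boundary h; rewrite /p /collapse h; congr (_, _).
    by rewrite /width min_r; [rewrite mulr1 subrr mul0r scale0r|lra].
  by rewrite /height min_l; [rewrite max_r; lra|lra].
have sP : `[< forall v, cube_boundary v -> (mkcts cfp : continuousType C X) v = x >].
  by apply/asboolP => v /pb h; rewrite -[LHS]/(f (p v)) h.
pose s : spheroid R (m + n) x := exist
  (fun g : continuousType C X => `[< forall v, cube_boundary v -> g v = x >]) _ sP.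
have : (\pi_(homotopy_group R (m + n) x) s) = homotopy_group1 R (m + n) x by exact: asph.
move=> /eqmodP /asboolP [H [cH H0 H1 Hb]].
have Hb' t v : cube_boundary v -> H (t, v) = x.
  by move=> vb; rewrite Hb // -[LHS]/(f (p v)) pb.
(* Homotopy time becomes depth in the cone. Identifications occur only on the boundary of the cube
   and at [t = 1], and the homotopy is constant on both. *)
pose k (tv : I * C) : Q := (1 - ival tv.1) *: p tv.2.
have ck : continuous k.
  apply: cont_scale; last by apply: cont_comp; [exact: cont_snd|exact: cp].
  apply: cont_sub; first exact: cont_cst.
  by apply: cont_comp; [exact: cont_fst|exact: ival_continuous].
have i1 (t : I) : 0 <= 1 - ival t by rewrite subr_ge0 ival_le1.
have gk tv : cyl_gauge (k tv) = 1 - ival tv.1 by rewrite cyl_gaugeZ // p1 mulr1.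
have [F [FE cF]] : exists g : Q -> X, (forall tv, setT tv -> g (k tv) = H tv) /\
    {within k @` setT, continuous g}.
  apply: (@compact_descend _ _ _ setT k H x) => //.
  - by rewrite -setXTT; apply: compact_setX; [exact: unitI_compact|exact: cube_compact].
  - exact: continuous_subspaceT.
  move=> [t v] [t' v'] _ _ e.
  have tt : t' = t.
    by apply: ival_inj; have := gk (t, v); rewrite e gk /= => h; lra.
  rewrite tt in e *; have [->|t1] := pselect (t = I1); first by rewrite !H1.
  have tp : 1 - ival t != 0.
    by rewrite subr_eq0; apply/eqP => h; apply: t1; apply: ival_inj; rewrite ival1.
  have [] := collapse_inj (cube_center_le1 v) (cube_center_le1 v') (scalerI tp e).
    move=> cv; congr (H (_, _)); apply: val_inj; apply/rowP => i.
    by have := congr1 (fun w : 'rV[R]_(m + n) => w 0 i) cv; rewrite /= !cube_center_coord => h; lra.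
  by move=> [/cube_center_boundary vb /cube_center_boundary vb']; rewrite !Hb'.
have surj q : cyl_gauge q = 1 -> exists v, p v = q.
  by move=> /(collapse_surj mn0) [w /cube_center_surj [v <-] <-]; exists v.
exists F; split.
  apply: continuous_subspaceW cF => q /= q1.
  have [/cyl_gauge_eq0 ->|g0] := eqVneq (cyl_gauge q) 0.
    have n0 : `|0 : 'rV[R]_(m + n)| <= 1 by rewrite normr0.
    have [v _] := cube_center_surj n0.
    by exists (I1, v) => //; rewrite /k /= ival1 subrr scale0r.
  have gp : 0 < cyl_gauge q.
    by rewrite lt_neqAle eq_sym g0 /= /cyl_gauge le_max normr_ge0 orbT.
  have [|v vq] := surj ((cyl_gauge q)^-1 *: q).
    by rewrite cyl_gaugeZ ?invr_ge0 ?(ltW gp) // mulVf.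
  exists (clamp (1 - cyl_gauge q), v) => //; rewrite /k /= vq clampE; last by lra.
  by rewrite opprB addrC subrK scalerA divff // scale1r.
move=> q /surj [v <-].
have := FE (I0, v) Logic.I; rewrite /k /= ival0 subr0 scale1r => ->.
by rewrite H0.
Qed.

End FillBallAspherical.

Lemma rV0_eq0 (R : realType) (v : 'rV[R]_0) : v = 0.
Proof. by apply/rowP; case. Qed.

Section LineCoordinate.
Variable R : realType.

(** For [m + n = 1] one factor is a line and the other a point. Filling both, and summing over both
    in [line_coord], treats the two cases at once. *)
Definition line_point m n (s : R) : 'rV[R]_m * 'rV[R]_n := (const_mx s, const_mx s).
Definition line_coord m n (z : 'rV[R]_m * 'rV[R]_n) : R :=
  \sum_i z.1 0 i + \sum_i z.2 0 i.

Lemma line_coordK m n (z : 'rV[R]_m * 'rV[R]_n) : (m + n = 1)%N ->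
  line_point m n (line_coord z) = z /\ gauge z = `|line_coord z|.
Proof.
have nrm1 (v : 'rV[R]_1) : nrm v = `|v 0 0|.
  by rewrite /nrm /sqnorm big_ord1 sqrtr_sqr.
have ge0 k (v : 'rV[R]_k) : Num.max 0 (nrm v) = nrm v by rewrite max_r // nrm_ge0.
case: m z => [|[|m]] z; case: n z => [|[|n]] [z1 z2] // _; rewrite /line_coord /line_point /gauge /=.
- rewrite big_ord0 add0r big_ord1 (rV0_eq0 z1) nrm0 ge0 nrm1; split => //.
  by congr (_, _); apply/rowP => i; rewrite ?mxE ?(ord1 i) //; case: i.
- rewrite big_ord0 addr0 big_ord1 (rV0_eq0 z2) nrm0 maxC ge0 nrm1; split => //.
  by congr (_, _); apply/rowP => i; rewrite ?mxE ?(ord1 i) //; case: i.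
Qed.

Lemma line_coord_continuous m n : continuous (@line_coord m n).
Proof.
apply: cont_add.
  apply: (@cont_sum _ _ _ _ (fun i (z : 'rV[R]_m * 'rV[R]_n) => z.1 0 i)) => i.
  by apply: (@cont_comp _ _ _ fst (fun v : 'rV[R]_m => v 0 i)); [exact: cont_fst|exact: coord_continuous].
apply: (@cont_sum _ _ _ _ (fun i (z : 'rV[R]_m * 'rV[R]_n) => z.2 0 i)) => i.
by apply: (@cont_comp _ _ _ snd (fun v : 'rV[R]_n => v 0 i)); [exact: cont_snd|exact: coord_continuous].
Qed.

End LineCoordinate.

(** * Extending a family of paths from the boundary of a product cell *)

Section ExtendPaths.
Variables (R : realType) (X : topologicalType) (m n : nat).
Notation I := (unitI R).
Notation V := ('rV[R]_m * 'rV[R]_n)%type.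
Notation Q := (V * R^o)%type.
Variables (a : 'rV[R]_m -> X) (b : 'rV[R]_n -> X).
Hypotheses (ca : continuous a) (cb : continuous b).
Variable (alpha : path_classes R X).
Hypotheses (alpha0 : src alpha = a 0) (alpha1 : tgt alpha = b 0).
Variable (f : V -> path_space R X).
Hypothesis cf : {within [set z | gauge z = 1], continuous f}.
Hypothesis fS : forall z, gauge z = 1 -> path_class (f z) = transport ca cb alpha z.

Let f0 z : gauge z = 1 -> f z I0 = a z.1.
Proof. by move=> /fS h; rewrite -src_class h src_transport. Qed.

Let f1 z : gauge z = 1 -> f z I1 = b z.2.
Proof. by move=> /fS h; rewrite -tgt_class h tgt_transport. Qed.

Let extends (F : V -> path_space R X) := [/\ continuous F,
  forall z, gauge z = 1 -> F z = f z &
  forall z, gauge z <= 1 -> path_class (F z) = transport ca cb alpha z].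

Lemma extend_paths0 : (m + n = 0)%N -> exists F, extends F.
Proof.
move=> /eqP; rewrite addn_eq0 => /andP[/eqP m0 /eqP n0].
have z0 (z : V) : z = 0.
  case: z => z1 z2; congr (_, _).
    by apply/rowP => -[i im]; exfalso; move: im; rewrite m0.
  by apply/rowP => -[i im]; exfalso; move: im; rewrite n0.
exists (fun=> repr alpha); split; first exact: cont_cst.
- move=> z; rewrite (z0 z) /gauge /= !nrm0 maxxx => /eqP.
  by rewrite eq_sym oner_eq0.
- by move=> z _; rewrite (z0 z) transport0 // path_classK.
Qed.

(** A family of paths over a product of disks is a map on a cylinder, with path parameter [t] at
    height [2 t - 1]. Retracting the base makes the family total, and [transport_extend] gives the
    class inside for free. *)
Lemma extend_cylinder (F : Q -> X) : (0 < m + n)%N ->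
  {within [set q | cyl_gauge q <= 1], continuous F} ->
  (forall z, gauge z <= 1 -> F (z, -1) = a z.1 /\ F (z, 1) = b z.2) ->
  (forall z (t : I), gauge z = 1 -> F (z, 2 * ival t - 1) = f z t) ->
  exists G, extends G.
Proof.
move=> mn cF Fe Ff.
pose k (zt : V * I) : Q := ((ret zt.1.1, ret zt.1.2), 2 * ival zt.2 - 1).
have ck : continuous k.
  apply: continuous_pair.
    by apply: continuous_pair; (apply: cont_comp; last exact: ret_continuous);
      (apply: cont_comp; first exact: cont_fst); [exact: cont_fst|exact: cont_snd].
  apply: cont_sub; last exact: cont_cst.
  apply: cont_mul; first exact: cont_cst.
  by apply: cont_comp; [exact: cont_snd|exact: ival_continuous].
have k1 zt : cyl_gauge (k zt) <= 1.
  rewrite /cyl_gauge ge_max gauge_box /= !nrm_ret_le1 /= ler_norml.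
  by have := ival_ge0 zt.2; have := ival_le1 zt.2; move: (ival _) => x h1 h2;
    apply/andP; split; lra.
have cFk : continuous (fun zt => F (k zt)).
  apply/within_continuousT; apply: (within_comp (r := k) _ _ cF).
    exact/within_continuousT.
  by move=> zt _ /=; exact: k1.
have cGz z : continuous (fun t : I => F (k (z, t))).
  apply: (cont_comp (f := fun t : I => (z, t)) _ cFk).
  by apply: continuous_pair; [exact: cont_cst|exact: cont_id].
pose G z : path_space R X := path_of (@cGz z).
have cG : continuous G by apply: curry_path_continuous; exact: cFk.
have kE z t : gauge z <= 1 -> k (z, t) = (z, 2 * ival t - 1).
  by rewrite gauge_box /k /= => /andP[h1 h2]; rewrite !ret_id //; case: z h1 h2.
have GS z : gauge z = 1 -> G z = f z.
  by move=> z1; apply: path_eq => t; rewrite path_ofE kE ?z1 // Ff.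
exists G; split => //.
apply: transport_extend => //.
- by apply: continuous_subspaceT.
- move=> z z1; rewrite !path_ofE !kE // ival0 ival1 mulr0 sub0r mulr1.
  by rewrite (_ : 2 - 1 = 1); [exact: Fe|lra].
- by move=> z z1; rewrite GS // fS.
Qed.

Lemma extend_paths1 : (m + n = 1)%N -> exists F, extends F.
Proof.
move=> mn1; pose zm : V := line_point m n (-1); pose zp : V := line_point m n 1.
have coordE (s : R) : line_coord (line_point m n s) = s.
  have [e _] := line_coordK (line_point m n s) mn1.
  have [m0|mp] := posnP m.
    have np : (0 < n)%N by move: mn1; rewrite m0 add0n => ->.
    have := congr1 (fun z : V => z.2 0 (Ordinal np)) e.
    by rewrite /= !mxE.
  have := congr1 (fun z : V => z.1 0 (Ordinal mp)) e.
  by rewrite /= !mxE.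
have gE (s : R) : gauge (line_point m n s) = `|s|.
  by have [_ ->] := line_coordK (line_point m n s) mn1; rewrite coordE.
have gm : gauge zm = 1 by rewrite gE normrN1.
have gp : gauge zp = 1 by rewrite gE normr1.
have [F [cF FE]] : exists F : R^o * R^o -> X,
    {within [set z | (0 <= z.1 <= 1) && (0 <= z.2 <= 1)], continuous F} /\
    forall t : I, [/\ F (0, ival t) = f zm t,
      F (ival t, 1) = map_path cb (segment zm.2 zp.2) t,
      F (ival t, 0) = map_path ca (segment zm.1 zp.1) t & F (1, ival t) = f zp t].
  apply: fill_square.
  - by rewrite map_pathE segment0 f0.
  - by rewrite map_pathE segment0 f1.
  - by rewrite map_pathE segment1 f0.
  - by rewrite map_pathE segment1 f1.
  (* The square to fill has the two prescribed paths as vertical sides. It commutes because both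
     have the class transported from the same [alpha]. *)
  rewrite !fS // -/(seg ca _ _) -/(seg cb _ _) (transportM ca cb alpha0 alpha1 zm zp).
  rewrite -pmulA ?tgt_seg ?src_transport ?tgt_transport ?src_seg //.
  rewrite pmulA; last 2 first.
  - by rewrite tgt_seg src_seg.
  - by rewrite tgt_seg src_mul ?src_transport ?tgt_transport ?src_seg.
  rewrite segM seg_id -(src_transport ca cb alpha0 alpha1 zm).
  rewrite -(@src_mul _ _ (transport ca cb alpha zm) (seg cb zm.2 zp.2)) ?pmul1p //.
  by rewrite tgt_transport // src_seg.
pose half (x : R) : R := (x + 1) / 2.
pose k (q : Q) : R^o * R^o := (half (line_coord q.1), half q.2).
have ck : continuous k.
  by apply: continuous_pair; (apply: cont_mul; last exact: cont_cst);
    (apply: cont_add; last exact: cont_cst);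
    [apply: cont_comp; [exact: cont_fst|exact: line_coord_continuous]|exact: cont_snd].
have halfb x : `|x| <= 1 -> 0 <= half x <= 1.
  by rewrite ler_norml /half => /andP[h1 h2]; apply/andP; split; lra.
apply: (@extend_cylinder (F \o k)); first by rewrite mn1.
- apply: (within_comp (r := k) _ _ cF).
    by apply: continuous_subspaceT; exact: ck.
  move=> q /=; rewrite /cyl_gauge ge_max => /andP[h1 h2].
  by rewrite !halfb //; have [_ <-] := line_coordK q.1 mn1.
- move=> z z1; have [zE gz] := line_coordK z mn1.
  rewrite /= /k /= /half addNr mul0r (_ : (1 + 1) / 2 = 1) //; last first.
    by rewrite divff // (_ : 1 + 1 = 2) ?pnatr_eq0.
  have hz := halfb (line_coord z); rewrite -gz in hz.
  have [_ h1 h2 _] := FE (clamp (half (line_coord z))).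
  rewrite clampE ?hz // in h1 h2; rewrite h1 h2 !map_pathE !segmentE clampE ?hz //.
  rewrite -{3 6}zE /half; split; congr (_ _); apply/rowP => i; rewrite !mxE; lra.
- move=> z t z1; have [zE gz] := line_coordK z mn1.
  have hE : half (2 * ival t - 1) = ival t by rewrite /half; lra.
  rewrite /= /k /= hE -{2}zE; have [h1 _ _ h2] := FE t.
  have : `|line_coord z| = 1 by rewrite -gz.
  have [s0|s0] := leP 0 (line_coord z).
    rewrite ger0_norm // => ->; rewrite /half (_ : (1 + 1) / 2 = 1) //.
    by rewrite divff // (_ : 1 + 1 = 2) ?pnatr_eq0.
  rewrite ltr0_norm // => e; have -> : line_coord z = -1 by rewrite -e opprK.
  by rewrite /half addNr mul0r.
Qed.

(** The cylinder has dimension [m + n + 1], so its boundary is a sphere of dimension [m + n]. The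
    map prescribed there is [a] on the bottom, [b] on the top and the given paths on the side. *)
Lemma extend_paths2 : (2 <= m + n)%N ->
  (forall (x : X) (s : homotopy_group R (m + n) x), s = homotopy_group1 R (m + n) x) ->
  exists F, extends F.
Proof.
move=> mn2 asph; have mn0 : (0 < m + n)%N by apply: leq_trans mn2.
pose g (q : Q) : X := if q.2 <= -1 then a q.1.1 else if 1 <= q.2 then b q.1.2
  else f q.1 (clamp ((q.2 + 1) / 2)).
have cg : {within [set q | cyl_gauge q = 1], continuous g}.
  pose A1 : set Q := [set q | q.2 <= -1].
  pose A2 : set Q := [set q | 1 <= q.2].
  pose A3 : set Q := [set q | gauge q.1 = 1 /\ -1 <= q.2 <= 1].
  have c2 : continuous (fun q : Q => q.2) by exact: cont_snd.
  have cg1 : continuous (fun q : Q => gauge q.1).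
    by apply: cont_comp; [exact: cont_fst|exact: gauge_continuous].
  have cA1 : closed A1 by have /continuous_closedP/(_ _ (@closed_le _ (-1))) := c2.
  have cA2 : closed A2 by have /continuous_closedP/(_ _ (@closed_ge _ 1)) := c2.
  have cA3 : closed A3.
    have -> : A3 = (fun q : Q => gauge q.1) @^-1` [set x | x <= 1] `&`
        (fun q : Q => gauge q.1) @^-1` [set x | 1 <= x] `&`
        ((fun q : Q => q.2) @^-1` [set x | x <= 1] `&` (fun q : Q => q.2) @^-1` [set x | -1 <= x]).
      apply/seteqP; split => q.
        by move=> [h /andP[h1 h2]]; split; split => //=; rewrite h.
      by move=> [[h1 h2] [h3 h4]]; split; [apply: le_anti; apply/andP|apply/andP].
    by apply: closedI; apply: closedI; (apply: closed_comp => [? _|]; [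
      (exact: cg1 || exact: c2)|(exact: closed_le || exact: closed_ge)]).
  apply: (@continuous_subspaceW _ _ _ (A1 `|` A2 `|` A3)).
    move=> [z s] /= q1; have zle : gauge z <= 1 by rewrite -q1 /cyl_gauge le_max lexx.
    have [h|h] := leP s (-1); first by left; left.
    have [h'|h'] := leP 1 s; first by left; right.
    right; split; last by rewrite !ltW.
    move: q1; rewrite /cyl_gauge /=; have [h2 //|h2 s1] := leP `|s| (gauge z).
    exfalso; move: h h'.
    have [s0|s0] := leP 0 s; first by move: s1; rewrite ger0_norm // => ->; lra.
    by move: s1; rewrite ltr0_norm //; lra.
  apply: withinU_continuous => //; first exact: closedU.
    apply: withinU_continuous => //.
      apply: (@within_eq _ _ _ (fun q : Q => a q.1.1)).
        by move=> q h; rewrite /g ifT.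
      apply: continuous_subspaceT; apply: cont_comp; last exact: ca.
      by apply: cont_comp; [exact: cont_fst|exact: cont_fst].
    apply: (@within_eq _ _ _ (fun q : Q => b q.1.2)).
      move=> q h; rewrite /g ifF; last by apply/negbTE; rewrite -ltNge; move: h; rewrite /A2 /=; lra.
      by rewrite ifT.
    apply: continuous_subspaceT; apply: cont_comp; last exact: cb.
    by apply: cont_comp; [exact: cont_fst|exact: cont_snd].
  apply: (@within_eq _ _ _ (fun q : Q => f q.1 (clamp ((q.2 + 1) / 2)))).
    move=> q [h1 /andP[h2 h3]]; rewrite /g; case: ifPn => [h4|_].
      by rewrite clamp_le0 ?f0 //; lra.
    by case: ifPn => // h5; rewrite clamp_ge1 ?f1 //; lra.
  have cfA : {within A3, continuous (fun q : Q => f q.1)}.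
    apply: (within_comp (r := fst) _ _ cf).
      by apply: continuous_subspaceT; exact: cont_fst.
    by move=> q [].
  (* The paths vary continuously only over boundary points, so evaluation is uncurried over the
     subspace [A3] itself. *)
  apply: (@cont_comp (subspace A3) (subspace A3 * I)%type X
    (fun q => (q, clamp ((q.2 + 1) / 2))) (fun qt => f qt.1.1 qt.2)).
    apply: continuous_pair; first exact: cont_id.
    apply: (@continuous_subspaceT _ _ A3 (fun q : Q => clamp ((q.2 + 1) / 2))).
    apply: cont_comp; last exact: clamp_continuous.
    apply: cont_mul; last exact: cont_cst.
    by apply: cont_add; [exact: cont_snd|exact: cont_cst].
  exact: (@uncurry_path_continuous R (subspace A3) X (fun q => f q.1) cfA).
have [F [cF Fg]] := fill_ball mn0 asph cg.
apply: (@extend_cylinder F) => //.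
- move=> z z1; rewrite !Fg; last 2 first.
  + by rewrite /cyl_gauge /= normr1 max_r.
  + by rewrite /cyl_gauge /= normrN1 max_r.
  rewrite /g /= lexx; split => //; rewrite ifF ?lexx //.
  by apply/negbTE; rewrite -ltNge; lra.
- move=> z t z1; have := ival_ge0 t; have := ival_le1 t => t1 t0.
  rewrite Fg; last first.
    by rewrite /cyl_gauge /= z1 max_l // ler_norml; apply/andP; split; lra.
  rewrite /g /=; case: ifPn => [h|_].
    have -> : t = I0 by apply: ival_inj; rewrite ival0; lra.
    by rewrite f0.
  case: ifPn => [h|_].
    have -> : t = I1 by apply: ival_inj; rewrite ival1; lra.
    by rewrite f1.
  by rewrite (_ : (2 * ival t - 1 + 1) / 2 = ival t) ?ivalK //; lra.
Qed.

Lemma extend_paths : (forall N (x : X) (s : homotopy_group R N x), (2 <= N)%N ->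
    s = homotopy_group1 R N x) -> exists F, extends F.
Proof.
move=> asph; case mn: (m + n)%N => [|[|N]].
- exact: extend_paths0.
- exact: extend_paths1.
by apply: extend_paths2 => [|x s]; [rewrite mn|apply: asph; rewrite mn].
Qed.

End ExtendPaths.

Lemma filter_finite (J T : Type) (F : set J) (G : set_system T) (P : J -> set T) :
  Filter G -> finite_set F -> (forall i, F i -> G (P i)) ->
  G [set x | forall i, F i -> P i x].
Proof.
move=> FG /(@finite_seqP {classic J}) [s ->].
elim: s => [|i s IH] h; first by apply: (@filterS _ G _ setT) filterT => x _ i.
have h1 : G (P i) by apply: h; rewrite /= mem_head.
have h2 : G [set x | forall i, [set` s] i -> P i x].
  by apply: IH => j js; apply: h; rewrite /= inE; apply/orP; right.
apply: filterS (filterI h1 h2) => x [x1 x2] j /=.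
by rewrite inE => /orP [/eqP ->|/x2].
Qed.

(** * The cellular section *)

Section PathCells.
Variables (R : realType) (X : topologicalType) (K : CW_structure R X).
Notation I := (unitI R).
Notation J := (cell K).
Notation PC := (path_classes R X).
Implicit Types (i j : J) (p q : PC).

Definition pcell := (J * J * PC)%type.
Definition pdisk (c : pcell) := ('rV[R]_(dim c.1.1) * 'rV[R]_(dim c.1.2))%type.
Implicit Type c : pcell.

(** Carried as a separate predicate so that [pcell] stays a plain product, and index equalities can
    be handled componentwise. *)
Definition pvalid c := src c.2 = Phi (0 : 'rV[R]_(dim c.1.1)) /\
  tgt c.2 = Phi (0 : 'rV[R]_(dim c.1.2)).

Definition pret c (z : pdisk c) : pdisk c := (ret z.1, ret z.2).

(* The cells of the space of path classes: a pair of cells of [X] together with a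
   class joining their centres. *)
Definition pchar c (z : pdisk c) : PC :=
  transport (@Phi_continuous _ _ K c.1.1) (@Phi_continuous _ _ K c.1.2) c.2 (pret z).

Lemma pret_id c (z : pdisk c) : gauge z <= 1 -> pret z = z.
Proof. by rewrite gauge_box => /andP[h1 h2]; rewrite /pret !ret_id // -surjective_pairing. Qed.

Lemma gauge_pret c (z : pdisk c) : gauge (pret z) = Num.min 1 (gauge z).
Proof. by rewrite /gauge /pret /= !nrm_ret -min_maxr. Qed.

Lemma pret_continuous c : continuous (@pret c).
Proof.
by apply: continuous_pair; (apply: cont_comp; last exact: ret_continuous);
  [exact: cont_fst|exact: cont_snd].
Qed.

Lemma pchar_pret c (z : pdisk c) : pchar (pret z) = pchar z.
Proof. by rewrite /pchar pret_id // gauge_pret ge_min lexx. Qed.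

Lemma src_pchar c (z : pdisk c) : pvalid c -> src (pchar z) = Phi z.1.
Proof. by case=> h1 h2; rewrite src_transport // Phi_ret. Qed.

Lemma tgt_pchar c (z : pdisk c) : pvalid c -> tgt (pchar z) = Phi z.2.
Proof. by case=> h1 h2; rewrite tgt_transport // Phi_ret. Qed.

(** Slide both ends of [p] along straight segments to the centres of the cells; transporting back
    cancels these segments. *)
Lemma pchar_at i j (u : 'rV[R]_(dim i)) (v : 'rV[R]_(dim j)) p :
  nrm u <= 1 -> nrm v <= 1 -> src p = Phi u -> tgt p = Phi v ->
  exists alpha, pvalid (i, j, alpha) /\ @pchar (i, j, alpha) (u, v) = p.
Proof.
move=> u1 v1 pu pv.
have ci := @Phi_continuous _ _ K i; have cj := @Phi_continuous _ _ K j.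
exists (pmul (pmul (seg ci 0 u) p) (seg cj v 0)); split.
  split; first by rewrite src_mul ?tgt_mul ?src_mul ?src_seg ?tgt_seg.
  by rewrite tgt_mul ?tgt_mul ?src_seg ?tgt_seg.
rewrite /pchar pret_id ?gauge_box /= ?u1 // /transport /=.
rewrite (Prop_irrelevance (@Phi_continuous _ _ K i) ci) (Prop_irrelevance (@Phi_continuous _ _ K j) cj).
rewrite !pmulA ?src_mul ?tgt_mul ?src_mul ?tgt_mul ?src_seg ?tgt_seg //.
rewrite segM seg_id -pu pmul1p -pmulA ?src_seg ?tgt_seg //.
by rewrite segM seg_id -pv pmulp1.
Qed.

Lemma pchar_inj i j alpha beta (u : 'rV[R]_(dim i)) (v : 'rV[R]_(dim j)) :
  pvalid (i, j, alpha) -> pvalid (i, j, beta) ->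
  @pchar (i, j, alpha) (u, v) = @pchar (i, j, beta) (u, v) -> alpha = beta.
Proof.
move=> [a1 a2] [b1 b2] e.
have := transportM (@Phi_continuous _ _ K i) (@Phi_continuous _ _ K j) a1 a2 (pret (c := (i, j, alpha)) (u, v)) 0.
have := transportM (@Phi_continuous _ _ K i) (@Phi_continuous _ _ K j) b1 b2 (pret (c := (i, j, beta)) (u, v)) 0.
rewrite !transport0 // -[transport _ _ _ (pret (c := (i, j, beta)) _)]/(@pchar (i, j, beta) (u, v)) -e.
by move=> bE aE; rewrite /= in aE bE; rewrite aE [RHS]bE.
Qed.

(** For [w] close to [z] the segments joining their retractions map into the given nice sets, and by
    [transportM] they are exactly the connecting paths that [nbd] asks for. *)
Lemma pchar_continuous c : pvalid c ->
  (forall x (O : set X), open O -> O x -> exists U, [/\ nice R U, U x & U `<=` O]) ->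
  continuous (@pchar c).
Proof.
move=> [c1 c2] nb z; apply: cvg_path_classes => // U V nU nV Uz Vz.
have seg_near n (a : 'rV[R]_n -> X) (ca : continuous a) (v : 'rV[R]_n) (W : set X) :
    open W -> W (a v) -> \forall w \near v, forall t, W (a (segment v w t)) /\ W (a (segment w v t)).
  move=> oW Wv; have : nbhs (a v) W by exact: open_nbhs_nbhs.
  move=> /ca /nbhs_ballP [e /= e0 eW].
  near=> w; have wv : ball v e w by near: w; exact: nbhsx_ballx.
  move: wv; rewrite -ball_normE /ball_ /= => wv t.
  have t0 := ival_ge0 t; have t1 := ival_le1 t.
  split; apply: eW; rewrite -ball_normE /ball_ /= segmentE.
    have -> : v - ((1 - ival t) *: v + ival t *: w) = ival t *: (v - w).
      by apply/rowP => k; rewrite !mxE; ring.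
    by rewrite normrZ ger0_norm // (le_lt_trans _ wv) // ler_piMl.
  have -> : v - ((1 - ival t) *: w + ival t *: v) = (1 - ival t) *: (v - w).
    by apply/rowP => k; rewrite !mxE; ring.
  rewrite normrZ ger0_norm ?subr_ge0 // (le_lt_trans _ wv) // ler_piMl //.
  by rewrite gerBl.
move: Uz Vz; rewrite src_pchar // tgt_pchar // -(Phi_ret z.1) -(Phi_ret z.2) => Uz Vz.
have oU : open U by case: nU.
have oV : open V by case: nV.
have n1 := seg_near _ _ (@Phi_continuous _ _ K c.1.1) _ _ oU Uz.
have n2 := seg_near _ _ (@Phi_continuous _ _ K c.1.2) _ _ oV Vz.
have cr1 : (fun w : pdisk c => ret w.1) @ z --> ret z.1.
  by apply: (cont_comp (@cont_fst _ _) (@ret_continuous _ _)).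
have cr2 : (fun w : pdisk c => ret w.2) @ z --> ret z.2.
  by apply: (cont_comp (@cont_snd _ _) (@ret_continuous _ _)).
have m1 : \forall w \near z, forall t, U (Phi (segment (ret z.1) (ret w.1) t)) /\
  U (Phi (segment (ret w.1) (ret z.1) t)) := cr1 _ n1.
have m2 : \forall w \near z, forall t, V (Phi (segment (ret z.2) (ret w.2) t)) /\
  V (Phi (segment (ret w.2) (ret z.2) t)) := cr2 _ n2.
near=> w.
have w1 : forall t, U (Phi (segment (ret w.1) (ret z.1) t)).
  move=> t; have h : forall t, U (Phi (segment (ret z.1) (ret w.1) t)) /\ U (Phi (segment (ret w.1) (ret z.1) t)).
    by near: w.
  by case: (h t).
have w2 : forall t, V (Phi (segment (ret z.2) (ret w.2) t)).
  move=> t; have h : forall t, V (Phi (segment (ret z.2) (ret w.2) t)) /\ V (Phi (segment (ret w.2) (ret z.2) t)).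
    by near: w.
  by case: (h t).
exists (map_path (@Phi_continuous _ _ K c.1.1) (segment (ret w.1) (ret z.1))),
  (map_path (@Phi_continuous _ _ K c.1.2) (segment (ret z.2) (ret w.2))); split => //.
- by rewrite map_pathE segment1 src_pchar // Phi_ret.
- by rewrite map_pathE segment0 tgt_pchar // Phi_ret.
exact: (transportM (@Phi_continuous _ _ K c.1.1) (@Phi_continuous _ _ K c.1.2) c1 c2 (pret z) (pret w)).
Unshelve. all: by end_near. Qed.

End PathCells.

Section PathSection.
Variables (R : realType) (X : topologicalType) (K : CW_structure R X).
Notation I := (unitI R).
Notation J := (cell K).
Notation PC := (path_classes R X).
Implicit Types (i j : J) (p q : PC) (c : pcell K).

Let nb := @CW_nice R X K.

(* A selection that is continuous along the cells over [closed_cell a] and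
   [closed_cell b] is continuous on the set of classes with endpoints there:
   the compact disks are covered by finitely many neighbourhoods on which the
   class is determined by its endpoints. *)
Lemma near_pcell (gw : PC -> path_space R X) (a b : J) p0 (W : set (path_space R X)) :
  (forall alpha, pvalid (a, b, alpha) ->
    continuous (fun z : pdisk (a, b, alpha) => gw (pchar z))) ->
  nbhs (gw p0) W ->
  \forall p \near p0, closed_cell a (src p) -> closed_cell b (tgt p) -> W (gw p).
Proof.
move=> cgw gW.
pose B : set ('rV[R]_(dim a) * 'rV[R]_(dim b)) := ball_le 1 `*` ball_le 1.
have cB : compact B by apply: compact_setX; exact: ball_le_compact.
pose P p (z : 'rV[R]_(dim a) * 'rV[R]_(dim b)) :=
  src p = Phi z.1 -> tgt p = Phi z.2 -> W (gw p).
suff h : \forall p \near p0, B `<=` P p.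
  apply: filterS h => p BP; rewrite !closed_cellE => -[u u1 up] [v v1 vp].
  by apply: (BP (u, v)).
have /compact_near_coveringP ncB := cB.
apply: (ncB PC (nbhs p0) P) => z [z1 z2].
have hX : hausdorff_space X by exact: CW_hausdorff K.
(* Where the point of the disks does not match the endpoints of [p0], Hausdorff separation makes [P]
   vacuous nearby. *)
have sep (Z : topologicalType) (f : Z -> X) (g : PC -> X) w : continuous f -> continuous g ->
    f w <> g p0 -> \forall w' \near w & p \near p0, g p <> f w'.
  move=> cf cg fg; move: hX; rewrite open_hausdorff => /(_ (f w) (g p0)).
  case; first exact/eqP.
  move=> [A1 A2] /= [/set_mem h1 /set_mem h2] [q1 q2 /eqP A12].
  have n1 : nbhs (f w) A1 by exact: open_nbhs_nbhs.
  have n2 : nbhs (g p0) A2 by exact: open_nbhs_nbhs.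
  exists (f @^-1` A1, g @^-1` A2); first by split; [exact: cf|exact: cg].
  move=> [w' p] /= [w'A pA] e.
  have : (A1 `&` A2) (f w') by split => //; rewrite -e.
  by rewrite A12.
have [e1|ne1] := pselect (src p0 = Phi z.1); last first.
  have := sep _ (fun w : 'rV[R]_(dim a) * 'rV[R]_(dim b) => Phi w.1) (@src R X) z
    (cont_comp (@cont_fst _ _) (@Phi_continuous _ _ K a)) (src_continuous nb).
  move=> /(_ (fun e => ne1 (esym e))).
  by apply: filterS => -[w p] /= h e; case: (h e).
have [e2|ne2] := pselect (tgt p0 = Phi z.2); last first.
  have := sep _ (fun w : 'rV[R]_(dim a) * 'rV[R]_(dim b) => Phi w.2) (@tgt R X) z
    (cont_comp (@cont_snd _ _) (@Phi_continuous _ _ K b)) (tgt_continuous nb).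
  move=> /(_ (fun e => ne2 (esym e))).
  by apply: filterS => -[w p] /= h _ e; case: (h e).
have [alpha [va zE]] := pchar_at z1 z2 e1 e2.
rewrite -surjective_pairing in zE.
have [U [nU Up _]] := nb (@openT X) (Logic.I : setT (src p0)).
have [V [nV Vp _]] := nb (@openT X) (Logic.I : setT (tgt p0)).
have nN : nbhs p0 (nbd U V p0).
  by apply: open_nbhs_nbhs; split; [exact: nbd_open|exact: nbd_refl].
have n1 : \forall w \near z, W (gw (@pchar _ _ K (a, b, alpha) w)).
  by apply: (cgw alpha va z); rewrite zE.
have n2 : \forall w \near z, nbd U V p0 (@pchar _ _ K (a, b, alpha) w).
  have cz := pchar_continuous va nb.
  by apply: (cz z); rewrite zE.
exists ([set w | W (gw (@pchar _ _ K (a, b, alpha) w))] `&`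
  [set w | nbd U V p0 (@pchar _ _ K (a, b, alpha) w)], nbd U V p0).
  by split => //; exact: filterI.
move=> [w p] /= [[w1 w2] pN] s1 s2.
rewrite (nbd_inj nU nV pN w2) //; first by rewrite src_pchar.
by rewrite tgt_pchar.
Qed.

Lemma near_pcells (gw : PC -> path_space R X) (S : set (J * J)) p0 (W : set (path_space R X)) :
  finite_set S ->
  (forall ab, S ab -> forall alpha, pvalid (ab.1, ab.2, alpha) ->
    continuous (fun z : pdisk (ab.1, ab.2, alpha) => gw (pchar z))) ->
  nbhs (gw p0) W ->
  \forall p \near p0, (exists2 ab, S ab & closed_cell ab.1 (src p) /\ closed_cell ab.2 (tgt p)) ->
    W (gw p).
Proof.
move=> finS cgw gW.
have h := filter_finite (nbhs_filter p0) finS (fun ab Sab => near_pcell (cgw ab Sab) gW).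
by apply: filterS h => p h [ab Sab [h1 h2]]; exact: h ab Sab h1 h2.
Qed.

Lemma Phi_lower i (u : 'rV[R]_(dim i)) : exists i' (w : 'rV[R]_(dim i')),
  [/\ (dim i' <= dim i)%N, nrm w < 1, Phi u = Phi w & 1 <= nrm u -> (dim i' < dim i)%N].
Proof.
have [u1|u1] := ltP (nrm u) 1.
  by exists i, u; split => // h; move: (lt_le_trans u1 h); rewrite ltxx.
have [F [_ Fd /(_ u u1) [i' [w [Fi w1 uw]]]]] := Phi_boundary i.
by exists i', w; split => //; [rewrite ltnW // Fd|move=> _; exact: Fd].
Qed.

Definition prank c := (dim c.1.1 + dim c.1.2)%N.

Hypothesis asph : forall N (x : X) (s : homotopy_group R N x), (2 <= N)%N ->
  s = homotopy_group1 R N x.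

(** The choice depends on the set alone: boundary data that agree have the same set of extensions,
    hence the same chosen extension, as the recursion over cells demands. *)
Definition pick_fun (T : Type) (S : set T) (t0 : T) : T :=
  if pselect (exists t, S t) is left e then projT1 (cid e) else t0.

Lemma pick_funP (T : Type) (S : set T) (t0 : T) : (exists t, S t) -> S (pick_fun S t0).
Proof. by move=> e; rewrite /pick_fun; case: pselect => // e'; exact: (projT2 (cid e')). Qed.

Lemma cell_section (x0 : X) : exists gw : PC -> path_space R X,
  (forall p, path_class (gw p) = p) /\
  forall c, pvalid c -> continuous (fun z : pdisk c => gw (pchar z)).
Proof.
pose S c (f : pdisk c -> path_space R X) : set (pdisk c -> path_space R X) :=
  [set F | [/\ continuous F, forall z, pvalid c -> gauge z = 1 -> F z = f z &
    forall z, gauge z <= 1 -> path_class (F z) = pchar z]].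
pose E c (f : pdisk c -> path_space R X) (z : pdisk c) :=
  pick_fun (S c f) (fun=> cst_path R x0) (pret z).
have Eext c (f g : pdisk c -> path_space R X) :
    (forall z, pvalid c /\ 1 <= gauge z -> f z = g z) -> E c f = E c g.
  move=> fg; apply/funext => z; rewrite /E; congr (pick_fun _ _ _).
  by apply/seteqP; split => F [h1 h2 h3]; split => // w vc w1; rewrite h2 // fg // w1.
have cover p : exists c (z : pdisk c), (pvalid c /\ gauge z < 1) /\ pchar z = p.
  have [i [u [u1 pu]]] := Phi_cover K (src p).
  have [j [v [v1 pv]]] := Phi_cover K (tgt p).
  have [alpha [va zE]] := pchar_at (ltW u1) (ltW v1) (esym pu) (esym pv).
  by exists (i, j, alpha), (u, v); rewrite /gauge /= gt_max u1.
have uniq c (z : pdisk c) c' (z' : pdisk c') : pvalid c /\ gauge z < 1 ->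
    pvalid c' /\ gauge z' < 1 -> pchar z = pchar z' -> existT (@pdisk _ _ K) c z = existT _ c' z'.
  case: c z => -[i j] al [u v]; case: c' z' => -[i' j'] be [u' v'] /=.
  move=> [va +] [vb +] e; rewrite /gauge /= !gt_max => /andP[u1 v1] /andP[u1' v1'].
  have eu := Phi_uniq u1 u1' (etrans (esym (src_pchar (u, v) va))
    (etrans (congr1 (@src R X) e) (src_pchar (u', v') vb))).
  have ev := Phi_uniq v1 v1' (etrans (esym (tgt_pchar (u, v) va))
    (etrans (congr1 (@tgt R X) e) (tgt_pchar (u', v') vb))).
  have ii : i = i' := congr1 (@projT1 _ _) eu.
  have jj : j = j' := congr1 (@projT1 _ _) ev.
  subst i' j'.
  move: (existT_inj eu) (existT_inj ev) => uu vv; subst u' v'.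
  by rewrite (pchar_inj va vb e).
have lower c (z : pdisk c) : pvalid c /\ 1 <= gauge z ->
    exists c' (w : pdisk c'), [/\ (prank c' < prank c)%N, pvalid c' /\ gauge w < 1 & pchar z = pchar w].
  move=> [vc z1].
  have [i [u [iu u1 pu lu]]] := Phi_lower z.1.
  have [j [v [jv v1 pv lv]]] := Phi_lower z.2.
  have [| |al [va zE]] := @pchar_at _ _ K i j u v (pchar z) (ltW u1) (ltW v1).
  - by rewrite src_pchar.
  - by rewrite tgt_pchar.
  exists (i, j, al), (u, v); split => //; last by rewrite /gauge /= gt_max u1.
  move: z1; rewrite /prank /gauge /= le_max => /orP [/lu h|/lv h].
    by rewrite -addSn leq_add.
  by rewrite -addnS leq_add.
have [gw gwE] := @cell_rec PC (path_space R X) (pcell K) (@pdisk _ _ K) prank (@pchar _ _ K)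
  (fun c z => pvalid c /\ gauge z < 1) (fun c z => pvalid c /\ 1 <= gauge z) E cover uniq lower
  Eext (cst_path R x0).
suff main n c : pvalid c -> (prank c < n)%N -> continuous (fun z : pdisk c => gw (pchar z)) /\
    forall z : pdisk c, path_class (gw (pchar z)) = pchar z.
  exists gw; split => [p|c vc]; last by have [] := main _ c vc (ltnSn _).
  by have [c [z [[vc _] <-]]] := cover p; have [_] := main _ c vc (ltnSn _).
elim: n c => // n IH c vc; rewrite ltnS => cn.
pose f (z : pdisk c) := gw (pchar z).
have fS (z : pdisk c) : gauge z = 1 -> path_class (f z) = pchar z.
  move=> z1; rewrite /f; have [|c' [w [rk [vc' _] ->]]] := lower c z; first by rewrite z1.
  by apply: (IH c' vc' _).2; exact: leq_trans rk cn.
have cf : {within [set z : pdisk c | gauge z = 1], continuous f}.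
  have [F1 [fin1 F1d F1P]] := Phi_boundary c.1.1.
  have [F2 [fin2 F2d F2P]] := Phi_boundary c.1.2.
  (* Pairs of cells of [X] are counted here, not cells of the space of classes: the boundary meets
     finitely many pairs, and [near_pcells] copes with all classes over a pair at once. *)
  pose S' : set (J * J) := (F1 `*` [set c.1.2]) `|` ([set c.1.1] `*` F2).
  have finS : finite_set S'.
    by rewrite finite_setU; split; apply: finite_setX => //; exact: finite_set1.
  have S'c ab : S' ab -> forall alpha, pvalid (ab.1, ab.2, alpha) ->
      continuous (fun z : pdisk (ab.1, ab.2, alpha) => gw (pchar z)).
    move=> Sab alpha va; apply: (IH (ab.1, ab.2, alpha) va _).1; apply: leq_trans cn.
    case: ab Sab alpha va => a b /= [] [/= h1 h2] alpha va; rewrite /prank /= ?h1 ?h2.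
      by rewrite -addSn leq_add2r F1d.
    by rewrite -addnS leq_add2l F2d.
  apply/subspace_continuousP => z /= z1 W fW.
  have h := near_pcells finS S'c fW.
  have cz : pchar w @[w --> z] --> pchar z by exact: pchar_continuous nb _.
  have h' : \forall w \near z, (exists2 ab, S' ab & closed_cell ab.1 (src (pchar w)) /\
      closed_cell ab.2 (tgt (pchar w))) -> W (f w) := cz _ h.
  apply: filterS h' => w hw w1; apply: hw.
  rewrite src_pchar // tgt_pchar //.
  have := w1; rewrite /gauge /=; case: (leP (nrm w.1) (nrm w.2)) => _ e.
    have [|b [v [Fb v1 vE]]] := F2P w.2; first by rewrite e.
    exists (c.1.1, b); first by right.
    by split; [exact: Phi_closed_cell|rewrite vE; exact: Phi_closed_cell].
  have [|a [u [Fa u1 uE]]] := F1P w.1; first by rewrite e.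
  exists (a, c.1.2); first by left.
  by split; [rewrite uE; exact: Phi_closed_cell|exact: Phi_closed_cell].
have [c1 c2] := vc.
have fS' (z : pdisk c) : gauge z = 1 -> path_class (f z) =
    transport (@Phi_continuous _ _ K c.1.1) (@Phi_continuous _ _ K c.1.2) c.2 z.
  by move=> z1; rewrite fS // /pchar pret_id ?z1.
have [F [cF FS FE]] := extend_paths c1 c2 cf fS' asph.
have SF : S c f F.
  split => [|z _|z z1]; [exact: cF|exact: FS|].
  by rewrite FE // /pchar pret_id.
have [cG GS GE] := pick_funP (fun=> cst_path R x0) (ex_intro _ F SF).
set G := pick_fun _ _ in cG GS GE.
(* Inside this is the recursion equation; outside, [pret] lands on the boundary, where the chosen
   extension agrees with [f]. *)
have fG (z : pdisk c) : f z = G (pret z).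
  have [z1|z1] := ltP (gauge z) 1; first by rewrite /f gwE.
  by rewrite GS //; [rewrite /f pchar_pret|rewrite gauge_pret min_l].
split.
  suff -> : (fun z => gw (pchar z)) = fun z => G (pret z).
    by apply: cont_comp; [exact: pret_continuous|exact: cG].
  by apply/funext.
move=> z; rewrite -[gw _]/(f z) fG GE; first exact: pchar_pret.
by rewrite gauge_pret ge_min lexx.
Qed.

End PathSection.

(** * Flowing the endpoints *)

Ltac match_ends := solve [ repeat first [ assumption | congruence
  | rewrite src_inv | rewrite tgt_inv
  | (rewrite src_mul; [|match_ends]) | (rewrite tgt_mul; [|match_ends]) ] ].

(** Naturality of conjugation: two commuting squares let the [h] paths slide past [d1] and [d2],
    which become [m1] and [m2]. *)
Lemma pmul_conjugate (R : realType) (X : topologicalType)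
    (p d1 d2 h0 h1 h2 h3 m1 m2 : path_classes R X) :
  src h0 = src d1 -> tgt d1 = src p -> src h1 = src p -> tgt p = src d2 ->
  src h2 = tgt p -> src h3 = tgt d2 -> tgt h0 = src m1 -> tgt m1 = tgt h1 ->
  tgt h2 = src m2 -> pmul d1 h1 = pmul h0 m1 -> pmul d2 h3 = pmul h2 m2 ->
  pmul (pmul (pinv h0) (pmul (pmul d1 p) d2)) h3 =
  pmul (pmul m1 (pmul (pmul (pinv h1) p) h2)) m2.
Proof.
move=> e1 e2 e3 e4 e5 e6 e7 e8 e9 n1 n2.
have n1' : pmul (pinv h0) d1 = pmul m1 (pinv h1).
  rewrite -[d1 in LHS](@pmulK _ _ d1 h1); last by match_ends.
  rewrite n1 pmulA; [|match_ends|match_ends].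
  by rewrite pmulKV; last match_ends.
rewrite -(@pmulA _ _ d1 p d2); [|match_ends|match_ends].
rewrite (@pmulA _ _ (pinv h0) d1); [|match_ends|match_ends].
rewrite n1' -(@pmulA _ _ _ _ h3); [|match_ends|match_ends].
rewrite -(@pmulA _ _ p d2 h3); [|match_ends|match_ends].
rewrite n2 -(@pmulA _ _ m1 (pinv h1)); [|match_ends|match_ends].
rewrite -(@pmulA _ _ m1 _ m2); [|match_ends|match_ends].
rewrite -(@pmulA _ _ (pinv h1) p h2); [|match_ends|match_ends].
rewrite -(@pmulA _ _ (pinv h1) _ m2); [|match_ends|match_ends].
by rewrite -(@pmulA _ _ p h2 m2); [|match_ends|match_ends].
Qed.

Section Assembly.
Variables (R : realType) (X : topologicalType) (K : CW_structure R X).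
Notation I := (unitI R).
Notation PC := (path_classes R X).
Implicit Types (p q : PC).

Lemma pcat_continuous (Y : topologicalType) (a b : Y -> path_space R X) :
  continuous a -> continuous b -> (forall y, a y I1 = b y I0) ->
  continuous (fun y => pcat (a y) (b y)).
Proof.
move=> ca cb ab; apply: curry_path_continuous.
have -> : (fun yt : Y * I => pcat (a yt.1) (b yt.1) yt.2) =
    fun yt => if ival yt.2 <= 2^-1 then a yt.1 (lhalf yt.2) else b yt.1 (rhalf yt.2).
  by apply/funext => -[y t] /=; rewrite (pcatE (ab y)) concatE.
apply: (@paste_continuous R _ _ snd).
- exact: cont_snd.
- apply: (cont_comp (f := fun yt : Y * I => (yt.1, lhalf yt.2)) _ (uncurry_path_continuous ca)).
  apply: continuous_pair; first exact: cont_fst.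
  by apply: cont_comp; [exact: cont_snd|exact: lhalf_continuous].
- apply: (cont_comp (f := fun yt : Y * I => (yt.1, rhalf yt.2)) _ (uncurry_path_continuous cb)).
  apply: continuous_pair; first exact: cont_fst.
  by apply: cont_comp; [exact: cont_snd|exact: rhalf_continuous].
- by move=> yt h; rewrite (lhalf_mid h) (rhalf_mid h).
Qed.

Lemma rev_path_continuous (Y : topologicalType) (a : Y -> path_space R X) :
  continuous a -> continuous (fun y => rev_path (a y)).
Proof.
move=> ca; apply: curry_path_continuous.
apply: (cont_comp (f := fun yt : Y * I => (yt.1, irev yt.2)) _ (uncurry_path_continuous ca)).
apply: continuous_pair; first exact: cont_fst.
by apply: cont_comp; [exact: cont_snd|exact: irev_continuous].
Qed.

Variables (H : X -> I -> X) (HF : is_flow K H).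
Let cH := flow_continuous HF.
Let nb := @CW_nice R X K.

Let flow_path_subproof x : continuous (H x).
Proof.
apply: (cont_comp (f := fun t : I => (x, t)) _ cH).
by apply: continuous_pair; [exact: cont_cst|exact: cont_id].
Qed.

Definition flow_path x : path_space R X := path_of (@flow_path_subproof x).
Definition flow_end x : X := H x I1.

Lemma flow_path0 x : flow_path x I0 = x.
Proof. exact: (flow0 HF). Qed.

Lemma flow_path1 x : flow_path x I1 = flow_end x.
Proof. by []. Qed.

Lemma flow_path_continuous : continuous flow_path.
Proof. by apply: curry_path_continuous; exact: cH. Qed.

Lemma flow_end_continuous : continuous flow_end.
Proof.
apply: (cont_comp (f := fun x : X => (x, I1)) _ cH).
by apply: continuous_pair; [exact: cont_id|exact: cont_cst].
Qed.

Definition flow_class p : PC :=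
  pmul (pmul (pinv (path_class (flow_path (src p)))) p) (path_class (flow_path (tgt p))).

Lemma src_flow_class p : src (flow_class p) = flow_end (src p).
Proof.
by rewrite src_mul ?tgt_mul ?src_mul ?tgt_inv ?src_inv ?src_class ?tgt_class ?flow_path0.
Qed.

Lemma tgt_flow_class p : tgt (flow_class p) = flow_end (tgt p).
Proof.
by rewrite tgt_mul ?tgt_mul ?src_mul ?tgt_inv ?src_inv ?src_class ?tgt_class ?flow_path0.
Qed.

(** The square swept by flowing [d] has flow paths as vertical sides. *)
Lemma flow_natural (d : path_space R X) :
  pmul (path_class d) (path_class (flow_path (d I1))) =
  pmul (path_class (flow_path (d I0))) (path_class (map_path flow_end_continuous d)).
Proof.
pose k (st : R^o * R^o) := H (d (clamp st.1)) (clamp st.2).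
have ck : continuous k.
  apply: (cont_comp (f := fun st : R^o * R^o => (d (clamp st.1), clamp st.2)) _ cH).
  apply: continuous_pair.
    apply: (@cont_comp _ _ _ (fun st : R^o * R^o => clamp st.1) d); last exact: cts_fun.
    by apply: cont_comp; [exact: cont_fst|exact: clamp_continuous].
  by apply: cont_comp; [exact: cont_snd|exact: clamp_continuous].
have vert (s : R) : seg ck (s, 0) (s, 1) = path_class (flow_path (d (clamp s))).
  congr path_class; apply: path_eq => t; rewrite map_pathE segmentE /k /=.
  by rewrite -scalerDl subrK scale1r scaler0 add0r [_ *: _]mulr1 ivalK.
have := square_class ck; rewrite !vert.
rewrite (clamp_le0 (lexx 0)) (clamp_ge1 (lexx 1)).
have -> : seg ck (0, 0) (1, 0) = path_class d.
  congr path_class; apply: path_eq => t; rewrite map_pathE segmentE /k /=.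
  rewrite !scaler0 !addr0 add0r [_ *: _]mulr1 ivalK (clamp_le0 (lexx 0)).
  exact: (flow0 HF).
have -> : seg ck (0, 1) (1, 1) = path_class (map_path flow_end_continuous d) => [|-> //].
congr path_class; apply: path_eq => t; rewrite !map_pathE segmentE /k /=.
rewrite scaler0 add0r [ival t *: 1]mulr1 [(1 - ival t) *: 1]mulr1 subrK ivalK.
by rewrite (clamp_ge1 (lexx 1)).
Qed.

(** Connecting paths for [q] near [p] are carried by [flow_end] to connecting paths for the flowed
    classes, by naturality; it is enough to start in nice sets that [flow_end] maps into the given
    ones. *)
Lemma flow_class_continuous : continuous flow_class.
Proof.
move=> p; apply: (@cvg_path_classes R X nb PC (nbhs p) flow_class (flow_class p)) => U V nU nV.
rewrite src_flow_class tgt_flow_class => Up Vp.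
have oU : open U by case: nU.
have oV : open V by case: nV.
have preo W : open W -> open (flow_end @^-1` W).
  by move=> oW; have /continuousP := flow_end_continuous; apply.
have [U' [nU' U'p U'U]] := nb (preo _ oU) Up.
have [V' [nV' V'p V'V]] := nb (preo _ oV) Vp.
have nN : \forall q \near p, nbd U' V' p q.
  by apply: open_nbhs_nbhs; split; [exact: nbd_open|exact: nbd_refl].
apply: filterS nN => q [d1 [d2 [d1U d2V e1 e2 qE]]].
exists (map_path flow_end_continuous d1), (map_path flow_end_continuous d2); split.
- by move=> t; rewrite map_pathE; exact: U'U.
- by move=> t; rewrite map_pathE; exact: V'V.
- by rewrite map_pathE e1 src_flow_class.
- by rewrite map_pathE e2 tgt_flow_class.
have sq : src q = d1 I0 by rewrite qE src_mul ?tgt_mul ?src_mul ?src_class ?tgt_class.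
have tq : tgt q = d2 I1 by rewrite qE tgt_mul ?tgt_mul ?src_class ?tgt_class.
rewrite /flow_class sq tq qE.
have n1 := flow_natural d1; have n2 := flow_natural d2.
rewrite e1 in n1; rewrite e2 in n2.
by apply: pmul_conjugate; rewrite ?src_class ?tgt_class ?map_pathE ?flow_path0 ?flow_path1 ?e1 ?e2.
Qed.

Hypothesis asph : forall N (x : X) (s : homotopy_group R N x), (2 <= N)%N ->
  s = homotopy_group1 R N x.

Lemma CW_dpp (x0 : X) : dpp R X.
Proof.
have [gw [gwE cgw]] := cell_section K asph x0.
pose g p := pcat (pcat (flow_path (src p)) (gw (flow_class p))) (rev_path (flow_path (tgt p))).
have gw0 p : gw (flow_class p) I0 = flow_end (src p).
  by rewrite -src_flow_class -{2}(gwE (flow_class p)) src_class.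
have gw1 p : gw (flow_class p) I1 = flow_end (tgt p).
  by rewrite -tgt_flow_class -{2}(gwE (flow_class p)) tgt_class.
have a1 p : flow_path (src p) I1 = gw (flow_class p) I0 by rewrite gw0.
have a2 p : pcat (flow_path (src p)) (gw (flow_class p)) I1 = rev_path (flow_path (tgt p)) I0.
  by rewrite pcat1 // gw1 rev_path0.
exists g; split.
  apply: pcat_continuous => //.
    apply: pcat_continuous => //.
      by apply: cont_comp; [exact: src_continuous nb|exact: flow_path_continuous].
    (* The middle factor is the only one whose continuity is not formal. Near [p] both flowed
       endpoints lie in finitely many closed cells, which is exactly what [near_pcells] needs. *)
    move=> p W gW.
    have [F1 [fin1 F1P]] := flow_locally_finite HF (src p).
    have [F2 [fin2 F2P]] := flow_locally_finite HF (tgt p).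
    have fin12 : finite_set (F1 `*` F2) by exact: finite_setX.
    have h : \forall q \near flow_class p, (exists2 ab, (F1 `*` F2) ab &
        closed_cell ab.1 (src q) /\ closed_cell ab.2 (tgt q)) -> W (gw q).
      by apply: near_pcells => // ab _ alpha; exact: cgw.
    have h0 : \forall q \near p, (exists2 ab, (F1 `*` F2) ab &
        closed_cell ab.1 (src (flow_class q)) /\ closed_cell ab.2 (tgt (flow_class q))) ->
        W (gw (flow_class q)) := flow_class_continuous h.
    have h1 : \forall q \near p, exists2 i, F1 i & closed_cell i (flow_end (src q)) :=
      src_continuous nb F1P.
    have h2 : \forall q \near p, exists2 i, F2 i & closed_cell i (flow_end (tgt q)) :=
      tgt_continuous nb F2P.
    apply: filterS (filterI h0 (filterI h1 h2)) => q [hq [[i Fi qi] [j Fj qj]]].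
    by apply: hq; exists (i, j) => //; rewrite src_flow_class tgt_flow_class.
  apply: rev_path_continuous.
  by apply: cont_comp; [exact: tgt_continuous nb|exact: flow_path_continuous].
move=> p; rewrite /g -(pmul_pcat (a2 p)) -(pmul_pcat (a1 p)) gwE -pinv_class.
set h0 := path_class _; set h1 := path_class _.
have s0 : src h0 = src p by rewrite src_class flow_path0.
have s1 : src h1 = tgt p by rewrite src_class flow_path0.
rewrite /flow_class -/h0 -/h1 -pmulA; [|match_ends|match_ends].
rewrite pmulK; last match_ends.
by rewrite pmulVK.
Qed.

End Assembly.

Theorem theorem4p3 (R : realType) (X : topologicalType) (K : CW_structure R X) :
  connected [set: X] -> aspherical R X ->
  locally_finite_CW K \/ countable_CW K ->
  dpp R X.
Proof.
move=> _ [_ asph] _.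
(* A point is needed as default value for the recursions; over an empty space there are no path
   classes and the section is the empty map. *)
have [[x0 _]|noX] := pselect (exists x : X, True); last first.
  have noP : path_classes R X -> False by move=> p; apply: noX; exists (src p).
  by exists (fun p => False_rect _ (noP p)); split => p; case: (noP p).
have [H HF] := flow_exists K x0.
by apply: (CW_dpp HF) => // N x s; exact: asph.
Qed.
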